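(* Let $m\ge 1$ be a fixed integer and let $p=p_n$ be a sequence of positive integers with $p_n\to\infty$ as $n\to\infty$. For each $n$ let $\mathbf{x}_1,\ldots,\mathbf{x}_p$ be independent and identically distributed $\mathbb{R}^n$-valued random vectors. Let $v,w\in\overline{\mathbb{R}}=\mathbb{R}\cup\{\infty,-\infty\}$ with $v<w$, and for each $n$ let $g_n:\mathbb{R}^{mn}=(\mathbb{R}^n)^m\to(v,w)$ be a measurable and symmetric function. Assume that there exists a function $\mu:(v,w)\to[0,\infty)$ with $\lim_{x\to v}\mu(x)=\infty$ and $\lim_{x\to w}\mu(x)=0$ such that, for every $x\in(v,w)$ and as $n\to\infty$, (A1) $\binom{p}{m}\,\mathbb{P}\big(g_n(\mathbf{x}_1,\ldots,\mathbf{x}_m)>x\big)\to\mu(x)$, and (A2) $\mathbb{P}\big(g_n(\mathbf{x}_1,\ldots,\mathbf{x}_m)>x,\ g_n(\mathbf{x}_{m-l+1},\ldots,\mathbf{x}_{2m-l})>x\big)=o\big(p^{-(2m-l)}\big)$ for $l=1,\ldots,m-1$. Assume further that $H(\cdot)=\exp(-\mu(\cdot))$ is an extreme value distribution, i.e. $H\in\{\Lambda,\Phi_\alpha,\Psi_\alpha\}$ for some $\alpha>0$. Let $(L(k))_{k\ge1}$ be the record times of the running maxima of the points $T_{\mathbf{i}}=g_n(\mathbf{x}_{i_1},\ldots,\mathbf{x}_{i_m})$, and let $(\tau_k)_{k\ge1}$ be the sequence of discontinuity points of the process $Y$ on $(0,1]$. Then, as $n\to\infty$, $$J_n:=\sum_{k=1}^{p}\varepsilon_{p^{-1}L(k)}\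 \xrightarrow{\ d\ }\ J:=\sum_{k=1}^\infty\varepsilon_{\tau_k}$$ in $\mathcal{M}(0,1]$.
   Context: $\varepsilon_x$ denotes the Dirac measure at $x$. A function $g_n:(\mathbb{R}^n)^m\to\mathbb{R}$ is symmetric if $g_n(\mathbf{y}_1,\ldots,\mathbf{y}_m)=g_n(\mathbf{y}_{\pi(1)},\ldots,\mathbf{y}_{\pi(m)})$ for all arguments and all permutations $\pi$ of $\{1,\ldots,m\}$. Extreme value distributions: Gumbel $\Lambda(x)=\exp(-e^{-x})$, $x\in\mathbb{R}$ (with $(v,w)=(-\infty,\infty)$); Fréchet $\Phi_\alpha(x)=\exp(-x^{-\alpha})$, $x>0$ (with $(v,w)=(0,\infty)$); Weibull $\Psi_\alpha(x)=\exp(-|x|^\alpha)$, $x<0$ (with $(v,w)=(-\infty,0)$). Record times: for each $n$, $L(1)=1$ and $$L(k+1)=\inf\Big\{j>L(k):\ \max_{1\le i_1<\cdots<i_m\le j}T_{\mathbf{i}}>\max_{1\le i_1<\cdots<i_m\le L(k)}T_{\mathbf{i}}\Big\},\quad k\in\mathbb{N},$$ where $T_{\mathbf{i}}=g_n(\mathbf{x}_{i_1},\ldots,\mathbf{x}_{i_m})$ for $\mathbf{i}=(i_1,\ldots,i_m)$, $j$ ranges over integers $\le p$, the maximum over an empty index set is $-\infty$ and $\inf\emptyset=\infty$; only those $L(k)$ with $L(k)\le p$ contribute to $J_n$ as a point measure on $(0,1]$. The process $Y$: let $S_1=\{(z_1,\ldots,z_m):0<z_1<\cdots<z_m\le1\}$,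 let $(U_i)_{i\ge1}$ be iid random vectors uniformly distributed on $S_1$, and let $\Gamma_i=E_1+\cdots+E_i$ with $(E_i)$ iid standard exponential, independent of $(U_i)$. Put $\Delta_i=-\log\Gamma_i$ if $H=\Lambda$, $\Delta_i=\Gamma_i^{-1/\alpha}$ if $H=\Phi_\alpha$, $\Delta_i=-\Gamma_i^{1/\alpha}$ if $H=\Psi_\alpha$. Then $$Y(t)=\sup\{\Delta_i:\ U_i^{(m)}\le t,\ i\ge1\},\qquad t\in(0,1],$$ where $U_i^{(m)}$ is the $m$-th component of $U_i$. $Y$ is nondecreasing and almost surely constant between isolated jumps in $(0,1]$. $\mathcal{M}(0,1]$ is the space of point measures on $(0,1]$ with the vague topology, and $\xrightarrow{d}$ is convergence in distribution of random elements of this space. *)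

(* Defs.v *)
From HB Require Import structures.
From mathcomp Require Import all_boot all_order all_algebra finmap.
From mathcomp Require Import all_classical all_reals all_analysis.

Set Implicit Arguments.
Unset Strict Implicit.
Unset Printing Implicit Defensive.

Import Order.TTheory GRing.Theory Num.Theory numFieldNormedType.Exports.

Local Open Scope classical_set_scope.
Local Open Scope ring_scope.

Section independence.
Context d (T : measurableType d) (R : realType) (P : probability T R).

Definition mutually_independent (I : choiceType) (D : set I)
    (F : I -> set (set T)) :=
  forall (K : {fset I}) (A : I -> set T),
    (forall i, i \in K -> D i /\ F i (A i)) ->
    P (\bigcap_(i in [set` K]) A i) = (\prod_(i <- K) P (A i))%E.

Definition sigma_rv d' (S : measurableType d') (X : T -> S) : set (set T) :=
  preimage_set_system setT X measurable.

(* The random elements X i, i \in D, are independent and identically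
   distributed. *)
Definition iid (I : choiceType) d' (S : measurableType d') (D : set I)
    (X : I -> T -> S) :=
  [/\ forall i, D i -> measurable_fun setT (X i),
      mutually_independent D (fun i => sigma_rv (X i)) &
      forall i j B, D i -> D j -> measurable B ->
        P (X i @^-1` B) = P (X j @^-1` B)].

Definition independent_sequences d1 (S1 : measurableType d1)
    d2 (S2 : measurableType d2) (X : nat -> T -> S1) (Y : nat -> T -> S2) :=
  forall A B, <<s \bigcup_i sigma_rv (X i) >> A ->
              <<s \bigcup_i sigma_rv (Y i) >> B ->
    P (A `&` B) = (P A * P B)%E.

End independence.

(* The Lebesgue measure of R^m, as the m-fold iterated product of the
   Lebesgue measure of R. *)
Fixpoint lebesgue_tuple (R : realType) (m : nat) : set (m.-tuple R) -> \bar R :=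
  match m with
  | 0 => fun A => \d_[tuple] A
  | m'.+1 => fun A => (\int[lebesgue_measure]_x
                         lebesgue_tuple [set y : m'.-tuple R | A (cons_tuple x y)])%E
  end.

(* 0 < z_1 < ... < z_m <= 1 *)
Definition simplex (R : realType) (m : nat) : set (m.-tuple R) :=
  [set z | path <%R 0 z && (last 0 z <= 1)].
Arguments simplex : clear implicits.

Definition uniform_law d (T : measurableType d) (R : realType)
    (P : probability T R) (m : nat) (S : set (m.-tuple R))
    (U : T -> m.-tuple R) :=
  forall B, measurable B ->
    P (U @^-1` B) = (fine (lebesgue_tuple (B `&` S)) /
                     fine (lebesgue_tuple S))%:E.

Definition exponential_law d (T : measurableType d) (R : realType)
    (P : probability T R) (rate : R) (E : T -> R) :=
  forall B : set R, measurable B -> P (E @^-1` B) = exponential_prob rate B.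

Section extreme_value_distributions.
Context {R : realType}.

Inductive evd := Gumbel | Frechet of {posnum R} | Weibull of {posnum R}.

Definition evd_left (H : evd) : \bar R :=
  match H with Gumbel => -oo | Frechet _ => 0 | Weibull _ => -oo end%E.

Definition evd_right (H : evd) : \bar R :=
  match H with Gumbel => +oo | Frechet _ => +oo | Weibull _ => 0 end%E.

(* Only meant for evd_left H < x < evd_right H. *)
Definition evd_cdf (H : evd) (x : R) : R :=
  match H with
  | Gumbel => expR (- expR (- x))
  | Frechet a => expR (- (x `^ (- a%:num)))
  | Weibull a => expR (- (`|x| `^ a%:num))
  end.

Definition evd_level (H : evd) (gamma : R) : R :=
  match H with
  | Gumbel => - ln gamma
  | Frechet a => gamma `^ (- a%:num^-1)
  | Weibull a => - (gamma `^ (a%:num^-1))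
  end.

End extreme_value_distributions.
Arguments evd : clear implicits.

Section records.
Context {R : realType}.

(* An index i_1 < ... < i_m is an increasing tuple of naturals starting at 0:
   the paper's x_1, x_2, ... are X 0, X 1, ... *)
Definition T_ (m : nat) (V : Type) (g : m.-tuple V -> R) (X : nat -> V)
  (i : m.-tuple nat) : R := g (map_tuple X i).

Definition running_max (m : nat) (V : Type) (g : m.-tuple V -> R)
    (X : nat -> V) (j : nat) : \bar R :=
  (\big[maxe/-oo]_(i : m.-tuple 'I_j | sorted ltn (map val i))
     (T_ g X (map_tuple val i))%:E)%E.

(* record_time p M k is L(k+1), for the running maximum M and times up to p;
   None stands for the infimum of the empty set. *)
Fixpoint record_time (p : nat) (M : nat -> \bar R) (k : nat) : option nat :=
  if k is k'.+1 then
    if record_time p M k' is Some l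
    then ohead [seq j <- iota l.+1 (p - l) | (M l < M j)%E]
    else None
  else Some 1%N.

Definition scaled_record_time (p : nat) (M : nat -> \bar R) (k : nat) :
    option R :=
  if (k < p)%N then omap (fun l => l%:R / p%:R) (record_time p M k) else None.

End records.

Section point_measures.
Context {R : realType}.

Let E : set R := `]0, 1]%classic.

(* sum_k eps_(x k) over the k with x k <> None *)
Definition dirac_sum (x : nat -> option R) : {measure set R -> \bar R} :=
  mseries (fun k => if x k is Some t then \d_t else mzero) 0.

Definition locally_finite (mu : set R -> \bar R) :=
  forall K : set R, compact K -> K `<=` E -> (mu K < +oo)%E.

(* The points of the sequence lie in ]0, 1] and have no accumulation point
   there (they may accumulate at 0). *)
Definition radon_points (x : nat -> option R) :=
  (forall k t, x k = Some t -> E t) /\ locally_finite (dirac_sum x).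

(* M(0,1]: the measures are on R, but carried by ]0, 1]. Being sums of Dirac
   masses, they are determined on every subset of R, so that two of them that
   agree on Borel sets are equal. *)
Record point_measure := PointMeasure {
  pm_measure :> {measure set R -> \bar R} ;
  pm_radon : exists2 x, radon_points x & pm_measure = dirac_sum x }.

HB.instance Definition _ := gen_eqMixin point_measure.
HB.instance Definition _ := gen_choiceMixin point_measure.

Lemma radon_points_fin (x : nat -> option R) (n : nat) :
  (forall k t, x k = Some t -> E t) -> (forall k, (n <= k)%N -> x k = None) ->
  radon_points x.
Proof.
move=> xE xn; split=> // K _ _; rewrite /dirac_sum /= /mseries.
rewrite (@nneseries_split _ _ 0 n); last by move=> k _; exact: measure_ge0.
rewrite add0n.
rewrite eseries0 ?adde0; last by move=> k nk _; rewrite xn.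
apply: lte_sum_pinfty => k _; case: (x k) => [t|]; last exact: ltry.
exact: ltry.
Qed.

Lemma radon_points_none : radon_points (fun=> None).
Proof. exact: (@radon_points_fin _ 0). Qed.

Definition pm_zero : point_measure :=
  PointMeasure (ex_intro2 _ _ _ radon_points_none erefl).

(* The point measure with the given points, and 0 if these are not the points
   of a Radon measure on ]0, 1]. *)
Definition pm_of (x : nat -> option R) : point_measure :=
  if pselect (radon_points x) is left h
  then PointMeasure (ex_intro2 _ _ x h erefl) else pm_zero.

(* No junk value for the point process of scaled record times. *)
Lemma radon_scaled_record_time (p : nat) (M : nat -> \bar R) :
  radon_points (scaled_record_time p M).
Proof.
have L k l : (0 < p)%N -> record_time p M k = Some l -> (0 < l <= p)%N.
  move=> p0; case: k => [[<-]//|k /=].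
  case: (record_time p M k) => // l'.
  case Es: [seq _ <- _ | _] => [//|j s] /= [<-].
  have : j \in [seq j <- iota l'.+1 (p - l') | (M l' < M j)%E].
    by rewrite Es mem_head.
  rewrite mem_filter mem_iota => /and3P[_ l'j]; rewrite addSn ltnS => jp.
  rewrite (leq_trans _ l'j)//= (leq_trans jp)//.
  by case: (leqP l' p) => pl'; [rewrite subnKC|move: (leq_trans l'j jp); rewrite (eqP (ltnW pl' : _ - _ == 0)%N) addn0 ltnn].
apply: (@radon_points_fin _ p) => [k t|k pk]; rewrite /scaled_record_time; last first.
  by rewrite ltnNge pk.
case: ifPn => // kp; have p0 : (0 < p)%N by exact: leq_ltn_trans kp.
case El: record_time => [l|//] [<-]; have /andP[l0 lp] := L _ _ p0 El.
by rewrite /E /= in_itv /= divr_gt0 ?ltr0n//= ler_pdivrMr ?ltr0n// mul1r ler_nat.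
Qed.

(* C_K^+((0,1]) *)
Definition test_function :=
  { f : R -> R | [/\ forall t, E t -> 0 <= f t, {within E, continuous f} &
      exists2 K, compact K /\ K `<=` E & forall t, E t -> ~ K t -> f t = 0] }.

HB.instance Definition _ := gen_eqMixin test_function.
HB.instance Definition _ := gen_choiceMixin test_function.

Definition pm_integral (mu : point_measure) (f : test_function) : R :=
  \int[pm_measure mu]_(t in E) sval f t.

(* The vague topology: the coarsest one making mu |-> \int f dmu continuous
   for every test function f. *)
HB.instance Definition _ := Topological.copy point_measure
  (initial_topology
     (pm_integral : point_measure -> {ptws test_function -> R})).

End point_measures.
Arguments point_measure : clear implicits.

Definition cvg_in_distribution (R : realType) (S : topologicalType)
    (d : nat -> measure_display) (T : forall n, measurableType (d n))
    (P : forall n, probability (T n) R) (xi : forall n, T n -> S)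
    (d' : measure_display) (T' : measurableType d') (P' : probability T' R)
    (xi' : T' -> S) :=
  forall F : S -> R, continuous F -> (exists C, forall s, `|F s| <= C) ->
    ('E_(P n)[F \o xi n] @[n --> \oo] --> 'E_P'[F \o xi'])%E.

Section limit_process.
Context {R : realType} (H : evd R) (m : nat).

(* Only the values at t in ]0, 1] matter; u i and e i are U_(i+1), E_(i+1). *)
Definition limit_path (u : nat -> m.-tuple R) (e : nat -> R) (t : R) : \bar R :=
  ereal_sup [set (evd_level H (\sum_(j < i.+1) e j))%:E
            | i in [set i | last 0 (u i) <= t]].

End limit_process.

Definition discontinuities (R : realType) (y : R -> \bar R) : set R :=
  [set t : R | 0 < t <= 1 /\
    ~ (y s @[s --> within `]0, 1]%classic (nbhs t)] --> y t)].

(* tau lists every element of D exactly once; it may use finitely many indices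
   only. *)
Definition enumerates (R : Type) (D : set R) (tau : nat -> option R) :=
  (forall t, D t <-> exists k, tau k = Some t) /\
  (forall k l t, tau k = Some t -> tau l = Some t -> k = l).

(* Main.v *)
(* Fix K and a grid of mesh 1/q of ]0, 1]. By (A1), (A2) and Chebyshev's
   inequality, with probability tending to 1 the K largest kernels are distinct
   and carried by disjoint index sets. By exchangeability these index sets,
   ordered by decreasing kernel, are then uniformly distributed, so the K scaled
   maxima of the index sets fall in given grid cells with asymptotically the
   same probability as the last components V_1, ..., V_K of K independent uniform
   points of the simplex. If one of the K maxima is at most delta p, then the
   record times above delta p are the strict lower records of the sequence of the
   K maxima, just as the jumps of Y above delta are the strict lower records of
   V_1, ..., V_K once some V_i is at most delta. Hence J_n and J, tested against
   functions vanishing below delta, are the same function of points lying in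
   common cells. Convergence in distribution follows by bounding a continuous
   functional below and above by its extrema over the measures compatible with
   each cell, as K and q tend to infinity. *)
Require Import Defs.
From HB Require Import structures.
From mathcomp Require Import all_boot all_order all_algebra all_fingroup finmap.
From mathcomp Require Import all_classical all_reals all_analysis.
From mathcomp Require Import measurable_realfun.
From mathcomp Require Import ring lra zify.

Import Order.TTheory GRing.Theory Num.Theory numFieldNormedType.Exports.

Local Open Scope classical_set_scope.
Local Open Scope ring_scope.

Set Implicit Arguments.
Unset Strict Implicit.
Unset Printing Implicit Defensive.

(** * Convergence in distribution from matching cells *)

(** Hence the sandwich between simple functions on measurable cell events, which uses monotonicity
    alone. Only lower bounds on the cell probabilities are needed: the limiting ones sum to nearly
    1, so no mass can appear elsewhere. (A2) concerns overlapping pairs only, so ties between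
    kernels on disjoint index sets need an argument of their own. The range is cut into slabs: tied
    kernels share a slab, and the expected number of disjoint pairs in a slab is at most the square
    of its small expected count. Thresholds are parametrized by [a], the limiting expected number of
    kernels above them, using that [mu] equals [a] at [evd_level H a]. Chebyshev's inequality is
    applied at a mean well above [K]. Low records can be read from cells only when the cells are
    distinct; a coincidence costs about K^2 m / q, so [K] is chosen before the mesh. *)

Section portmanteau.
Import HBNNSimple.
Context {R : realType}.

(* No measurability: the integral of a nonnegative function is a supremum over
   the simple functions below it. *)
Lemma ge0_le_integralT d (T : measurableType d)
    (mu : {measure set T -> \bar R}) (f g : T -> \bar R) :
  (forall x, 0 <= f x)%E -> (forall x, f x <= g x)%E ->
  (\int[mu]_x f x <= \int[mu]_x g x)%E.
Proof.
move=> f0 fg; rewrite !ge0_integralTE//; last first.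
  by move=> x; exact: le_trans (fg x).
apply: ereal_sup_le => _ [h hf <-] /=.
by exists h => // x; exact: le_trans (fg x).
Qed.

Section simple_bounds.
Context d (T : measurableType d) (P : probability T R) (I : finType).
Variable (A : I -> set T).
Hypothesis mA : forall i, measurable (A i).
Hypothesis dA : forall i j om, A i om -> A j om -> i = j.

Lemma sum_indic_in (c : I -> R) i om : A i om -> \sum_j c j * \1_(A j) om = c i.
Proof.
move=> Ai; rewrite (bigD1 i)//= indicE mem_set// mulr1 big1 ?addr0// => j ji.
rewrite indicE memNset ?mulr0// => Aj.
by rewrite (dA Ai Aj) eqxx in ji.
Qed.

Lemma sum_indic_out (c : I -> R) om : (forall i, ~ A i om) ->
  \sum_j c j * \1_(A j) om = 0.
Proof. by move=> Ai; rewrite big1// => j _; rewrite indicE memNset ?mulr0. Qed.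

Lemma measurable_sum_indic (c : I -> R) :
  measurable_fun setT (fun om => \sum_j c j * \1_(A j) om).
Proof.
apply: measurable_sum => i; apply: measurable_funM => //.
Qed.

Lemma integral_sum_indic (c : I -> R) : (forall i, 0 <= c i) ->
  (\int[P]_om (\sum_j c j * \1_(A j) om)%:E)%E =
  (\sum_j c j * fine (P (A j)))%:E.
Proof.
move=> c0; under eq_integral do rewrite -sumEFin.
rewrite ge0_integral_sum//=.
- rewrite -sumEFin; apply: eq_bigr => i _.
  under eq_integral do rewrite EFinM.
  rewrite ge0_integralZl//=; last 2 first.
  - by apply/measurable_EFinP; exact: measurable_indic.
  - by rewrite lee_fin.
  by rewrite integral_indic// setIT EFinM fineK// fin_num_measure.
- by move=> i; apply/measurable_EFinP; exact: measurable_funM.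
- by move=> i om _; rewrite lee_fin mulr_ge0.
Qed.

Variables (lo hi : I -> R) (M : R) (F : T -> R).
Hypothesis F0M : forall om, 0 <= F om <= M.
Hypothesis lo_ge0 : forall i, 0 <= lo i.
Hypothesis hi_leM : forall i, hi i <= M.
Hypothesis FA : forall i om, A i om -> lo i <= F om <= hi i.

Lemma expectation_ge_cells :
  ((\sum_i lo i * fine (P (A i)))%:E <= 'E_P[F])%E.
Proof.
rewrite expectation.unlock -integral_sum_indic//; apply: ge0_le_integralT => om.
  by rewrite lee_fin sumr_ge0// => i _; rewrite mulr_ge0.
rewrite lee_fin; have [[i Ai]|] := pselect (exists i, A i om).
  by rewrite (sum_indic_in _ Ai); have /andP[] := FA Ai.
move=> /forallNP nA; rewrite sum_indic_out//; by have /andP[] := F0M om.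
Qed.

(** Off the cells [F] is bounded by [M]. In this form the cell probabilities carry the nonnegative
    weights [M - hi i], so lower bounds on them yield an upper bound on the expectation. *)
Lemma expectation_le_cells :
  ('E_P[F] <= (M - \sum_i (M - hi i) * fine (P (A i)))%:E)%E.
Proof.
have sM om : \sum_i (M - hi i) * \1_(A i) om <= M - F om.
  have [[i Ai]|] := pselect (exists i, A i om).
    rewrite (sum_indic_in _ Ai); have /andP[] := FA Ai; lra.
  move=> /forallNP nA; rewrite sum_indic_out//; have /andP[] := F0M om; lra.
have c0 i : 0 <= M - hi i by rewrite subr_ge0.
rewrite EFinB leeBrDr//.
rewrite -integral_sum_indic//.
(* [F] need not be measurable: it is first dominated by a simple function, and only then are the two
   integrals added. *)
apply: (@le_trans _ _ (\int[P]_om (M - \sum_i (M - hi i) * \1_(A i) om)%:E +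
   \int[P]_om (\sum_i (M - hi i) * \1_(A i) om)%:E)%E).
  apply: leeD => //; rewrite expectation.unlock; apply: ge0_le_integralT => om.
    by rewrite lee_fin; have /andP[] := F0M om.
  rewrite lee_fin; have := sM om; lra.
rewrite -ge0_integralD//=; first last.
- by apply/measurable_EFinP; exact: measurable_sum_indic.
- by move=> om _; rewrite lee_fin sumr_ge0// => i _; rewrite mulr_ge0.
- apply/measurable_EFinP; apply: measurable_funB => //.
  exact: measurable_sum_indic.
- move=> om _; rewrite lee_fin; have := sM om; have /andP[] := F0M om; lra.
under eq_integral do rewrite -EFinD subrK.
by rewrite integral_cst//= probability_setT mule1.
Qed.

End simple_bounds.

Unset Implicit Arguments.
Section cells.
Context (S : topologicalType).
Context (d : nat -> measure_display) (T : forall n, measurableType (d n)).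
Context (P : forall n, probability (T n) R) (xi : forall n, T n -> S).
Context (d' : measure_display) (T' : measurableType d').
Context (P' : probability T' R) (xi' : T' -> S).
Variables (I : nat -> finType) (A : forall n k, I k -> set (T n)).
Variables (B : forall k, I k -> set T') (C : forall k, I k -> set S).
Hypothesis mA : forall n k i, measurable (A n k i).
Hypothesis dA : forall n k i j om, A n k i om -> A n k j om -> i = j.
Hypothesis xiA : forall n k i om, A n k i om -> C k i (xi n om).
Hypothesis mB : forall k i, measurable (B k i).
Hypothesis dB : forall k i j om, B k i om -> B k j om -> i = j.
Hypothesis xiB : forall k i om, B k i om -> C k i (xi' om).
(** A one-sided bound is enough: by [B1] the cells nearly exhaust the limit law. *)
Hypothesis AB : forall k i e, 0 < e ->
  \forall n \near \oo, fine (P' (B k i)) - e <= fine (P n (A n k i)).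
Hypothesis B1 : \sum_i fine (P' (B k i)) @[k --> \oo] --> (1 : R).
(* Applied to selections [s] that nearly realize the infimum or the supremum of
   a continuous function on the cells. *)
Hypothesis shrink : forall om (s : nat -> S),
  (forall k i, B k i om -> C k i (s k)) ->
  (forall k, (forall i, ~ B k i om) -> s k = xi' om) ->
  s k @[k --> \oo] --> xi' om.

Section nonnegative.
Variables (F : S -> R) (M : R).
Hypothesis cF : continuous F.
Hypothesis F0M : forall s, 0 <= F s <= M.

Let lo k i := inf (F @` C k i).
Let hi k i := sup (F @` C k i).

Let lbF k i : has_lbound (F @` C k i).
Proof. by exists 0 => _ [s _ <-]; have /andP[] := F0M s. Qed.

Let ubF k i : has_ubound (F @` C k i).
Proof. by exists M => _ [s _ <-]; have /andP[] := F0M s. Qed.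

Let lohi k i s : C k i s -> lo k i <= F s <= hi k i.
Proof.
move=> Cs; rewrite /lo /hi; apply/andP; split.
  by apply: ge_inf => //; exists s.
by apply: ub_le_sup => //; exists s.
Qed.

Let lo_ge0 k i : 0 <= lo k i.
Proof.
rewrite /lo; have [->|C0] := eqVneq (F @` C k i) set0; first by rewrite inf0.
apply: lb_le_inf; first exact/set0P.
by move=> _ [s _ <-]; have /andP[] := F0M s.
Qed.

Let M_ge0 : 0 <= M.
Proof. by have /andP[/le_trans] := F0M (xi' point); apply. Qed.

Let hi_leM k i : hi k i <= M.
Proof.
rewrite /hi; have [->|C0] := eqVneq (F @` C k i) set0; first by rewrite sup0.
apply: ge_sup; first exact/set0P.
by move=> _ [s _ <-]; have /andP[] := F0M s.
Qed.

Let lo_leM k i : lo k i <= M.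
Proof.
rewrite /lo; have [->|/set0P[_ [s Cs _]]] := eqVneq (F @` C k i) set0.
  by rewrite inf0.
by have /andP[+ _] := lohi _ _ _ Cs; move/le_trans; apply; have /andP[] := F0M s.
Qed.

Let hi_ge0 k i : 0 <= hi k i.
Proof.
rewrite /hi; have [->|/set0P[_ [s Cs _]]] := eqVneq (F @` C k i) set0.
  by rewrite sup0.
by have /andP[_] := lohi _ _ _ Cs; apply: le_trans; have /andP[] := F0M s.
Qed.

Let D k om : R := \sum_i (hi k i - lo k i) * \1_(B k i) om.

Let hilo0 k i : B k i !=set0 -> 0 <= hi k i - lo k i.
Proof.
by move=> [om /xiB/lohi/andP[l h]]; rewrite subr_ge0 (le_trans l).
Qed.

Let D0M k om : 0 <= D k om <= M.
Proof.
rewrite /D; have [[i Bi]|] := pselect (exists i, B k i om).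
  rewrite (sum_indic_in (dB k) _ Bi) hilo0/=; last by exists om.
  by have := hi_leM k i; have := lo_ge0 k i; lra.
by move=> /forallNP nB; rewrite sum_indic_out// lexx.
Qed.

(** Selections within 1 / (k + 1) of the infimum and of the supremum of [F] on the cell both
    converge to [xi' om] by [shrink], and [F] is continuous there. *)
Let D_cvg0 om : D k om @[k --> \oo] --> (0 : R).
Proof.
have /choice[st Hst] : forall k, exists s : S * S,
  [/\ forall i, B k i om -> C k i s.1 /\ C k i s.2,
      (forall i, ~ B k i om) -> s.1 = xi' om /\ s.2 = xi' om &
      D k om <= F s.2 - F s.1 + 2 * k.+1%:R^-1].
  move=> k; have h0 : 0 < k.+1%:R^-1 :> R by rewrite invr_gt0.
  have [[i Bi]|] := pselect (exists i, B k i om); last first.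
    move=> /forallNP nB; exists (xi' om, xi' om); split => //=.
      by move=> i /nB.
    by rewrite /D sum_indic_out// subrr add0r mulr_ge0// ltW.
  have Ci := xiB _ _ _ Bi.
  have [_ [s1 Cs1 <-] s1lo] : exists2 e, (F @` C k i) e & e < lo k i + k.+1%:R^-1.
    by apply: inf_adherent => //; split => //; exists (F (xi' om)), (xi' om).
  have [_ [s2 Cs2 <-] s2hi] : exists2 e, (F @` C k i) e & hi k i - k.+1%:R^-1 < e.
    by apply: sup_adherent => //; split => //; exists (F (xi' om)), (xi' om).
  exists (s1, s2); split => /=.
  - by move=> j Bj; rewrite (dB _ _ _ _ Bj Bi).
  - by move=> /(_ _ Bi).
  - rewrite /D (sum_indic_in (dB k) _ Bi); move: s1lo s2hi.
    by move: (k.+1%:R^-1 : R) (lo k i) (hi k i) => h a b; lra.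
have s1 : F (st k).1 @[k --> \oo] --> F (xi' om).
  apply: (cvg_comp (fun k => (st k).1) F _ (cF (xi' om))); apply: shrink => k.
    by move=> i Bi; have [/(_ _ Bi)[]] := Hst k.
  by move=> nB; have [_ /(_ nB)[]] := Hst k.
have s2 : F (st k).2 @[k --> \oo] --> F (xi' om).
  apply: (cvg_comp (fun k => (st k).2) F _ (cF (xi' om))); apply: shrink => k.
    by move=> i Bi; have [/(_ _ Bi)[]] := Hst k.
  by move=> nB; have [_ /(_ nB)[]] := Hst k.
apply: (@squeeze_cvgr _ _ _ _ (fun=> 0)
    (fun k => F (st k).2 - F (st k).1 + 2 * k.+1%:R^-1)).
- near=> k; have [_ _ ->] := Hst k; rewrite andbT.
  by have /andP[] := D0M k om.
- exact: cvg_cst.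
- rewrite [X in _ --> X](_ : _ = F (xi' om) - F (xi' om) + 2 * 0); last first.
    by rewrite subrr mulr0 addr0.
  apply: cvgD; first exact: cvgB.
  apply: cvgM; [exact: cvg_cst|exact: cvg_harmonic].
Unshelve. all: by end_near. Qed.

Let width_cvg0 :
  \sum_i (hi k i - lo k i) * fine (P' (B k i)) @[k --> \oo] --> (0 : R).
Proof.
have mD k : measurable_fun setT (EFin \o D k).
  by apply/measurable_EFinP; exact: measurable_sum_indic.
have [] := @dominated_convergence _ _ R P' setT measurableT
  (fun k om => (D k om)%:E) (cst 0%E) (cst M%:E).
- exact: mD.
- exact: measurable_cst.
- by apply: aeW => om _; apply: cvg_EFin;
    [exact: nearW|exact: D_cvg0].
- exact: finite_measure_integrable_cst.
- apply: aeW => om k _; rewrite lee_fin ger0_norm.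
    by have /andP[] := D0M k om.
  by have /andP[] := D0M k om.
move=> _ _; rewrite integral0 => /fine_cvg.
apply: cvg_trans; apply: near_eq_cvg; apply: nearW => k /=.
(* An empty [B k i] gets the coefficient 0, which keeps all coefficients nonnegative; its indicator
   vanishes anyway. *)
rewrite (_ : (fun x => (D k x)%:E) =
  fun om => (\sum_i (if `[< B k i !=set0 >] then hi k i - lo k i else 0)
            * \1_(B k i) om)%:E).
  rewrite integral_sum_indic//=; last first.
    by move=> i; case: asboolP => // /hilo0.
  apply: eq_bigr => i _; case: asboolP => // Bi.
  rewrite (_ : B k i = set0) ?measure0 ?mulr0//.
  by apply/eqP; apply/negPn/negP => /set0P.
apply/funext => om; congr EFin; apply: eq_bigr => i _.
case: asboolP => // Bi; rewrite indicE memNset ?mulr0// => Bio.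
by apply: Bi; exists om.
Qed.

Let l k := \sum_i lo k i * fine (P' (B k i)).
Let u k := M - \sum_i (M - hi k i) * fine (P' (B k i)).

Lemma ge0_cvg_expectation_cells :
  ('E_(P n)[F \o xi n] @[n --> \oo] --> 'E_P'[F \o xi'])%E.
Proof.
have lP k : ((l k)%:E <= 'E_P'[F \o xi'])%E.
  by apply: (@expectation_ge_cells _ _ _ _ (B k) _ _ _ (hi k) M) => //= [|i om /xiB/lohi//]; exact: dB.
have uP k : ('E_P'[F \o xi'] <= (u k)%:E)%E.
  by apply: (@expectation_le_cells _ _ _ _ (B k) _ _ (lo k)) => //= [|i om /xiB/lohi//]; exact: dB.
have lPn n k : ((\sum_i lo k i * fine (P n (A n k i)))%:E <= 'E_(P n)[F \o xi n])%E.
  by apply: (@expectation_ge_cells _ _ _ _ (A n k) _ _ _ (hi k) M) => //= [|i om /xiA/lohi//]; exact: dA.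
have uPn n k : ('E_(P n)[F \o xi n] <= (M - \sum_i (M - hi k i) * fine (P n (A n k i)))%:E)%E.
  by apply: (@expectation_le_cells _ _ _ _ (A n k) _ _ (lo k)) => //= [|i om /xiA/lohi//]; exact: dA.
have fin d0 (T0 : measurableType d0) (P0 : probability T0 R) (G : T0 -> R) (a b : R) :
    (a%:E <= 'E_P0[G])%E -> ('E_P0[G] <= b%:E)%E -> 'E_P0[G]%E = (fine 'E_P0[G])%:E.
  by move=> aE Eb; rewrite fineK// fin_numElt (lt_le_trans _ aE) ?ltNyr//= (le_lt_trans Eb) ?ltry.
have EP := fin _ _ _ _ _ _ (lP 0) (uP 0).
have EPn n := fin _ _ _ _ _ _ (lPn n 0) (uPn n 0).
rewrite EP (_ : (fun n => _) = (fun n => (fine 'E_(P n)[F \o xi n])%:E)); last exact/funext.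
apply: cvg_EFin; first exact: nearW.
apply/cvgrPdist_le => e e0 /=.
(* The gap splits into the mass missed by the cells and the mean oscillation of [F] on them. *)
have ul0 : u k - l k @[k --> \oo] --> (0 : R).
  rewrite (_ : (fun k => _) = (fun k => M * (1 - \sum_i fine (P' (B k i))) +
      \sum_i (hi k i - lo k i) * fine (P' (B k i)))); last first.
    apply/funext => k; rewrite /u /l mulrBr mulr1 mulr_sumr -!addrA; congr (_ + _).
    rewrite -!sumrN -!big_split/=; apply: eq_bigr => i _; ring.
  rewrite [X in _ --> X](_ : _ = M * (1 - 1) + 0); last by rewrite subrr mulr0 addr0.
  apply: cvgD => //; apply: cvgM; first exact: cvg_cst.
  by apply: cvgB => //; exact: cvg_cst.
have e20 : 0 < e / 2 by rewrite divr_gt0.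
move/cvgrPdist_le : ul0 => /(_ _ e20)[k _ /(_ k (leqnn k))].
rewrite sub0r normrN => ulk.
(* Weights at most [M] over [#|I k|] labels turn a deficit of (e / 2) / cc per cell into a total of
   at most e / 2; the increments keep [cc] positive. *)
pose cc := (M + 1) * #|I k|.+1%:R.
have cc0 : 0 < cc by rewrite mulr_gt0// ltr_wpDl.
have e'0 : 0 < (e / 2) / cc by rewrite divr_gt0.
have near_sum (c : I k -> R) n : (forall i, 0 <= c i <= M) ->
    (forall i, fine (P' (B k i)) - (e / 2) / cc <= fine (P n (A n k i))) ->
    \sum_i c i * fine (P' (B k i)) - e / 2 <= \sum_i c i * fine (P n (A n k i)).
  move=> cM Pni; apply: (@le_trans _ _ (\sum_i (c i * fine (P' (B k i)) - (e / 2) / #|I k|.+1%:R))).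
    rewrite big_split/= sumrN lerD2l lerN2 sumr_const -[leLHS]mulr_natr.
    rewrite -[leLHS]mulrA; apply: ler_piMr; first exact: ltW.
    by rewrite ler_pdivrMl// mulr1 ler_nat leqW// max_card.
  apply: ler_sum => i _.
  apply: (@le_trans _ _ (c i * (fine (P' (B k i)) - (e / 2) / cc))); last first.
    by apply: ler_wpM2l => //; have /andP[] := cM i.
  rewrite mulrBr lerD2l lerN2 /cc.
  have /andP[ci0 ciM] := cM i.
  rewrite mulrCA ler_pM2l// invfM mulrA; apply: ler_piMl; first by rewrite invr_ge0.
  by rewrite ler_pdivrMr ?mul1r; [lra|rewrite ltr_wpDl].
near=> n.
have Pni i : fine (P' (B k i)) - (e / 2) / cc <= fine (P n (A n k i)).
  move: i; near: n; apply: filter_forall => i; exact: AB.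
have := lP k; have := uP k; have := lPn n k; have := uPn n k.
rewrite EP EPn !lee_fin => h1 h2 h3 h4.
have h5 := near_sum (lo k) n (fun i => introT andP (conj (lo_ge0 k i) (lo_leM k i))) Pni.
have h6 : \sum_i (M - hi k i) * fine (P' (B k i)) - e / 2 <=
   \sum_i (M - hi k i) * fine (P n (A n k i)).
  by apply: near_sum => // i; rewrite subr_ge0 hi_leM/= gerBl.
move: ulk h1 h2 h3 h4 h5 h6; rewrite /u /l ler_norml => /andP[ulk1 ulk2].
move=> h1 h2 h3 h4 h5 h6; rewrite ler_norml.
by apply/andP; split; lra.
Unshelve. all: by end_near. Qed.

End nonnegative.

Lemma cvg_in_distribution_cells : cvg_in_distribution P xi P' xi'.
Proof.
move=> F cF [M FM].
have M0 : 0 <= M by exact: le_trans (normr_ge0 _) (FM (xi' point)).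
(* Even without measurability, the integral is by definition that of the positive part minus that of
   the negative part. *)
have EB d0 (T0 : measurableType d0) (P0 : probability T0 R) (X : T0 -> S) :
    'E_P0[F \o X]%E = ('E_P0[(fun s => Num.max (F s) 0)%R \o X] -
                        'E_P0[(fun s => Num.max (- F s) 0)%R \o X])%E.
  rewrite expectation.unlock integralE; congr (_ - _)%E.
    by apply: eq_integral => om _; rewrite funeposE/= -EFin_max.
  by apply: eq_integral => om _; rewrite funenegE/= -EFin_max.
have fin d0 (T0 : measurableType d0) (P0 : probability T0 R) (G : T0 -> R) :
    (forall om, 0 <= G om <= M) -> 'E_P0[G]%E \is a fin_num.
  move=> GM; rewrite expectation.unlock ge0_fin_numE; last first.
    by apply: integral_ge0 => om _; rewrite lee_fin; have /andP[] := GM om.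
  apply: (@le_lt_trans _ _ (\int[P0]_om M%:E)%E); last first.
    by rewrite integral_cst//= probability_setT mule1 ltry.
  by apply: ge0_le_integralT => om; rewrite lee_fin; have /andP[] := GM om.
have bnd s : 0 <= Num.max (F s) 0 <= M.
  by rewrite le_max lexx orbT ge_max M0 (le_trans (ler_norm _) (FM s)).
have bnd' s : 0 <= Num.max (- F s) 0 <= M.
  by rewrite le_max lexx orbT ge_max M0 (le_trans (ler_norm _))// normrN.
rewrite EB; under eq_fun do rewrite EB.
apply: cvgeB.
- by apply: fin_num_adde_defr; apply: fin => om; exact: bnd.
- apply: (ge0_cvg_expectation_cells (fun s => Num.max (F s) 0) M) => //.
  move=> s; apply: continuous_max; [exact: cF|exact: cvg_cst].
- apply: (ge0_cvg_expectation_cells (fun s => Num.max (- F s) 0) M) => //.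
  move=> s; apply: (@continuous_max R S (fun s => - F s) (fun=> 0)).
    by apply: (@continuousN R R^o); exact: cF.
  exact: cvg_cst.
Qed.

End cells.
Set Implicit Arguments.
End portmanteau.
(** * Point measures *)

Section point_measures.
Context {R : realType}.
Implicit Types (f : @test_function R) (x : nat -> option R).

Lemma vague_cvg (s : nat -> point_measure R) (mu : point_measure R) :
  (forall f, pm_integral (s k) f @[k --> \oo] --> pm_integral mu f) ->
  s k @[k --> \oo] --> mu.
Proof.
move=> h A; rewrite nbhsE => -[B [[C oC <-] Cmu] BA].
have ptws : (fun k => pm_integral (s k) : {ptws test_function -> R}) @ \oo -->
    (pm_integral mu : {ptws test_function -> R}).
  apply/cvg_sup => f B'; rewrite nbhsE => -[D [[C' oC' <-] C'mu] DB].
  have hC : nbhs (pm_integral mu f) C' by exact: open_nbhs_nbhs.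
  by have := h f _ hC; apply: (@filterS _ \oo) => k Ck; exact: DB.
have : nbhs (pm_integral mu : {ptws test_function -> R}) C.
  by apply: open_nbhs_nbhs; split.
by move/ptws; apply: (@filterS _ \oo) => k Ck; exact: BA.
Qed.

Lemma compact_itvoc_away0 (K : set R) : compact K -> K `<=` `]0, 1]%classic ->
  exists2 del : R, 0 < del & forall t, K t -> del < t.
Proof.
move=> cK KE.
have : nbhs (0 : R) (~` K).
  apply: open_nbhs_nbhs; split.
    by apply: closed_openC; apply: compact_closed.
  by move=> /KE; rewrite /= in_itv/= ltxx.
move=> /nbhs_ballP[e /= e0 eK]; exists (e / 2); first by rewrite divr_gt0.
move=> t Kt; rewrite ltNge; apply/negP => te; apply: (eK t) => //.
have := KE _ Kt; rewrite /= in_itv/= => /andP[t0 t1].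
rewrite /ball/= sub0r normrN gtr0_norm// (le_lt_trans te)//.
by rewrite gtr_pMr// invf_lt1// ltr1n.
Qed.

Lemma test_function_support f : exists2 del : R, 0 < del &
  forall t, 0 < t <= 1 -> t <= del -> sval f t = 0.
Proof.
have [_ _ [K [cK KE] gK]] := svalP f.
have [del del0 Kdel] := compact_itvoc_away0 cK KE; exists del => // t t01 tdel.
by apply: gK; [rewrite /= in_itv/=|move=> /Kdel; rewrite ltNge tdel].
Qed.

Lemma eseries_fin (h : nat -> R) (N : nat) : (forall k, 0 <= h k) ->
  (forall k, (N <= k)%N -> h k = 0) ->
  (\sum_(k <oo) (h k)%:E = (\sum_(k < N) h k)%:E)%E.
Proof.
move=> h0 hN; rewrite (@nneseries_split _ _ 0 N); last first.
  by move=> k _; rewrite lee_fin.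
rewrite add0n eseries0 ?adde0; last by move=> k Nk _; rewrite hN.
by rewrite big_mkord sumEFin.
Qed.

(* [L] lists the atoms that [f] may charge. *)
Lemma pm_integral_enum x f (L : seq R) : radon_points x ->
  (forall k l t, x k = Some t -> x l = Some t -> k = l) -> uniq L ->
  (forall t, t \in L -> exists k, x k = Some t) ->
  (forall k t, x k = Some t -> t \notin L -> sval f t = 0) ->
  pm_integral (pm_of x) f = \sum_(t <- L) sval f t.
Proof.
move=> rx xinj uL Lx xL; rewrite /pm_integral /pm_of; case: pselect => //= {}rx.
have [xE _] := rx.
have [f0 cf _] := svalP f.
have mE : measurable (`]0%R, 1%R] : set R) by exact: measurable_itv.
have mf : measurable_fun (`]0%R, 1%R] : set R) (fun t => (sval f t)%:E).
  by apply/measurable_EFinP; apply: subspace_continuous_measurable_fun.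
pose h k := if x k is Some t then sval f t else 0.
have h0 k : 0 <= h k.
  by rewrite /h; case E : (x k) => [t|//]; apply: f0; exact: xE E.
rewrite /Rintegral ge0_integral_measure_series//.
pose m_ k : {measure set R -> \bar R} := if x k is Some t then \d_t else mzero.
have intE k : (\int[m_ k]_(t in `]0%R, 1%R])
    (sval f t)%:E)%E = (h k)%:E.
  rewrite /m_ /h; case E : (x k) => [t|]; last by rewrite integral_measure_zero.
  by rewrite integral_dirac// diracE mem_set ?mul1e//; exact: xE E.
rewrite (eq_eseriesr (fun k (_ : xpredT k) => intE k)).
(* [ix] picks the index of each listed atom; from [N] on, the series meets no listed atom and its
   terms vanish. *)
have /choice[ix ixP] : forall t, exists k, t \in L -> x k = Some t.
  move=> t; have [/Lx[k ?]|] := boolP (t \in L); first by exists k.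
  by exists 0.
pose N := (\max_(t <- L) ix t).+1.
have hN k : h k = \sum_(t <- L) (if x k == Some t then sval f t else 0).
  rewrite /h; case E : (x k) => [t|]; last first.
    by rewrite big1_seq// => t _; case: eqP.
  have [tL|tL] := boolP (t \in L); last first.
    rewrite (xL _ _ E tL) big1_seq// => u /andP[_ uL'].
    by case: eqP => // -[tu]; rewrite tu uL' in tL.
  rewrite (bigD1_seq t)//= eqxx big1 ?addr0// => u ut.
  by case: eqP => // -[tu]; rewrite tu eqxx in ut.
rewrite (@eseries_fin _ N)//=; last first.
  move=> k Nk; rewrite hN big1_seq// => t /andP[_ tL]; case: eqP => // xk.
  have ik : ix t = k by apply: xinj (ixP _ tL) xk.
  move: Nk; rewrite /N ltnNge -ik => /negP[].
  by rewrite (big_rem t)//= leq_maxl.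
under eq_bigr do rewrite hN.
rewrite exchange_big/=; apply: eq_big_seq => t tL.
have ixN : (ix t < N)%N by rewrite ltnS (big_rem t)//= leq_maxl.
rewrite (bigD1 (Ordinal ixN))//= ixP// eqxx big1 ?addr0// => k kix.
case: eqP => // xk; case/eqP : kix; apply/val_inj => /=.
by apply: xinj xk (ixP _ tL).
Qed.

(** A compact subset of ]0, 1] stays above some [del], where the points lie in a finite list; by
    injectivity each of them is counted once. *)
Lemma radon_points_inj x : (forall k t, x k = Some t -> 0 < t <= 1) ->
  (forall k l t, x k = Some t -> x l = Some t -> k = l) ->
  (forall del, 0 < del ->
     exists L : seq R, forall k t, x k = Some t -> del < t -> t \in L) ->
  radon_points x.
Proof.
move=> xE xinj xL; split=> [k t /xE|K cK KE]; first by rewrite /= in_itv.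
have [del del0 Kdel] := compact_itvoc_away0 cK KE.
have [L LP] := xL _ del0.
have /choice[ix ixP] : forall t, exists k, (exists l, x l = Some t) -> x k = Some t.
  move=> t; have [[l xl]|nx] := pselect (exists l, x l = Some t); first by exists l.
  by exists 0.
pose N := (\max_(t <- L) ix t).+1.
rewrite /dirac_sum /= /mseries.
rewrite (@nneseries_split _ _ 0 N); last by move=> k _; exact: measure_ge0.
rewrite add0n eseries0 ?adde0.
  apply: lte_sum_pinfty => k _; case: (x k) => [t|]; last exact: ltry.
  exact: ltry.
move=> k Nk _; case E : (x k) => [t|//].
have [Kt|Kt] := pselect (K t); last by rewrite /= diracE memNset.
have tL := LP _ _ E (Kdel _ Kt).
have ik : ix t = k by apply/esym; apply: (xinj _ _ _ E); apply: ixP; exists k.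
by move: Nk; rewrite /N ltnNge -ik => /negP[]; rewrite (big_rem t)//= leq_maxl.
Qed.

End point_measures.
(** * Record times *)

Section record_times.
Context {R : realType}.
Variables (p : nat) (M : nat -> \bar R).
Hypothesis p_gt0 : (0 < p)%N.
Hypothesis M_nd : forall i j, (i <= j)%N -> (M i <= M j)%E.

(** Filtering keeps the interval of times sorted, so the head is the least element. *)
Lemma next_recordP (l j : nat) : (l <= p)%N ->
  ohead [seq j <- iota l.+1 (p - l) | (M l < M j)%E] = Some j <->
  [/\ (l < j <= p)%N, (M l < M j)%E &
     forall i, (l < i <= p)%N -> (M l < M i)%E -> (j <= i)%N].
Proof.
move=> lp; set F := [seq _ <- _ | _].
have memF i : (i \in F) = (M l < M i)%E && (l < i <= p)%N.
  by rewrite mem_filter mem_iota addSn subnKC.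
have sF : sorted ltn F by apply: sorted_filter; [exact: ltn_trans|exact: iota_ltn_sorted].
case: F memF sF => [|j' s] memF sF /=.
  by split=> // -[lj Mj _]; have := memF j; rewrite in_nil lj Mj.
have jmin i : i \in j' :: s -> (j' <= i)%N.
  rewrite inE => /predU1P[->//|si].
  by move: sF => /= /(order_path_min ltn_trans)/allP/(_ _ si)/ltnW.
have /andP[Mj' lj'] : (M l < M j')%E && (l < j' <= p)%N by rewrite -memF mem_head.
split=> [[<-]|[lj Mj jm]].
  by split=> // i li Mi; apply: jmin; rewrite memF Mi.
congr Some; apply/eqP; rewrite eqn_leq jm// andbT jmin// memF Mj.
by rewrite lj.
Qed.

Lemma record_time_bound k l : record_time p M k = Some l -> (k < l <= p)%N.
Proof.
elim: k l => [l [<-]//|k IH l /=].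
case E : record_time => [l'|//]; have /andP[kl l'p] := IH _ E.
by move=> /next_recordP[]// /andP[l'l ->]; rewrite (leq_ltn_trans kl).
Qed.

Lemma record_time_lt k k' l l' : record_time p M k = Some l ->
  record_time p M k' = Some l' -> (k < k')%N -> (l < l')%N.
Proof.
move=> Ek; elim: k' l' => // k' IH l' /=.
case E : record_time => [l2|//]; have /andP[_ l2p] := record_time_bound E.
move=> /next_recordP[]// /andP[l2l' _] _ _; rewrite ltnS leq_eqVlt => /predU1P[kk'|/(IH _ E)].
  by move: E; rewrite -kk' Ek => -[->].
by move=> /ltn_trans; apply.
Qed.

Lemma record_time_inj k k' l : record_time p M k = Some l ->
  record_time p M k' = Some l -> k = k'.
Proof.
move=> E E'; case: (ltngtP k k') => //.
  by move=> /(record_time_lt E E'); rewrite ltnn.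
by move=> /(record_time_lt E' E); rewrite ltnn.
Qed.

(** Otherwise [M] would exceed its value at the previous record time already at [l.-1], against the
    minimality of [l]. *)
Lemma record_time_record k l : record_time p M k = Some l -> (1 < l)%N ->
  (M l.-1 < M l)%E.
Proof.
case: k => [[<-]//|k /=]; case E : record_time => [l'|//].
have /andP[_ l'p] := record_time_bound E.
move=> /next_recordP[]// /andP[l'l lp] Ml' lmin l1.
rewrite (le_lt_trans _ Ml')//; case: l => [|l]// in l'l lp Ml' lmin l1 *.
rewrite /= leNgt; apply/negP => Ml; move: (l'l); rewrite ltnS leq_eqVlt.
move=> /predU1P[ll|l'l2]; first by rewrite ll ltxx in Ml.
by have := lmin l; rewrite l'l2 (ltnW lp) ltnn => /(_ isT Ml).
Qed.

(** If [j] were missed, each record time below [j] would have a successor below [j]. The one of rank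
    [k] being larger than [k], this fails at [k = j]. *)
Lemma record_time_exists j : (1 < j <= p)%N -> (M j.-1 < M j)%E ->
  exists k, record_time p M k = Some j.
Proof.
move=> /andP[j1 jp] Mj; apply: contrapT => /forallNP nj.
have H k : exists2 l, record_time p M k = Some l & (l < j)%N.
  elim: k => [|k [l E lj]]; first by exists 1%N.
  have Ml : (M l < M j)%E by rewrite (le_lt_trans _ Mj)// M_nd// -ltnS prednK// (ltn_trans _ j1).
  have lp : (l <= p)%N by rewrite (leq_trans (ltnW lj)).
  have [l' E'] : exists l', record_time p M k.+1 = Some l'.
    rewrite /= E; case F : [seq _ <- _ | _] => [|l' s]; last by exists l'.
    have : j \in [seq j <- iota l.+1 (p - l) | (M l < M j)%E].
      by rewrite mem_filter Ml mem_iota lj addSn subnKC.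
    by rewrite F.
  exists l' => //; move: (E'); rewrite /= E => /next_recordP[]// _ _ /(_ j).
  rewrite lj jp => /(_ isT Ml); rewrite leq_eqVlt => /predU1P[l'j|//].
  by case: (nj k.+1); rewrite E' l'j.
have [l /record_time_bound/andP[jl _] lj] := H j.
by move: (ltn_trans jl lj); rewrite ltnn.
Qed.

(** Trades the recursion for the increments of [M]. Time 1 is a record time by definition, whence
    the guard [1 < j]. *)
Lemma scaled_record_timeP (t : R) :
  (exists k, scaled_record_time p M k = Some t) <->
  exists j, [/\ (0 < j <= p)%N, t = j%:R / p%:R &
                (1 < j)%N -> (M j.-1 < M j)%E].
Proof.
split=> [[k]|[j [/andP[j0 jp] -> Mj]]]; rewrite /scaled_record_time.
  case: ifP => // kp; case E : record_time => [j|//] [<-].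
  exists j; split=> //; first by have /andP[kj ->] := record_time_bound E; rewrite (leq_trans _ kj).
  by move=> /(record_time_record E).
have [k E] : exists k, record_time p M k = Some j.
  have [j1|j1] := ltnP 1 j; first by apply: record_time_exists; [rewrite j1|exact: Mj].
  by exists 0; congr Some; apply/eqP; rewrite eqn_leq j0 j1.
have /andP[kj _] := record_time_bound E.
by exists k; rewrite (leq_trans kj jp) E.
Qed.

Lemma scaled_record_time_inj k l (t : R) : scaled_record_time p M k = Some t ->
  scaled_record_time p M l = Some t -> k = l.
Proof.
rewrite /scaled_record_time; case: ifP => // _; case: ifP => // _.
case E : record_time => [i|//] [<-]; case E' : record_time => [j|//] [].
move=> /(congr1 ( *%R^~ p%:R)); rewrite !divfK ?pnatr_eq0 -?lt0n// => /eqP.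
rewrite eqr_nat => /eqP ji; rewrite ji in E'; exact: record_time_inj E E'.
Qed.

End record_times.
(* Indices start at 0 and times at 1: next_max u is the first j for which the
   running maximum at j takes the index set u into account. *)
Definition next_max (u : seq nat) : nat := \max_(x <- u) x.+1.

Lemma next_max_leq (u : seq nat) j : (next_max u <= j)%N = all (fun x => (x < j)%N) u.
Proof.
apply/bigmax_leqP_seq/allP => h x xu; first exact: (h x).
by move=> _; exact: h.
Qed.

Lemma perm_next_max (u v : seq nat) : perm_eq u v -> next_max u = next_max v.
Proof. by move=> uv; rewrite /next_max (perm_big _ uv). Qed.

(** Over any ordered type, because records are compared between integer times, real points and cell
    labels. *)
Definition low_record disp (T : orderType disp) K (w : 'I_K -> T) (i : 'I_K) :=
  [forall i' : 'I_K, (i' < i)%N ==> (w i < w i')%O].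

Lemma eq_low_record disp disp' (T : orderType disp) (T' : orderType disp') K
    (w : 'I_K -> T) (w' : 'I_K -> T') :
  (forall i j, (w i < w j)%O = (w' i < w' j)%O) ->
  low_record w =1 low_record w'.
Proof. by move=> h i; apply: eq_forallb => j; rewrite h. Qed.

Section running_maximum.
Context {R : realType} (m : nat) (V : Type) (g : m.-tuple V -> R).
Hypothesis g_sym : forall (s : 'S_m) (y : m.-tuple V),
  g [tuple tnth y (s k) | k < m] = g y.
Variable X : nat -> V.

Local Notation T := (T_ g X).

Lemma perm_T (u v : m.-tuple nat) : perm_eq u v -> T u = T v.
Proof.
case/tuple_permP => s us; rewrite /T_ -[RHS](g_sym s); congr g.
apply: eq_from_tnth => i; rewrite tnth_mktuple !tnth_map; congr X.
have -> : u = [tuple tnth v (s i) | i < m] by apply/val_inj.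
by rewrite tnth_mktuple.
Qed.

(** [running_max] ranges over increasing indices only; sorting [u] preserves its kernel by
    symmetry. *)
Lemma le_running_max (u : m.-tuple nat) j : uniq u -> (next_max u <= j)%N ->
  ((T u)%:E <= running_max g X j)%E.
Proof.
move=> uu; rewrite next_max_leq => /allP uj.
have su : perm_eq u (sort_tuple leq u) by rewrite perm_sym perm_sort.
have sj k : (tnth (sort_tuple leq u) k < j)%N.
  by apply: uj; rewrite (perm_mem su) mem_tnth.
pose i : m.-tuple 'I_j := [tuple Ordinal (sj k) | k < m].
have vi : map_tuple val i = sort_tuple leq u.
  by apply: eq_from_tnth => k; rewrite tnth_map tnth_mktuple.
rewrite (perm_T su) -vi /running_max; apply: le_bigmax_cond.
have -> : map val i = sort leq u by have := congr1 val vi.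
by rewrite ltn_sorted_uniq_leq sort_uniq uu; apply: sort_sorted; exact: leq_total.
Qed.

Lemma running_max_le (c : \bar R) j :
  (forall u : m.-tuple nat, uniq u -> (next_max u <= j)%N -> (T u)%:E <= c)%E ->
  (running_max g X j <= c)%E.
Proof.
move=> h; apply: bigmax_le => [|i si]; first exact: leNye.
apply: h; first by have := sorted_uniq ltn_trans ltnn si.
by rewrite next_max_leq; apply/allP => _ /mapP[k _ ->]; exact: ltn_ord.
Qed.

Lemma running_max_lt (c : R) j :
  (forall u : m.-tuple nat, uniq u -> (next_max u <= j)%N -> T u < c) ->
  (running_max g X j < c%:E)%E.
Proof.
move=> h; rewrite /running_max; elim/big_ind: _ => [|x y xc yc|i si].
- exact: ltNyr.
- by rewrite gt_max xc.
rewrite lte_fin; apply: h; first by have := sorted_uniq ltn_trans ltnn si.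
by rewrite next_max_leq; apply/allP => _ /mapP[k _ ->]; exact: ltn_ord.
Qed.

Lemma running_max_nd i j : (i <= j)%N -> (running_max g X i <= running_max g X j)%E.
Proof.
move=> ij; apply: running_max_le => u uu ui; apply: le_running_max => //.
exact: leq_trans ij.
Qed.

Section top.
Variables (p K : nat) (f : 'I_K -> m.-tuple nat).
Hypothesis f_uniq : forall i, uniq (f i).
Hypothesis f_dec : forall i j : 'I_K, (i < j)%N -> T (f j) < T (f i).
Hypothesis f_top : forall u : m.-tuple nat, uniq u -> (next_max u <= p)%N ->
  (forall i, ~~ perm_eq u (f i)) -> forall i, T u < T (f i).

Let w i := next_max (f i).

Let f_ge (i j : 'I_K) : (i <= j)%N -> T (f j) <= T (f i).
Proof.
rewrite leq_eqVlt => /predU1P[/val_inj->//|/f_dec]; exact: ltW.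
Qed.

(** Once one of the [K] top index sets is complete, the running maximum is the kernel of the best
    ranked complete one. It jumps at [j] exactly when that set is completed at [j], strictly before
    all better ranked sets. *)
Lemma top_record j : (0 < j <= p)%N -> (exists i, (w i <= j)%N) ->
  (running_max g X j.-1 < running_max g X j)%E <->
  exists2 i, w i = j & low_record w i.
Proof.
case: j => // j /andP[_ jp] [i0 i0j] /=.
have [i ij imin] : exists2 i, (w i <= j.+1)%N &
    forall i', (w i' <= j.+1)%N -> (i <= i')%N.
  by case: (@arg_minnP _ i0 (fun i => w i <= j.+1)%N val i0j) => i ij h; exists i.
have Mj : running_max g X j.+1 = (T (f i))%:E.
  apply/eqP; rewrite eq_le le_running_max// andbT; apply: running_max_le => u uu uj.
  rewrite lee_fin; have [/existsP[i' ui']|/existsPn nu] := boolP [exists i', perm_eq u (f i')].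
    rewrite (perm_T ui'); apply: f_ge; apply: imin.
    by rewrite /w -(perm_next_max ui').
  by apply: ltW; apply: f_top => //; exact: leq_trans uj jp.
rewrite Mj; split=> [Mj1|[k wk /forallP rk]].
  have wi : w i = j.+1.
    apply/eqP; rewrite eqn_leq ij/= ltnNge; apply/negP => wij.
    by move: Mj1; rewrite ltNge le_running_max.
  exists i => //; apply/forallP => i'; apply/implyP => i'i; rewrite wi.
  rewrite ltEnat/= ltnNge; apply/negP => /imin; by rewrite leqNgt i'i.
have ki : k = i.
  apply/val_inj; apply/eqP; rewrite eqn_leq imin ?wk// andbT leqNgt.
  apply/negP => ik; have := rk i; rewrite ik/= wk ltEnat/= => wi.
  by move: (leq_trans wi ij); rewrite ltnn.
apply: running_max_lt => u uu uj.
have [/existsP[i' ui']|/existsPn nu] := boolP [exists i', perm_eq u (f i')].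
  rewrite (perm_T ui'); apply: f_dec.
  have wi' : (w i' <= j)%N by rewrite /w -(perm_next_max ui').
  rewrite ltn_neqAle imin ?(leq_trans wi')// andbT.
  apply/eqP => /val_inj ii'; by move: wi'; rewrite -ii' -ki wk ltnn.
by apply: f_top => //; rewrite (leq_trans uj)// (leq_trans _ jp).
Qed.

(** [p%:R^-1 <= del] hides from [phi] the automatic record at time 1, and a top set completed by
    time [del] makes [top_record] applicable to all later times. Low records at or below [del] stay
    in the sum with value 0. *)
Lemma top_integral (del : R) (phi : @test_function R) :
  (0 < p)%N -> (forall i, 0 < w i <= p)%N -> p%:R^-1 <= del ->
  (exists i, (w i)%:R / p%:R <= del) ->
  (forall t, 0 < t <= 1 -> t <= del -> sval phi t = 0) ->
  pm_integral (pm_of (scaled_record_time p (running_max g X))) phi =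
  \sum_(i | low_record w i) sval phi ((w i)%:R / p%:R).
Proof.
move=> p0 wp pdel [i0 i0del] phi0.
have pR : (0 : R) < p%:R by rewrite ltr0n.
pose L := [seq (w i)%:R / p%:R : R |
   i <- [seq i <- enum 'I_K | low_record w i && (del < (w i)%:R / p%:R)]].
have wE i j : (w i)%:R / p%:R = (w j)%:R / p%:R :> R -> w i = w j.
  by move=> /(congr1 ( *%R^~ p%:R)); rewrite !divfK ?gt_eqF// => /eqP; rewrite eqr_nat => /eqP.
have uL : uniq L.
  rewrite map_inj_in_uniq; first by apply: filter_uniq; exact: enum_uniq.
  move=> i j.
  rewrite !mem_filter => /andP[/andP[/forallP ri _] _] /andP[/andP[/forallP rj _] _] /wE wij.
  apply/val_inj; case: (ltngtP i j) => // ij.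
    by have := rj i; rewrite ij/= wij ltxx.
  by have := ri j; rewrite ij/= wij ltxx.
have iex (j : nat) : del < j%:R / p%:R -> exists i, (w i <= j)%N.
  move=> delj; exists i0; rewrite -(ler_nat R) -(ler_pM2r (x := p%:R^-1)) ?invr_gt0//.
  by rewrite (le_trans i0del)// ltW.
have SP t := scaled_record_timeP p0 running_max_nd t.
rewrite (@pm_integral_enum _ _ _ L) => //.
- rewrite big_map big_filter big_mkcondr big_enum_cond/=.
  apply: eq_bigr => i ri; case: ifPn => //; rewrite -leNgt => h.
  rewrite phi0//; have /andP[w0 wp'] := wp i.
  by rewrite divr_gt0 ?ltr0n//= ler_pdivrMr// mul1r ler_nat.
- exact: radon_scaled_record_time.
- by move=> k l t; apply: scaled_record_time_inj => //; exact: running_max_nd.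
- move=> t /mapP[i]; rewrite mem_filter => /andP[/andP[ri deli] _] ->.
  apply/SP; exists (w i); split=> // w1.
  by apply/top_record; [exact: wp|exact: iex|exists i].
move=> k t xk tL; have [|tdel] := leP t del.
  apply: phi0; have [+ _] := @radon_scaled_record_time R p (running_max g X).
  by move=> /(_ _ _ xk); rewrite /= in_itv.
have /SP[j [j0p tj jrec]] : exists k, scaled_record_time p (running_max g X) k = Some t by exists k.
have j1 : (1 < j)%N.
  rewrite ltnNge; apply/negP => j1.
  move: tdel; rewrite tj ltNge => /negP[]; apply: le_trans pdel.
  by rewrite ler_piMl ?invr_ge0// ?ler0n// lern1.
case/negP: tL; have [i wi ri] : exists2 i, w i = j & low_record w i.
  by apply/top_record; [exact: j0p|apply: iex; rewrite -tj|exact: jrec].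
by apply/mapP; exists i; rewrite ?wi ?tj// mem_filter ri wi -tj tdel mem_enum.
Qed.

End top.
End running_maximum.
(** * The limit process *)

Section levels.
Context {R : realType}.
Implicit Types (H : evd R) (a b x : R).

Lemma evd_level_lt H a b : 0 < a -> a < b -> evd_level H b < evd_level H a.
Proof.
move=> a0 ab; have b0 := lt_trans a0 ab.
have pw r : 0 < r -> a `^ r < b `^ r.
  by move=> r0; apply: gt0_ltr_powR; rewrite ?nnegrE ?ltW.
case: H => [|al|al] /=.
- by rewrite ltrN2 ltr_ln ?posrE.
- rewrite !powRN ltf_pV2 ?posrE ?powR_gt0//; apply: pw; by rewrite invr_gt0.
- by rewrite ltrN2; apply: pw; rewrite invr_gt0.
Qed.

Lemma evd_level_range H a : 0 < a ->
  (evd_left H < (evd_level H a)%:E < evd_right H)%E.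
Proof.
move=> a0; case: H => [|al|al] /=; rewrite ?ltNyr ?ltry//=.
- by rewrite lte_fin powR_gt0.
- by rewrite lte_fin oppr_lt0 powR_gt0.
Qed.

(** Since [H] is exp(-mu), this says that [mu] takes the value [a] at [evd_level H a]. *)
Lemma evd_cdf_level H a : 0 < a -> evd_cdf H (evd_level H a) = expR (- a).
Proof.
move=> a0; have pw r : r != 0 -> (a `^ r^-1) `^ r = a.
  by move=> r0; rewrite -powRrM mulVf// powRr1// ltW.
case: H => [|al|al] /=.
- by rewrite opprK lnK ?posrE.
- by rewrite -powRrM mulrNN mulVf// powRr1// ltW.
- by rewrite normrN ger0_norm ?powR_ge0// pw.
Qed.

End levels.

Section limit_path.
Context {R : realType}.
Variables (H : evd R) (m : nat) (u : nat -> m.-tuple R) (e : nat -> R).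
Let V i : R := last 0 (u i).
Let Y := limit_path H u e.
Hypothesis e_gt0 : forall i, 0 < e i.
Hypothesis V01 : forall i, 0 < V i <= 1.
Hypothesis V_small : forall del, 0 < del -> exists i, V i <= del.

Let gam i : R := \sum_(j < i.+1) e j.

Let gam_gt0 i : 0 < gam i.
Proof.
rewrite /gam; elim: i => [|i IH]; first by rewrite big_ord1.
by rewrite big_ord_recr/= addr_gt0.
Qed.

Let level i := evd_level H (gam i).

Let level_lt i j : (i < j)%N -> level j < level i.
Proof.
move=> ij; apply: evd_level_lt => //; elim: j ij => // j IH.
rewrite ltnS leq_eqVlt => /predU1P[->|/IH ij]; rewrite /gam [ltRHS]big_ord_recr/= ltr_pwDr//.
exact: ltW.
Qed.

Let level_le i j : (i <= j)%N -> level j <= level i.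
Proof. by rewrite leq_eqVlt => /predU1P[->//|/level_lt/ltW]. Qed.

(** The levels decrease with the index, so the supremum is attained at the first index whose point
    is at most [t]. *)
Let Y_at t i : V i <= t -> (forall j, (j < i)%N -> t < V j) ->
  Y t = (level i)%:E.
Proof.
move=> Vi iV; apply/eqP; rewrite eq_le; apply/andP; split.
  apply: ge_ereal_sup => _ [j /= Vj <-]; rewrite lee_fin; apply: level_le.
  by rewrite leqNgt; apply/negP => /iV; rewrite ltNge Vj.
by apply: ereal_sup_ubound; exists i.
Qed.

Let first_below t : 0 < t -> exists2 i, V i <= t & forall j, (j < i)%N -> t < V j.
Proof.
move=> t0; have ex : exists i, V i <= t by exact: V_small.
case: (ex_minnP ex) => i Vi imin; exists i => // j ji.
by rewrite ltNge; apply/negP => /imin; rewrite leqNgt ji.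
Qed.

(** Let [i] be the first index with [V i <= t]. If [V i < t], then [Y] is constant around [t]. If
    [V i = t], only later indices, with lower levels, are available just before [t]. *)
Lemma discontinuities_limit_path t : discontinuities Y t <->
  exists2 i, V i = t & forall j, (j < i)%N -> V i < V j.
Proof.
have adh (a : R) : 0 < a -> a <= 1 -> forall s, 0 < s -> exists2 r, 0 < r < a & a - r < s.
  (* The first bound keeps the point positive, the second keeps it within [s] of [a]. *)
  move=> a0 _ s s0; exists (Num.max (a / 2) (a - s / 2)).
    rewrite lt_max divr_gt0//= gt_max ltr_pdivrMr// ltr_pMr// ltr1n/=.
    by rewrite gtrBl divr_gt0.
  rewrite ltrBlDr -ltrBlDl lt_max; apply/orP; right.
  by rewrite ltrD2l ltrN2 gtr_pMr// invf_lt1// ltr1n.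
split=> [[/andP[t0 t1] nc]|[i Vi Vj]].
  have [i Vi iV] := first_below t0; exists i; last by move=> j /iV; exact: le_lt_trans.
  apply: contrapT => /eqP Vit; apply: nc.
  (* The point [V i] is on the left of [t]; what remains is a common margin [del] by which the
     finitely many earlier points exceed [t], so that [i] is still the first index slightly to the
     right. *)
  have {}Vit : V i < t by rewrite lt_neqAle Vit.
  have [del del0 delP] : exists2 del, 0 < del &
      forall j, (j < i)%N -> t + del < V j.
    elim: (i) iV => [|k IH] kV; first by exists 1.
    have [|del del0 delP] := IH; first by move=> j jk; apply: kV; rewrite (ltn_trans jk).
    exists (Num.min del ((V k - t) / 2)).
      by rewrite lt_min del0 divr_gt0// subr_gt0 kV.
    move=> j; rewrite ltnS leq_eqVlt => /predU1P[->|/delP].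
      rewrite -ltrBrDl gt_min; apply/orP; right.
      by rewrite gtr_pMr ?subr_gt0 ?kV// invf_lt1// ltr1n.
    by apply: le_lt_trans; rewrite lerD2l ge_min lexx.
  rewrite (Y_at Vi iV); apply: cvg_near_cst; rewrite near_withinE.
  near=> s => _; apply: Y_at.
    by apply: ltW; near: s; exact: lt_nbhsr.
  move=> j /delP; apply: lt_trans; near: s; apply: lt_nbhsl.
  by rewrite ltrDl.
have /andP[t0 t1] : 0 < t <= 1 by rewrite -Vi.
split=> [|cY]; first by rewrite t0.
have Yt : Y t = (level i)%:E by apply: Y_at; rewrite -Vi.
have : nbhs (Y t) [set y | ((level i.+1)%:E < y)%E].
  by rewrite Yt; apply: (open_nbhs_nbhs (conj _ _)); [exact: open_ereal_gt_ereal|rewrite /= lte_fin level_lt].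
move=> /cY /nbhs_ballP[s /= s0 sY].
have [r /andP[r0 rt] trs] := adh _ t0 t1 _ s0.
have : ((level i.+1)%:E < Y r)%E.
  apply: sY; last by rewrite /= in_itv/= r0 (le_trans (ltW rt)).
  by rewrite /ball/= ger0_norm// subr_ge0 ltW.
rewrite ltNge => /negP; apply.
apply: ge_ereal_sup => _ [j /= Vjr <-]; rewrite lee_fin; apply: level_le.
rewrite ltnNge; apply/negP; rewrite leq_eqVlt => /predU1P[ji|/Vj].
  by move: Vjr; rewrite -/(V j) ji Vi leNgt rt.
by rewrite Vi ltNge => /negP; apply; rewrite (le_trans Vjr) ?ltW.
Unshelve. all: by end_near. Qed.

Section enumeration.
Variable x : nat -> option R.
Hypothesis x_enum : enumerates (discontinuities Y) x.

(** If [V n <= del], a strict lower record of index at least [n] is at most [del]; so finitely many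
    records lie above [del]. *)
Lemma radon_discontinuities : radon_points x.
Proof.
have [xD xinj] := x_enum; apply: radon_points_inj => // [k t xk|del del0].
  by have /xD[] : exists k, x k = Some t by exists k.
have [n Vn] := V_small del0; exists [seq V i | i <- iota 0 n] => k t xk delt.
have /xD/discontinuities_limit_path[i Vi iV] : exists k, x k = Some t by exists k.
apply/mapP; exists i => //; rewrite mem_iota leq0n add0n/= ltnNge.
apply/negP; rewrite leq_eqVlt => /predU1P[ni|/iV].
  by move: delt; rewrite -Vi -ni ltNge Vn.
by rewrite Vi ltNge => /negP; apply; rewrite (le_trans Vn)// ltW.
Qed.

Lemma limit_integral (del : R) (phi : @test_function R) (N : nat) :
  (exists i : 'I_N, V i <= del) ->
  (forall t, 0 < t <= 1 -> t <= del -> sval phi t = 0) ->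
  pm_integral (pm_of x) phi =
  \sum_(i < N | low_record (fun i : 'I_N => V i) i) sval phi (V i).
Proof.
move=> [n Vn] phi0; have [xD xinj] := x_enum.
pose L := map (fun i : 'I_N => V i)
  [seq i <- enum 'I_N | low_record (fun i : 'I_N => V i) i].
have recV (i : 'I_N) : low_record (fun i : 'I_N => V i) i ->
    forall j, (j < i)%N -> V i < V j.
  by move=> /forallP ri j ji; have := ri (Ordinal (ltn_trans ji (ltn_ord i))); rewrite ji.
rewrite (@pm_integral_enum _ _ _ L) => //.
- by rewrite big_map big_filter big_enum_cond.
- exact: radon_discontinuities.
- rewrite map_inj_in_uniq; first by apply: filter_uniq; exact: enum_uniq.
  move=> i j; rewrite !mem_filter => /andP[/recV ri _] /andP[/recV rj _] Vij.
  apply/val_inj; case: (ltngtP i j) => //.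
    by move=> /rj; rewrite Vij ltxx.
  by move=> /ri; rewrite Vij ltxx.
- move=> t /mapP[i]; rewrite mem_filter => /andP[/recV ri _] ->.
  by apply/xD/discontinuities_limit_path; exists i.
move=> k t xk tL.
have /xD dt : exists k, x k = Some t by exists k.
have [t01 _] := dt; apply: phi0 => //.
move/discontinuities_limit_path : dt => [i Vi iV].
have [iN|Ni] := ltnP i N; last first.
  rewrite -Vi (le_trans _ Vn)// ltW// iV//; exact: leq_trans (ltn_ord n) Ni.
case/negP: tL; apply/mapP; exists (Ordinal iN) => //.
rewrite mem_filter mem_enum andbT; apply/forallP => j; apply/implyP => ji.
exact: iV.
Qed.

End enumeration.
End limit_path.
(** * Laws of subsamples *)

Section iid_laws.
Context d (T : measurableType d) (R : realType) (P : probability T R).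
Context d' (S : measurableType d').
Variables (X : nat -> T -> S) (D : set nat).
Hypothesis Xiid : iid P D X.

Lemma iid_rect r (u : r.-tuple nat) (B : 'I_r -> set S) : uniq u ->
  (forall i, i \in u -> D i) -> (forall k, measurable (B k)) ->
  P [set om | forall k, B k (X (tnth u k) om)] =
  (\prod_(k < r) P (X (tnth u k) @^-1` B k))%E.
Proof.
move=> uu uD mB; have [mX indep _] := Xiid.
case: r => [|r] in u B uu uD mB *.
  rewrite big_ord0 (_ : [set _ | _] = setT) ?probability_setT//.
  by apply/seteqP; split => // om _ [].
(* Independence is stated over finite sets of indices, so the factor belonging to [i] is recovered
   from its position in [u]. *)
pose A i := X i @^-1` B (inord (index i u)).
have tu k : inord (index (tnth u k) u) = k :> 'I_r.+1.
  apply/val_inj; rewrite /= (tnth_nth (tnth u k)) index_uniq ?size_tuple ?ltn_ord// inordK//.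
pose K := [fset i in val u]%fset.
have Ku i : (i \in K) = (i \in u) by rewrite in_fset.
have := indep K A; rewrite (_ : \bigcap_(i in [set` K]) A i =
    [set om | forall k, B k (X (tnth u k) om)]); last first.
  apply/seteqP; split => om /= h.
    move=> k; have := h (tnth u k); rewrite /A /= tu; apply.
    by rewrite /= Ku mem_tnth.
  by move=> i /=; rewrite Ku => /tnthP[k ->]; rewrite /A tu; exact: h.
move=> -> => [|i]; last first.
  rewrite Ku => iu; split; first exact: uD.
  by exists (B (inord (index i u))) => //; rewrite setTI.
rewrite (perm_big u)/=; last by apply: uniq_perm => //; exact: fset_uniq.
by rewrite big_tuple; apply: eq_bigr => k _; rewrite /A tu.
Qed.

Lemma iid_rect_law i0 r (u : r.-tuple nat) (B : 'I_r -> set S) : D i0 -> uniq u ->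
  (forall i, i \in u -> D i) -> (forall k, measurable (B k)) ->
  P [set om | forall k, B k (X (tnth u k) om)] =
  (\prod_(k < r) P (X i0 @^-1` B k))%E.
Proof.
move=> D0 uu uD mB; rewrite iid_rect//; apply: eq_bigr => k _.
by have [_ _ h] := Xiid; apply: h => //; apply: uD; exact: mem_tnth.
Qed.

End iid_laws.

Section tuple_measure.
Context d (S : measurableType d) (R : realType) (r : nat).

Definition rect (B : 'I_r -> set S) : set (r.-tuple S) :=
  [set x | forall k, B k (tnth x k)].

Lemma measurable_rect B : (forall k, measurable (B k)) -> measurable (rect B).
Proof.
move=> mB; rewrite (_ : rect B =
  \bigcap_(k in [set: 'I_r]) ((fun x => tnth x k) @^-1` B k)).
  apply: fin_bigcap_measurable => // k _; rewrite -[X in measurable X]setTI.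
  exact: measurable_tnth.
by apply/seteqP; split => x /= h k; [move=> _; exact: h|exact: h].
Qed.

(** Rectangles are stable under intersection and generate the product sigma-algebra, so they
    determine a finite measure. *)
Lemma tuple_measure_ext (m1 m2 : {measure set (r.-tuple S) -> \bar R}) A :
  (m1 setT < +oo)%E ->
  (forall B, (forall k, measurable (B k)) -> m1 (rect B) = m2 (rect B)) ->
  measurable A -> m1 A = m2 A.
Proof.
move=> m1oo m12 mA.
pose G := [set rect B | B in [set B | forall k, measurable (B k)]].
have GT : G setT.
  exists (fun=> setT) => //=.
  by apply/seteqP; split.
apply: (@measure_unique _ R _ G (fun=> setT)) => //.
- apply/seteqP; split.
    apply: smallest_sub; first exact: smallest_sigma_algebra.
    move=> C; elim/big_ind: _ => [[]|C1 C2 h1 h2 [/h1|/h2]//|i _ [B mB <-]].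
    apply: sub_sigma_algebra; exists (fun k => if k == i then B else setT).
      by move=> k /=; case: ifP.
    rewrite setTI; apply/seteqP; split => x /= h; first by have := h i; rewrite eqxx.
    by move=> k; case: eqP => // ->.
  apply: smallest_sub; first exact: sigma_algebra_measurable.
  by move=> _ [B mB <-]; exact: measurable_rect.
- move=> _ _ [B1 mB1 <-] [B2 mB2 <-]; exists (fun k => B1 k `&` B2 k).
    by move=> k /=; apply: measurableI.
  apply/seteqP; split => x /= h; first by split => k; case: (h k).
  by move=> k; split; apply h.
- by rewrite bigcup_const//; exists 0.
- by move=> _ [B mB <-]; exact: m12.
Qed.

End tuple_measure.

Section iid_tuples.
Context d (T : measurableType d) (R : realType) (P : probability T R).
Context d' (S : measurableType d').
Variables (X : nat -> T -> S) (D : set nat).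
Hypothesis Xiid : iid P D X.
Implicit Types (r s : nat).

Definition sample r (u : r.-tuple nat) om : r.-tuple S :=
  map_tuple (fun i => X i om) u.

Lemma measurable_sample r (u : r.-tuple nat) : (forall i, i \in u -> D i) ->
  measurable_fun setT (sample u).
Proof.
move=> uD; have [mX _ _] := Xiid; apply/measurable_fun_tnthP => k.
rewrite (_ : _ \o _ = X (tnth u k)); first by apply: mX; apply: uD; exact: mem_tnth.
by apply/funext => om /=; rewrite tnth_map.
Qed.

Lemma measurable_sample_preimage r (u : r.-tuple nat) (A : set (r.-tuple S)) :
  (forall i, i \in u -> D i) -> measurable A -> measurable (sample u @^-1` A).
Proof.
move=> uD mA; rewrite -[X in measurable X]setTI.
by apply: (measurable_sample uD).
Qed.

(* Covers both equality in law ([C = setT], [c = 1]) and independence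
   ([v = u], [c = P C]). *)
Let sample_ext r (u v : r.-tuple nat) (C : set T) (c : {nonneg R}) A :
  (forall i, i \in u -> D i) -> (forall i, i \in v -> D i) -> measurable C ->
  (forall B, (forall k, measurable (B k)) ->
    P (sample u @^-1` rect B `&` C) = (c%:num%:E * P (sample v @^-1` rect B))%E) ->
  measurable A ->
  P (sample u @^-1` A `&` C) = (c%:num%:E * P (sample v @^-1` A))%E.
Proof.
move=> uD vD mC h mA.
have mfu := measurable_sample uD; have mfv := measurable_sample vD.
pose m1 := measure_function_pushforward__canonical__measure_function_Measure
  (mrestr P mC) mfu.
pose m2 := mscale c
  (measure_function_pushforward__canonical__measure_function_Measure P mfv).
apply: (@tuple_measure_ext _ _ R _ m1 m2) => //.
rewrite /m1/= /pushforward/= /mrestr preimage_setT setTI.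
by rewrite (le_lt_trans (probability_le1 P mC)) ?ltry.
Qed.

Lemma sample_law r (u v : r.-tuple nat) A :
  uniq u -> (forall i, i \in u -> D i) -> uniq v -> (forall i, i \in v -> D i) ->
  measurable A -> P (sample u @^-1` A) = P (sample v @^-1` A).
Proof.
(* An empty sample provides no reference index in [D] for the common law. *)
case: r => [|r] in u v A *; first by rewrite (tuple0 u) (tuple0 v).
move=> uu uD uv vD mA.
rewrite -[sample u @^-1` A]setIT -[RHS]mul1e.
apply: (@sample_ext _ u v setT 1%:nng A uD vD measurableT _ mA) => B mB.
rewrite setIT mul1e.
have E w : sample w @^-1` rect B = [set om | forall k, B k (X (tnth w k) om)].
  by apply/seteqP; split => om /= h k; have := h k; rewrite tnth_map.
have D0 : D (tnth u ord0) by apply: uD; exact: mem_tnth.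
by rewrite !E (iid_rect_law Xiid D0)// (iid_rect_law Xiid D0).
Qed.

(** The two events are reduced to rectangles one after the other, each time with the other event
    fixed. *)
Lemma sample_indep r s (u : r.-tuple nat) (v : s.-tuple nat) A B :
  uniq (u ++ v) -> (forall i, i \in u ++ v -> D i) ->
  measurable A -> measurable B ->
  P (sample u @^-1` A `&` sample v @^-1` B) =
  (P (sample u @^-1` A) * P (sample v @^-1` B))%E.
Proof.
move=> uuv uvD mA mB.
have uD i : i \in u -> D i by move=> iu; apply: uvD; rewrite mem_cat iu.
have vD i : i \in v -> D i by move=> iv; apply: uvD; rewrite mem_cat iv orbT.
have /and3P[uu _ uv] : [&& uniq u, ~~ has (mem u) v & uniq v] by rewrite -cat_uniq.
have ext r' (u' : r'.-tuple nat) (C : set T) A' : (forall i, i \in u' -> D i) ->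
    measurable C ->
    (forall B, (forall k, measurable (B k)) ->
      P (sample u' @^-1` rect B `&` C) = (P (sample u' @^-1` rect B) * P C)%E) ->
    measurable A' ->
    P (sample u' @^-1` A' `&` C) = (P (sample u' @^-1` A') * P C)%E.
  move=> u'D mC h mA'.
  have c0 : 0 <= fine (P C) by rewrite fine_ge0.
  have cE : P C = (NngNum c0)%:num%:E by rewrite /= fineK// fin_num_measure.
  rewrite muleC cE; apply: sample_ext => // B' mB'.
  by rewrite h// -cE muleC.
have mvB := measurable_sample_preimage vD mB.
apply: (ext) => // B1 mB1.
have muB1 : measurable (sample u @^-1` rect B1).
  by apply: measurable_sample_preimage => //; exact: measurable_rect.
rewrite setIC muleC; apply: (ext) => // B2 mB2.
rewrite setIC muleC.
pose BB k := match fintype.split k with inl i => B1 i | inr j => B2 j end.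
have mBB k : measurable (BB k) by rewrite /BB; case: fintype.split.
have := iid_rect Xiid (u := cat_tuple u v) (B := BB) uuv uvD mBB.
rewrite big_split_ord/= => E.
have EE w0 (w : w0.-tuple nat) (B0 : 'I_w0 -> set S) :
    sample w @^-1` rect B0 = [set om | forall k, B0 k (X (tnth w k) om)].
  by apply/seteqP; split => om /= h k; have := h k; rewrite tnth_map.
rewrite !EE (iid_rect Xiid (u := u))// (iid_rect Xiid (u := v))//.
transitivity (P [set om | forall k, BB k (X (tnth (cat_tuple u v) k) om)]).
  congr (P _); apply/seteqP; split => om /=.
    move=> [h1 h2] k; rewrite /BB -{2}(splitK k); case: fintype.split => j /=.
      by rewrite tnth_lshift; exact: h1.
    by rewrite tnth_rshift; exact: h2.
  move=> h; split => k.
    by have := h (lshift _ k); rewrite /BB tnth_lshift (unsplitK (inl k)).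
  by have := h (rshift _ k); rewrite /BB tnth_rshift (unsplitK (inr k)).
rewrite E; congr (_ * _)%E; apply: eq_bigr => k _.
  by rewrite tnth_lshift /BB (unsplitK (inl k)).
by rewrite tnth_rshift /BB (unsplitK (inr k)).
Qed.

End iid_tuples.
(** * Uniform points of the simplex *)

Section simplex_volume.
Context {R : realType}.
Local Notation leb := (@lebesgue_measure R).

Lemma integral_poly_deriv (p : {poly R}) (a b : R) : a < b ->
  (\int[leb]_(x in `[a, b]) (p^`().[x])%:E = (p.[b])%:E - (p.[a])%:E)%E.
Proof.
move=> ab.
have cp (q : {poly R}) x : {for x, continuous (horner q)}.
  by apply: differentiable_continuous; apply/derivable1_diffP.
apply: (@continuous_FTC2 _ (horner p^`()) (horner p)) => //.
- by apply: continuous_subspaceT => x; exact: cp.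
- split=> [x _||].
  + exact: ex_derive.
  + by apply: cvg_at_right_filter; exact: cp.
  + by apply: cvg_at_left_filter; exact: cp.
- by move=> x _; rewrite derive1E derive_val.
Qed.

Lemma integral_pow_sub n (a t : R) :
  (\int[leb]_x (if a < x <= t then (t - x) ^+ n / n`!%:R else 0)%:E =
   (if a <= t then (t - a) ^+ n.+1 / (n.+1)`!%:R else 0)%:E)%E.
Proof.
have [ta|at_] := ltP a t; last first.
  rewrite integral0_eq; last first.
    move=> x _; case: ifP => // /andP[ax xt].
    by move: (lt_le_trans ax (le_trans xt at_)); rewrite ltxx.
  move: at_; rewrite le_eqVlt => /predU1P[->|at_]; last by rewrite leNgt at_.
  by rewrite lexx subrr expr0n/= mul0r.
(* An antiderivative in x of (t - x)^n / n!. *)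
pose p : {poly R} := - ((n.+1)`!%:R^-1 *: (t%:P - 'X) ^+ n.+1).
have dp x : p^`().[x] = (t - x) ^+ n / n`!%:R.
  rewrite /p derivN derivZ deriv_exp derivB derivC derivX sub0r !hornerE.
  rewrite factS natrM invfM.
  have n1 : (n.+1%:R : R) != 0 by rewrite pnatr_eq0.
  have n2 : (n`!%:R : R) != 0 by rewrite pnatr_eq0 -lt0n fact_gt0.
  rewrite hornerMn !hornerE/= -(mulr_natl (-1 * _)); move: n1 n2.
  move: (n.+1%:R : R) (n`!%:R : R) => N F N0 F0.
  by field; rewrite N0 F0.
transitivity (\int[leb]_(x in `]a, t]) (p^`().[x])%:E)%E.
  rewrite [RHS]integral_mkcond; apply: eq_integral => x _.
  rewrite patchE dp; case: ifPn => axt.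
    by rewrite mem_set//= in_itv.
  by rewrite memNset//= in_itv/=; exact/negP.
rewrite integral_itv_obnd_cbnd; last first.
  apply/measurable_EFinP; apply: measurable_funTS.
  by apply: continuous_measurable_fun => x; apply: differentiable_continuous; apply/derivable1_diffP.
rewrite integral_poly_deriv// ltW//.
rewrite -EFinB; congr EFin.
rewrite /p !hornerE subrr expr0n/= mulr0 oppr0 sub0r opprK mulrC//.
Qed.

(** The start [a] is arbitrary because fixing the first coordinate [x] leaves a set of the same form
    that starts at [x]. *)
Lemma lebesgue_tuple_path n (a t : R) :
  lebesgue_tuple [set z : n.-tuple R | path <%R a z && (last a z <= t)] =
  (if a <= t then (t - a) ^+ n / n`!%:R else 0)%:E.
Proof.
elim: n a => [|n IH] a /=.
  rewrite diracE; case: leP => h.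
    by rewrite mem_set//= expr0 fact0 divr1.
  by rewrite memNset//= leNgt h.
rewrite -integral_pow_sub; apply: eq_integral => x _.
have -> : [set y : n.-tuple R | path <%R a (cons_tuple x y) && (last a (cons_tuple x y) <= t)] =
    if a < x then [set z : n.-tuple R | path <%R x z && (last x z <= t)] else set0.
  by apply/seteqP; split => z /=; case: ifP.
case: ifP => ax /=; last first.
  have {}IH : lebesgue_tuple (set0 : set (n.-tuple R)) = 0%E.
    elim: (n) => [|k IHk] /=; first by rewrite measure0.
    by rewrite integral0_eq// => y _; exact: IHk.
  by rewrite IH.
by rewrite IH.
Qed.

Variables (d : measure_display) (T : measurableType d) (P : probability T R).
Variable m : nat.
Hypothesis m_gt0 : (0 < m)%N.
Variable U : nat -> T -> m.-tuple R.
Hypothesis U_iid : iid P setT U.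
Hypothesis U_unif : forall i, uniform_law P (simplex R m) (U i).

Let V i om : R := last 0 (U i om).

Lemma measurable_last_le (t : R) : measurable [set z : m.-tuple R | last 0 z <= t].
Proof.
have k1 : (m.-1 < m)%N by rewrite prednK.
pose k := Ordinal k1.
rewrite (_ : [set _ | _] = (fun z => tnth z k) @^-1` `]-oo, t]).
  by rewrite -[X in measurable X]setTI; exact: measurable_tnth.
apply/seteqP; split => z /=; rewrite in_itv/= (tnth_nth 0)/=;
  by rewrite -nth_last size_tuple.
Qed.

Lemma measurable_last_gt_le (s t : R) :
  measurable [set z : m.-tuple R | s < last 0 z <= t].
Proof.
rewrite (_ : [set _ | _] = [set z : m.-tuple R | last 0 z <= t] `\`
   [set z | last 0 z <= s]).
  by apply: measurableD; exact: measurable_last_le.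
apply/seteqP; split => z /=; first by move=> /andP[h ->]; split => //; apply/negP; rewrite -ltNge.
by move=> [-> /negP]; rewrite -ltNge => ->.
Qed.

(** The ratio of the volumes t^m / m! and 1 / m!. *)
Lemma P_last_le i (t : R) : 0 <= t <= 1 -> P [set om | V i om <= t] = (t ^+ m)%:E.
Proof.
move=> /andP[t0 t1].
rewrite (_ : [set _ | _] = U i @^-1` [set z | last 0 z <= t])//.
rewrite U_unif; last exact: measurable_last_le.
have -> : [set z : m.-tuple R | last 0 z <= t] `&` simplex R m =
   [set z : m.-tuple R | path <%R 0 z && (last 0 z <= t)].
  apply/seteqP; split => z /=; first by move=> [zt /andP[-> _]].
  by move=> /andP[pz zt]; split => //; rewrite /simplex/= pz (le_trans zt).
rewrite /simplex !lebesgue_tuple_path t0 ler01 !subr0 expr1n/= div1r invrK.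
by rewrite divfK// pnatr_eq0 -lt0n fact_gt0.
Qed.

Lemma P_last_gt_le i (s t : R) : 0 <= s -> s <= t -> t <= 1 ->
  P [set om | s < V i om <= t] = (t ^+ m - s ^+ m)%:E.
Proof.
move=> s0 st t1; have [mU _ _] := U_iid.
have mV r : measurable [set om | V i om <= r].
  rewrite -[X in measurable X]setTI.
  exact: (mU i I measurableT _ (measurable_last_le r)).
rewrite (_ : [set _ | _] = [set om | V i om <= t] `\` [set om | V i om <= s]).
  rewrite measureD//; last by rewrite (le_lt_trans (probability_le1 P _)) ?ltry.
  rewrite (_ : _ `&` _ = [set om | V i om <= s]).
    rewrite EFinB; congr (_ - _)%E; apply: P_last_le.
      by rewrite (le_trans s0).
    by rewrite s0 (le_trans st).
  by apply/seteqP; split => om /=; [case|move=> h; split => //; exact: le_trans st].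
apply/seteqP; split => om /=; first by move=> /andP[h ->]; split => //; apply/negP; rewrite -ltNge.
by move=> [-> /negP]; rewrite -ltNge => ->.
Qed.

Lemma measurable_cells K (a b : 'I_K -> R) :
  measurable [set om | forall i : 'I_K, a i < V i om <= b i].
Proof.
have [mU _ _] := U_iid.
rewrite (_ : [set _ | _] = \bigcap_(i in [set: 'I_K]) [set om | a i < V i om <= b i]).
  apply: fin_bigcap_measurable => // i _; rewrite -[X in measurable X]setTI.
  exact: (mU i I measurableT _ (measurable_last_gt_le (a i) (b i))).
by apply/seteqP; split => om /= h i; [move=> _; exact: h|exact: h].
Qed.

Lemma P_cells K (a b : 'I_K -> R) : (forall i, 0 <= a i <= b i) -> (forall i, b i <= 1) ->
  P [set om | forall i : 'I_K, a i < V i om <= b i] =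
  (\prod_(i < K) (b i ^+ m - a i ^+ m))%:E.
Proof.
move=> ab b1.
pose u : K.-tuple nat := [tuple val i | i < K].
have uE k : tnth u k = k by rewrite tnth_mktuple.
have uu : uniq u by rewrite map_inj_uniq ?enum_uniq//; exact: val_inj.
have := iid_rect U_iid (B := fun k => [set z | a k < last 0 z <= b k]) uu
  (fun _ _ => I) (fun k => measurable_last_gt_le _ _).
rewrite (_ : [set _ | _] = [set om | forall i : 'I_K, a i < V i om <= b i]); last first.
  by apply/seteqP; split => om /= h k; have := h k; rewrite uE.
move=> ->; rewrite -prodEFin; apply: eq_bigr => k _.
by have /andP[a0 abk] := ab k; rewrite uE; exact: (P_last_gt_le k a0 abk (b1 k)).
Qed.

Lemma ae_last01 : {ae P, forall om i, 0 < V i om <= 1}.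
Proof.
apply: ae_foralln => i; have [mU _ _] := U_iid.
have mV : measurable [set om | 0 < V i om <= 1].
  rewrite -[X in measurable X]setTI.
  exact: (mU i I measurableT _ (measurable_last_gt_le 0 1)).
exists (~` [set om | 0 < V i om <= 1]); split => //; first exact: measurableC.
have := P_last_gt_le i (lexx 0) ler01 (lexx 1).
rewrite expr1n expr0n gtn_eqF//= subr0 => PV.
by rewrite [LHS](probability_setC P mV) PV subee.
Qed.

(** By independence the first [K] points all exceed [del] with probability (1 - del^m)^K, which
    tends to 0. *)
Lemma ae_last_small : {ae P, forall om (k : nat), exists i, V i om <= k.+1%:R^-1}.
Proof.
apply: ae_foralln => k; have [mU _ _] := U_iid; set del : R := k.+1%:R^-1.
have del01 : 0 <= del <= 1 by rewrite invr_ge0 ler0n/= invf_le1// ler1n.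
have mgt : measurable [set z : m.-tuple R | del < last 0 z].
  rewrite (_ : [set _ | _] = ~` [set z : m.-tuple R | last 0 z <= del]).
    by apply: measurableC; exact: measurable_last_le.
  by apply/seteqP; split => z /=; rewrite ltNge => /negP.
pose A K := [set om | forall i : 'I_K, del < V i om].
have mA K : measurable (A K).
  rewrite (_ : A K = \bigcap_(i in [set: 'I_K]) [set om | del < V i om]).
    apply: fin_bigcap_measurable => // i _; rewrite -[X in measurable X]setTI.
    exact: (mU i I measurableT _ mgt).
  by apply/seteqP; split => om /= h i; [move=> _; exact: h|exact: h].
have PA K : P (A K) = ((1 - del ^+ m) ^+ K)%:E.
  pose u : K.-tuple nat := [tuple val i | i < K].
  have uE j : tnth u j = j by rewrite tnth_mktuple.
  have uu : uniq u by rewrite map_inj_uniq ?enum_uniq//; exact: val_inj.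
  have := iid_rect U_iid (B := fun _ => [set z | del < last 0 z]) uu
    (fun _ _ => I) (fun j => mgt).
  rewrite (_ : [set _ | _] = A K); last first.
    by apply/seteqP; split => om /= h j; have := h j; rewrite uE.
  move=> ->; have -> : (1 - del ^+ m) ^+ K = \prod_(j < K) (1 - del ^+ m).
    by rewrite prodr_const card_ord.
  rewrite -prodEFin; apply: eq_bigr => j _.
  rewrite uE (_ : _ @^-1` _ = ~` [set om | V j om <= del]).
    rewrite probability_setC; first by rewrite [X in (_ - X)%E]P_last_le.
    rewrite -[X in measurable X]setTI.
    exact: (mU j I measurableT _ (measurable_last_le del)).
  by apply/seteqP; split => z /=; rewrite ltNge => /negP.
exists (\bigcap_K A K); split.
- exact: bigcap_measurable.
- apply/eqP; rewrite eq_le measure_ge0 andbT.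
  apply/lee_addgt0Pr => e e0; rewrite add0e.
  have c0 : 0 <= 1 - del ^+ m < 1.
    have /andP[d0 d1] := del01.
    rewrite subr_ge0 exprn_ile1// ltrBlDr ltrDl exprn_gt0//.
    by rewrite invr_gt0.
  have : (GRing.exp (1 - del ^+ m) : R^nat) @ \oo --> 0.
    by apply: cvg_expr; rewrite ger0_norm; case/andP: c0.
  move=> /cvgrPdist_le/(_ _ e0)[K _ /(_ K (leqnn K))].
  rewrite sub0r normrN => /(le_trans (ler_norm _)) h.
  apply: (@le_trans _ _ (P (A K))); last by rewrite PA lee_fin.
  apply: le_measure; rewrite ?inE//; first exact: bigcap_measurable.
  exact: bigcap_inf.
- move=> om /= nV K _ i; rewrite ltNge; apply/negP => h; apply: nV.
  by exists (val i).
Qed.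

Lemma ae_exponential_gt0 (E : nat -> T -> R) : iid P setT E ->
  (forall i, exponential_law P 1 (E i)) -> {ae P, forall om i, 0 < E i om}.
Proof.
move=> E_iid E_exp; apply: ae_foralln => i; have [mE _ _] := E_iid.
exists (E i @^-1` `]-oo, 0]%classic); split.
- by rewrite -[X in measurable X]setTI; apply: (mE i I) => //; exact: measurable_itv.
- transitivity (exponential_prob (1 : R) `]-oo, 0]%classic).
    by apply: (E_exp i); exact: measurable_itv.
  rewrite /exponential_prob -integral_itv_bndo_bndc; last first.
    by apply/measurable_EFinP; apply: measurable_funTS; exact: measurable_exponential_pdf.
  rewrite integral0_eq// => x; rewrite /= in_itv/= => x0.
  by rewrite lt0_exponential_pdf.
- by move=> om /= /negP; rewrite -leNgt in_itv.
Qed.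

End simplex_volume.
(** * The largest kernels have exchangeable index sets *)

Lemma perm_map_uniq (A : finType) (l l' : seq A) : uniq l -> uniq l' ->
  size l = size l' -> exists s : {perm A}, map s l = l'.
Proof.
elim/last_ind: l l' => [|l a IH] l'; first by case: l' => // _ _ _; exists 1%g.
case/lastP: l' => [|l' a']; first by rewrite size_rcons.
rewrite !rcons_uniq !size_rcons => /andP[al ul] /andP[al' ul'] [sl].
have [s sE] := IH l' ul ul' sl.
(* The transposition corrects the image of the last entry; the points it exchanges lie outside [l'],
   so the earlier images are kept. *)
exists (s * tperm (s a) a')%g; rewrite map_rcons permM tpermL; congr rcons.
rewrite -[RHS]sE; apply/eq_in_map => b bl; rewrite permM tpermD//.
  by apply: contraNneq al => /perm_inj ->.
by apply: contraNneq al' => ->; rewrite -sE; apply: map_f.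
Qed.

(** Transitivity of the symmetric group on injective arrays: the algebraic side of
    exchangeability. *)
Lemma perm_injective (A B : finType) (f f' : B -> A) : injective f -> injective f' ->
  exists s : {perm A}, forall b, s (f b) = f' b.
Proof.
move=> fi fi'; have [||//|s sE] := @perm_map_uniq A [seq f b | b : B] [seq f' b | b : B].
- by rewrite map_inj_uniq// enum_uniq.
- by rewrite map_inj_uniq// enum_uniq.
- by rewrite !size_map.
exists s => b; move: sE; rewrite -map_comp => /eq_in_map; apply.
by rewrite mem_enum.
Qed.

Section top_arrays.
Context {R : realType} (m p K : nat) (S : Type) (g : m.-tuple S -> R).
Hypothesis g_sym : forall (s : 'S_m) (y : m.-tuple S),
  g [tuple tnth y (s k) | k < m] = g y.
Implicit Types (x : p.-tuple S) (u v : m.-tuple 'I_p) (s : {perm 'I_p}).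
Implicit Types (f e : {ffun 'I_K * 'I_m -> 'I_p}).

Definition TT x u : R := g (map_tuple (tnth x) u).

(** All [K] index sets are held in one array [f]: its injectivity says that they are disjoint and
    without repetition, and permutations of the sample act on it by composition. *)
Definition block f (i : 'I_K) : m.-tuple 'I_p := [tuple f (i, k) | k < m].

Definition top f : set (p.-tuple S) := [set x |
  (forall i j : 'I_K, (i < j)%N -> TT x (block f j) < TT x (block f i)) /\
  (forall u, uniq u -> (forall i, ~~ perm_eq u (block f i)) ->
     forall i, TT x u < TT x (block f i))].

Lemma perm_TT x u v : perm_eq u v -> TT x u = TT x v.
Proof.
case/tuple_permP => s us; rewrite /TT -[RHS](g_sym s); congr g.
apply: eq_from_tnth => i; rewrite tnth_mktuple !tnth_map; congr tnth.
have -> : u = [tuple tnth v (s i) | i < m] by apply/val_inj.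
by rewrite tnth_mktuple.
Qed.

Definition pact s f : {ffun 'I_K * 'I_m -> 'I_p} := [ffun a => s (f a)].

Lemma pact_inj s : injective (pact s).
Proof.
move=> f f' /ffunP h; apply/ffunP => a.
by have := h a; rewrite !ffunE => /perm_inj.
Qed.

Lemma block_pact s f i : block (pact s f) i = map_tuple s (block f i).
Proof. by apply: eq_from_tnth => k; rewrite /block tnth_mktuple ffunE tnth_map tnth_mktuple. Qed.

Lemma injective_pact s f : injective (pact s f) <-> injective f.
Proof.
split=> h a b; last by rewrite !ffunE => /perm_inj /h.
by move=> ab; apply: h; rewrite !ffunE ab.
Qed.

Definition pshuffle s x : p.-tuple S := [tuple tnth x (s i) | i < p].

Lemma TT_pshuffle s x u : TT (pshuffle s x) u = TT x (map_tuple s u).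
Proof.
by rewrite /TT; congr g; apply: eq_from_tnth => k; rewrite tnth_map /pshuffle tnth_mktuple !tnth_map.
Qed.

Lemma top_pshuffle s x f : top f (pshuffle s x) <-> top (pact s f) x.
Proof.
have E i : TT (pshuffle s x) (block f i) = TT x (block (pact s f) i).
  by rewrite TT_pshuffle block_pact.
split=> -[h1 h2]; split.
- by move=> i j ij; rewrite -!E; exact: h1.
- move=> u uu nu i; rewrite -E.
  have su : u = map_tuple s (map_tuple s^-1%g u).
    by apply: eq_from_tnth => k; rewrite !tnth_map permKV.
  rewrite su -TT_pshuffle; apply: h2.
    by rewrite map_inj_uniq//; exact: perm_inj.
  move=> j; apply: contra (nu j) => /(perm_map s).
  by rewrite block_pact {2}su.
- by move=> i j ij; rewrite !E; exact: h1.
- move=> u uu nu i; rewrite E TT_pshuffle; apply: h2.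
    by rewrite map_inj_uniq//; exact: perm_inj.
  move=> j; apply: contra (nu j); rewrite block_pact => /(perm_map s^-1%g).
  by rewrite !(mapK (permK s)).
Qed.

Lemma uniq_block f i : injective f -> uniq (block f i).
Proof.
by move=> fi; rewrite map_inj_uniq ?enum_uniq// => k l /fi[].
Qed.

Lemma block_disjoint f i j a : injective f -> a \in block f i -> a \in block f j -> i = j.
Proof. by move=> fi /mapP[k _ ->] /mapP[l _ /fi[]]. Qed.

Definition same_blocks f e := [forall i, perm_eq (block f i) (block e i)].

Lemma same_blocks_pact s f e : same_blocks (pact s f) (pact s e) = same_blocks f e.
Proof.
apply: eq_forallb => i; rewrite !block_pact; apply/idP/idP; last exact: perm_map.
move=> /(perm_map s^-1%g).
by rewrite !(mapK (permK s)).
Qed.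

Hypothesis m_gt0 : (0 < m)%N.

Lemma block_perm_inj f i j : injective f -> perm_eq (block f i) (block f j) -> i = j.
Proof.
move=> fi ij; pose a := tnth (block f i) (Ordinal m_gt0).
by apply: (@block_disjoint f i j a) => //; rewrite -?(perm_mem ij); exact: mem_tnth.
Qed.

(** At the first rank where two top arrays had different sets, each set would have a kernel strictly
    larger than the other. Hence the top index sets are unique up to the order inside each block. *)
Lemma top_same_blocks f e x : injective f -> injective e -> top e x ->
  top f x <-> same_blocks f e.
Proof.
have le (f1 f2 : {ffun 'I_K * 'I_m -> 'I_p}) (i : 'I_K) : injective f1 -> injective f2 -> top f1 x ->
    (forall j : 'I_K, (j < i)%N -> perm_eq (block f1 j) (block f2 j)) ->
    ~~ perm_eq (block f1 i) (block f2 i) -> TT x (block f2 i) < TT x (block f1 i).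
  move=> f1i f2i [h1 h2] lti nii.
  have [/existsP[j ij]|/existsPn nj] := boolP [exists j, perm_eq (block f2 i) (block f1 j)]; last first.
    by apply: h2 => //; exact: uniq_block.
  rewrite (perm_TT _ ij); apply: h1; rewrite ltnNge; apply/negP.
  rewrite leq_eqVlt => /predU1P[/val_inj ji|ji].
    by move: ij; rewrite ji perm_sym (negPf nii).
  have : perm_eq (block f2 i) (block f2 j) by apply: perm_trans ij (lti _ ji).
  by move=> /(block_perm_inj f2i) ij'; move: ji; rewrite ij' ltnn.
move=> fi ei te; split=> [tf|/forallP fe].
  suff H n : forall i : 'I_K, (i < n)%N -> perm_eq (block f i) (block e i).
    by apply/forallP => i; apply: (H K).
  elim: n => // n IH i; rewrite ltnS leq_eqVlt => /predU1P[iN|]; last exact: IH.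
  apply/negPn/negP => nfe.
  have h1 := le f e i fi ei tf (fun j ji => IH j (eq_ind _ (fun n => (j < n)%N) ji _ iN)) nfe.
  have h2 : TT x (block f i) < TT x (block e i).
    apply: le => // [j ji|]; last by rewrite perm_sym.
    by rewrite perm_sym; apply: IH; rewrite -iN.
  by move: (lt_trans h1 h2); rewrite ltxx.
have [h1 h2] := te; split=> [i j ij|u uu nu i]; rewrite ?(perm_TT _ (fe _)).
  exact: h1.
by apply: h2 => // j; rewrite -(permPr (fe j)).
Qed.

(** The common value is (m!)^K, but only its independence of the array matters; a permutation
    carrying one array to the other transports the class. *)
Lemma card_same_blocks (e e' : {ffun 'I_K * 'I_m -> 'I_p}) : injective e -> injective e' ->
  #|[set f : {ffun 'I_K * 'I_m -> 'I_p} | injectiveb f && same_blocks f e]%SET| =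
  #|[set f : {ffun 'I_K * 'I_m -> 'I_p} | injectiveb f && same_blocks f e']%SET|.
Proof.
suff H (f f' : {ffun 'I_K * 'I_m -> 'I_p}) : injective f -> injective f' ->
    (#|[set h : {ffun 'I_K * 'I_m -> 'I_p} | injectiveb h && same_blocks h f]%SET| <=
     #|[set h : {ffun 'I_K * 'I_m -> 'I_p} | injectiveb h && same_blocks h f']%SET|)%N.
  by move=> ei ei'; apply/eqP; rewrite eqn_leq !H.
move=> fi fi'; have [s sE] := perm_injective fi fi'.
have -> : f' = pact s f by apply/ffunP => a; rewrite ffunE sE.
rewrite -(card_imset _ (@pact_inj s)); apply: subset_leq_card.
apply/fintype.subsetP => h0 /imsetP[h]; rewrite !inE => /andP[/injectiveP hi hf] ->.
by rewrite same_blocks_pact hf andbT; apply/injectiveP/injective_pact.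
Qed.

End top_arrays.
Section top_probability.
Context d (T : measurableType d) (R : realType) (P : probability T R).
Context d' (S : measurableType d').
Variables (m p K : nat) (X : nat -> T -> S) (g : m.-tuple S -> R).
Hypothesis Xiid : iid P [set i | (i < p)%N] X.
Hypothesis g_sym : forall (s : 'S_m) (y : m.-tuple S),
  g [tuple tnth y (s k) | k < m] = g y.
Hypothesis mg : measurable_fun setT g.
Hypothesis m_gt0 : (0 < m)%N.
Implicit Types (f e : {ffun 'I_K * 'I_m -> 'I_p}).

Definition whole_sample om : p.-tuple S := sample X [tuple val i | i < p] om.

Lemma TT_whole_sample om (u : m.-tuple 'I_p) :
  TT g (whole_sample om) u = T_ g (X ^~ om) (map_tuple val u).
Proof.
rewrite /TT /T_; congr g; apply: eq_from_tnth => k.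
by rewrite tnth_map /whole_sample tnth_map tnth_mktuple !tnth_map.
Qed.

Lemma measurable_TT (u : m.-tuple 'I_p) :
  measurable_fun setT (fun x : p.-tuple S => TT g x u).
Proof.
apply: (measurableT_comp mg); apply/measurable_fun_tnthP => k.
rewrite (_ : _ \o _ = fun x => tnth x (tnth u k)); first exact: measurable_tnth.
by apply/funext => x /=; rewrite tnth_map.
Qed.

Lemma measurable_TT_lt (u v : m.-tuple 'I_p) :
  measurable [set x : p.-tuple S | TT g x u < TT g x v].
Proof.
have := measurable_fun_ltr (measurable_TT u) (measurable_TT v).
move=> /(_ measurableT [set true] I); rewrite setTI.
by congr measurable; apply/seteqP; split.
Qed.

Lemma measurable_top f : measurable (top g f : set (p.-tuple S)).
Proof.
rewrite (_ : top g f =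
    \bigcap_(ij in [set: 'I_K * 'I_K])
      [set x | (ij.1 < ij.2)%N -> TT g x (block f ij.2) < TT g x (block f ij.1)] `&`
    \bigcap_(ui in [set: m.-tuple 'I_p * 'I_K])
      [set x | uniq ui.1 -> (forall i, ~~ perm_eq ui.1 (block f i)) ->
               TT g x ui.1 < TT g x (block f ui.2)]); last first.
  apply/seteqP; split => x /= [h1 h2]; split.
  - by move=> [i j] _ /=; exact: h1.
  - by move=> [u i] _ /= uu nu; exact: h2.
  - by move=> i j; exact: (h1 (i, j)).
  - by move=> u uu nu i; exact: (h2 (u, i)).
apply: measurableI.
  apply: fin_bigcap_measurable => // -[i j] _ /=.
  case: (ltnP i j) => ij; last by rewrite (_ : [set _ | _] = setT)//; apply/seteqP; split.
  rewrite (_ : [set _ | _] = [set x | TT g x (block f j) < TT g x (block f i)]).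
    exact: measurable_TT_lt.
  by apply/seteqP; split => x /= h; [exact: h|move=> _].
apply: fin_bigcap_measurable => // -[u i] _ /=.
have [[uu nu]|nu] := pselect (uniq u /\ forall i, ~~ perm_eq u (block f i)); last first.
  rewrite (_ : [set _ | _] = setT)//; apply/seteqP; split => // x _ /= h1 h2.
  by case: nu.
rewrite (_ : [set _ | _] = [set x | TT g x u < TT g x (block f i)]).
  exact: measurable_TT_lt.
by apply/seteqP; split => x /= h; [exact: h|move=> _].
Qed.

Let all_uniq : uniq ([tuple val i | i < p] : p.-tuple nat).
Proof. by rewrite map_inj_uniq ?enum_uniq//; exact: val_inj. Qed.

Let all_lt : forall i, i \in ([tuple val i | i < p] : p.-tuple nat) ->
  [set i | (i < p)%N] i.
Proof. by move=> _ /mapP[k _ ->] /=. Qed.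

Lemma measurable_whole (A : set (p.-tuple S)) : measurable A ->
  measurable (whole_sample @^-1` A).
Proof. by move=> mA; exact: (measurable_sample_preimage Xiid). Qed.

Let topE f := whole_sample @^-1` top g f.

Let mtopE f : measurable (topE f).
Proof. by apply: measurable_whole; exact: measurable_top. Qed.

Lemma P_top_eq f e : injective f -> injective e -> P (topE f) = P (topE e).
Proof.
move=> fi ei; have [s sE] := perm_injective fi ei.
have -> : e = pact s f by apply/ffunP => a; rewrite ffunE sE.
pose v : p.-tuple nat := [tuple val (s i) | i < p].
rewrite /topE (_ : _ @^-1` top g (pact s f) = sample X v @^-1` top g f).
  apply: (sample_law Xiid) => //.
  - by rewrite map_inj_uniq ?enum_uniq// => i j /val_inj/perm_inj.
  - by move=> _ /mapP[k _ ->] /=.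
  - exact: measurable_top.
have E om : pshuffle s (whole_sample om) = sample X v om.
  by apply: eq_from_tnth => k; rewrite /pshuffle /sample !(tnth_mktuple, tnth_map).
have tE om : top g f (sample X v om) <-> top g (pact s f) (whole_sample om).
  by rewrite -E; exact: top_pshuffle.
by apply/seteqP; split => om /= /tE.
Qed.

Definition top_event (Q : pred {ffun 'I_K * 'I_m -> 'I_p}) : set T :=
  [set om | exists f, [/\ injective f, Q f & top g f (whole_sample om)]].

Lemma measurable_top_event Q : measurable (top_event Q).
Proof.
rewrite (_ : top_event Q = \bigcup_(f in [set f : {ffun 'I_K * 'I_m -> 'I_p} | injective f /\ Q f]) topE f).
  by apply: fin_bigcup_measurable => //; exact: finite_finset.
by apply/seteqP; split => om [f]; [move=> [fi Qf tf]; exists f|move=> [fi Qf] tf; exists f].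
Qed.

(** Given that top index sets exist, they are uniformly distributed over injective arrays up to
    reordering. The product form also covers a null event and the absence of injective arrays. *)
Lemma prob_top_event Q : (forall f e, same_blocks f e -> Q f = Q e) ->
  fine (P (top_event Q)) * #|[pred f : {ffun 'I_K * 'I_m -> 'I_p} | injectiveb f]|%:R =
  fine (P (top_event predT)) * #|[pred f : {ffun 'I_K * 'I_m -> 'I_p} | injectiveb f && Q f]|%:R.
Proof.
move=> Qs.
have [e0i|noinj] := pickP [pred f : {ffun 'I_K * 'I_m -> 'I_p} | injectiveb f]; last first.
  have -> : #|[pred f : {ffun 'I_K * 'I_m -> 'I_p} | injectiveb f]| = 0%N.
    by apply: eq_card0 => f; exact: noinj.
  have -> : #|[pred f : {ffun 'I_K * 'I_m -> 'I_p} | injectiveb f && Q f]| = 0%N.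
    by apply: eq_card0 => f; have := noinj f; rewrite !inE => ->.
  by rewrite !mulr0.
move=> /= e0inj; have e0P : injective e0i by apply/injectiveP.
pose hh : nat := #|[set f : {ffun 'I_K * 'I_m -> 'I_p} | injectiveb f && same_blocks f e0i]%SET|.
have hh0 : (hh%:R : R) != 0.
  rewrite pnatr_eq0 -lt0n; apply/card_gt0P; exists e0i; rewrite inE; apply/andP; split => //.
  by apply/forallP => i; exact: perm_refl.
(* Double counting: a sample in the event lies in [topE f] for exactly [hh] injective arrays [f]
   satisfying [Q'], and all [topE f] with [f] injective are equally likely. *)
have key Q' : (forall f e, same_blocks f e -> Q' f = Q' e) ->
    hh%:R * fine (P (top_event Q')) =
    fine (P (topE e0i)) * #|[pred f : {ffun 'I_K * 'I_m -> 'I_p} | injectiveb f && Q' f]|%:R.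
  move=> Q's.
  pose c f : R := (injectiveb f && Q' f)%:R.
  have c0 f : 0 <= c f by rewrite /c ler0n.
  have := integral_sum_indic P mtopE c0.
  have -> : (fun om => (\sum_f c f * \1_(topE f) om)%:E) =
      (fun om => (\sum_(i : 'I_1) hh%:R * \1_(top_event Q') om)%:E).
    apply/funext => om; congr EFin; rewrite big_ord1.
    have [[e [ei Q'e te]]|nt] := pselect (top_event Q' om); last first.
      rewrite [\1_(top_event _) _]indicE memNset// mulr0 big1// => f _.
      rewrite /c; case: (boolP (_ && _)) => [/andP[/injectiveP fi Q'f]|]; last by rewrite mul0r.
      by rewrite indicE memNset ?mulr0// => tf; apply: nt; exists f.
    rewrite [\1_(top_event _) _]indicE mem_set ?mulr1; last by exists e.
    rewrite /hh (card_same_blocks e0P ei) -sum1_card natr_sum [RHS]big_mkcond/=.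
    apply: eq_bigr => f _; rewrite inE /c.
    have [/injectiveP fi|nfi] := boolP (injectiveb f); last by rewrite mul0r.
    have [sfe|nsfe] := boolP (same_blocks f e).
      rewrite (Q's _ _ sfe) Q'e mul1r indicE mem_set//.
      exact/(top_same_blocks g_sym m_gt0 fi ei te).
    rewrite indicE memNset ?mulr0// => tf; move/negP : nsfe; apply.
    exact/(top_same_blocks g_sym m_gt0 fi ei te).
  rewrite (@integral_sum_indic _ _ _ P _ (fun=> top_event Q')) => //; last first.
    by move=> _; exact: measurable_top_event.
  rewrite big_ord1 => -[->].
  rewrite mulr_natr -sumr_const.
  rewrite [RHS]big_mkcond; apply: eq_bigr => f _; rewrite inE /c.
  case: ifPn => [/andP[/injectiveP fi _]|_]; last by rewrite mul0r.
  by rewrite mul1r (P_top_eq fi e0P).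
apply: (mulfI hh0); rewrite !mulrA !key//.
have -> : #|[pred f : {ffun 'I_K * 'I_m -> 'I_p} | injectiveb f && predT f]| =
    #|[pred f : {ffun 'I_K * 'I_m -> 'I_p} | injectiveb f]|.
  by apply: eq_card => f; rewrite !inE andbT.
by rewrite mulrAC.
Qed.

End top_probability.
(** * The largest kernels have disjoint index sets *)

Definition increasing p m (u : m.-tuple 'I_p) := sorted ltn (map val u).

Lemma increasing_uniq p m (u : m.-tuple 'I_p) : increasing u -> uniq u.
Proof.
by move=> su; rewrite -(map_inj_uniq val_inj) (sorted_uniq ltn_trans ltnn).
Qed.

Lemma increasing_inj p m (u v : m.-tuple 'I_p) : increasing u -> increasing v ->
  u =i v -> u = v.
Proof.
move=> su sv uv; apply/val_inj; apply: (inj_map val_inj).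
apply: (irr_sorted_eq ltn_trans ltnn) => // i.
by apply/mapP/mapP => -[a ua ->]; exists a; rewrite ?uv// -uv.
Qed.

Lemma perm_increasing p m (u : m.-tuple 'I_p) : uniq u ->
  exists2 v : m.-tuple 'I_p, increasing v & perm_eq u v.
Proof.
move=> uu; exists (sort_tuple (relpre val leq) u); last by rewrite perm_sym perm_sort.
rewrite /increasing -sort_map ltn_sorted_uniq_leq sort_uniq map_inj_uniq ?uu//=; last exact: val_inj.
by apply: sort_sorted; exact: leq_total.
Qed.

Section top_exists.
Context {R : realType} (m p K : nat) (S : Type) (g : m.-tuple S -> R).
Hypothesis g_sym : forall (s : 'S_m) (y : m.-tuple S),
  g [tuple tnth y (s k) | k < m] = g y.

(** Sort the index sets with kernel above [y] by decreasing kernel and keep the first [K]; the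
    assumption above [y] makes them disjoint and the order strict, and sets below [y] cannot
    compete. *)
Lemma top_exists (x : p.-tuple S) (y : R) :
  (forall u v : m.-tuple 'I_p, increasing u -> increasing v -> u != v ->
     y < TT g x u -> y < TT g x v -> ~~ has (mem u) v /\ TT g x u != TT g x v) ->
  (K <= #|[pred u : m.-tuple 'I_p | increasing u & (y < TT g x u)%R]|)%N ->
  exists f : {ffun 'I_K * 'I_m -> 'I_p}, injective f /\ top g f x.
Proof.
move=> disj; set A := [pred u | _] => KA.
pose ge u v := TT g x v <= TT g x u.
pose L := sort ge (enum A).
have KL : (K <= size L)%N by rewrite size_sort -cardE.
have LA u : (u \in L) = (u \in A) by rewrite mem_sort mem_enum.
have uL : uniq L by rewrite sort_uniq enum_uniq.
have ge_tr : transitive ge by move=> v u w uv vw; exact: le_trans vw uv.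
have ge_refl : reflexive ge by move=> u; exact: lexx.
have sL : sorted ge L by apply: sort_sorted => u v; rewrite /ge le_total.
pose B i := tnth (in_tuple L) (widen_ord KL i).
have BE u0 i : B i = nth u0 L i by rewrite /B (tnth_nth u0).
have BA i : B i \in A by rewrite -LA; exact: mem_tnth.
have Binj i j : B i = B j -> i = j.
  move=> Bij; apply/val_inj/eqP; rewrite -(nth_uniq (B i) _ _ uL) ?(leq_trans (ltn_ord _) KL)//.
  by rewrite -!BE Bij.
have TL u (i : 'I_K) : u \in A -> (forall j : 'I_K, (j <= i)%N -> u != B j) -> TT g x u < TT g x (B i).
  move=> uA nu; have /andP[/= incB yB] := BA i; have /andP[/= incu yu] := uA.
  have [_ ne] := disj _ _ incu incB (nu i (leqnn i)) yu yB.
  rewrite lt_neqAle ne/=.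
  have uLi : (index u L < size L)%N by rewrite index_mem LA.
  suff : ge (nth u L i) (nth u L (index u L)).
    by rewrite /ge nth_index ?LA// -BE.
  apply: (sorted_leq_nth ge_tr ge_refl u sL).
  - by rewrite inE (leq_trans (ltn_ord _) KL).
  - by rewrite inE.
  rewrite leqNgt; apply/negP => ui.
  pose j := Ordinal (ltn_trans ui (ltn_ord i)).
  have /negP := nu j (ltnW ui); apply; apply/eqP.
  by rewrite (BE u) /= nth_index// LA.
pose f : {ffun 'I_K * 'I_m -> 'I_p} := [ffun a => tnth (B a.1) a.2].
have fB i : block f i = B i.
  by apply: eq_from_tnth => k; rewrite tnth_mktuple ffunE.
exists f; split.
  move=> [i k] [j l]; rewrite !ffunE/=; case: (eqVneq i j) => [<-|ij] kl.
    have /andP[/= /increasing_uniq ui _] := BA i.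
    congr pair; apply/val_inj/eqP; rewrite /= -(nth_uniq (tnth (B i) k) _ _ ui) ?size_tuple ?ltn_ord//.
    by rewrite -!tnth_nth kl.
  have /andP[/= incj yj] := BA j; have /andP[/= inci yi] := BA i.
  have [] := disj _ _ inci incj _ yi yj; first by apply: contra_neq ij; exact: Binj.
  by move/hasPn => /(_ (tnth (B j) l)); rewrite mem_tnth -kl => /(_ isT); rewrite /= mem_tnth.
split=> [i j ij|u uu nu i]; rewrite !fB.
  apply: TL => // k ki; apply/eqP => /Binj jk.
  by move: (leq_ltn_trans ki ij); rewrite jk ltnn.
have [v incv uv] := perm_increasing uu.
rewrite (perm_TT g_sym _ uv).
have [yv|vy] := ltP y (TT g x v); last first.
  by rewrite (le_lt_trans vy)//; have /andP[] := BA i.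
apply: TL => [|k _]; first by rewrite inE incv.
by apply/eqP => vk; move: (nu k); rewrite fB -vk uv.
Qed.

End top_exists.

(** * Union bound and Chebyshev's inequality *)

Section finite_probability.
Context d (T : measurableType d) (R : realType) (P : probability T R).

Local Notation Pr A := (fine (P A)).

Lemma Pr_ge0 A : 0 <= Pr A. Proof. by rewrite fine_ge0. Qed.

Lemma Pr_le1 A : measurable A -> Pr A <= 1.
Proof.
by move=> mA; rewrite -lee_fin fineK ?fin_num_measure// probability_le1.
Qed.

Lemma Pr_union_bound (I : finType) (Q : pred I) (A : set T) (B : I -> set T) :
  measurable A -> (forall i, measurable (B i)) ->
  (forall om, A om -> exists2 i, Q i & B i om) -> Pr A <= \sum_(i | Q i) Pr (B i).
Proof.
move=> mA mB AB; pose c i : R := (Q i)%:R.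
have c0 i : 0 <= c i by rewrite ler0n.
have -> : \sum_(i | Q i) Pr (B i) = \sum_i c i * Pr (B i).
  by rewrite big_mkcond; apply: eq_bigr => i _; rewrite /c; case: (Q i); rewrite ?mul1r ?mul0r.
rewrite -lee_fin fineK ?fin_num_measure// -(integral_sum_indic P mB c0) -[in leLHS](setIT A).
rewrite -integral_indic//; apply: ge0_le_integralT => om; rewrite lee_fin.
  by rewrite indicE ler0n.
rewrite indicE; have [/set_mem/AB[i Qi Bi]|_] := boolP (om \in A); last first.
  by apply: sumr_ge0 => i _; rewrite mulr_ge0// indicE.
rewrite (bigD1 i)//= /c Qi mul1r indicE mem_set// ler_wpDr//.
by apply: sumr_ge0 => j _; rewrite mulr_ge0// indicE.
Qed.

Lemma card_indic (I : finType) (E : I -> set T) om :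
  #|[pred i | `[< E i om >]]|%:R = \sum_i \1_(E i) om :> R.
Proof.
rewrite -sum1_card natr_sum big_mkcond; apply: eq_bigr => i _.
rewrite indicE inE; case: asboolP => h; first by rewrite mem_set.
by rewrite memNset.
Qed.

(** Chebyshev's inequality for the number of events that occur, the threshold [K] being below its
    mean. *)
Lemma Pr_few (I : finType) (E : I -> set T) (K : nat) :
  (forall i, measurable (E i)) -> K%:R < \sum_i Pr (E i) ->
  measurable [set om | (#|[pred i | `[< E i om >]]| < K)%N] /\
  Pr [set om | (#|[pred i | `[< E i om >]]| < K)%N] * (\sum_i Pr (E i) - K%:R) ^+ 2 <=
  \sum_i \sum_j Pr (E i `&` E j) - (\sum_i Pr (E i)) ^+ 2.
Proof.
move=> mE; set a := \sum_i Pr (E i) => Ka.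
set N := [set om | _].
have mN : measurable N.
  have -> : N = [set om | \sum_i \1_(E i) om < K%:R :> R].
    by apply/seteqP; split => om /=; rewrite -card_indic ltr_nat.
  have mf : measurable_fun setT (fun om => \sum_i \1_(E i) om : R).
    by apply: measurable_sum => i; exact: measurable_indic.
  have := measurable_fun_ltr mf (measurable_cst (K%:R : R)).
  move=> /(_ measurableT [set true] Logic.I); rewrite setTI.
  by congr measurable; apply/seteqP; split.
split => //.
(* With s the number of occurring events, (a - K)^2 1_N <= (a - s)^2 is rearranged as (a - K)^2 1_N
   + 2 a s <= a^2 + s^2. Both sides are then nonnegative combinations of indicators: weights [b] on
   the events [B], weights [e] on the events [D]. *)
pose B (i : 'I_1 + I) : set T := match i with inl _ => N | inr i => E i end.
pose b (i : 'I_1 + I) : R := match i with inl _ => (a - K%:R) ^+ 2 | inr i => 2 * a end.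
pose D (i : 'I_1 + I * I) : set T := match i with inl _ => setT | inr (i, j) => E i `&` E j end.
pose e (i : 'I_1 + I * I) : R := match i with inl _ => a ^+ 2 | inr (i, j) => 1 end.
have a0 : 0 <= a by apply: sumr_ge0 => i _; exact: Pr_ge0.
have mB i : measurable (B i) by case: i.
have mD i : measurable (D i).
  case: i => [i|[i j]] /=; [exact: measurableT|by apply: measurableI].
have b0 i : 0 <= b i by case: i => [i|i] /=; rewrite ?sqr_ge0// mulr_ge0.
have e0 i : 0 <= e i by case: i => [i|[i j]] /=; rewrite ?sqr_ge0.
have sB (F : set T -> R) : \sum_i b i * F (B i) = (a - K%:R) ^+ 2 * F N + 2 * a * \sum_i F (E i).
  by rewrite big_sumType/= big_ord1 -mulr_sumr.
have sD (F : set T -> R) : \sum_i e i * F (D i) = a ^+ 2 * F setT + \sum_i \sum_j F (E i `&` E j).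
  rewrite big_sumType/= big_ord1 pair_bigA/=; congr (_ + _).
  by apply: eq_bigr => -[i j] _ /=; rewrite mul1r.
have : \sum_i b i * Pr (B i) <= \sum_i e i * Pr (D i).
  rewrite -lee_fin -(integral_sum_indic P mB b0) -(integral_sum_indic P mD e0).
  apply: ge0_le_integralT => om; rewrite lee_fin.
    by apply: sumr_ge0 => i _; rewrite mulr_ge0// indicE.
  rewrite (sB (fun A => \1_A om)) (sD (fun A => \1_A om)).
  set s := \sum_i \1_(E i) om.
  have -> : \sum_i \sum_j \1_(E i `&` E j) om = s ^+ 2 :> R.
    rewrite expr2 big_distrl/=; apply: eq_bigr => i _; rewrite big_distrr/=.
    by apply: eq_bigr => j _; rewrite indicI.
  rewrite [\1_setT _]indicE in_setT mulr1.
  have [Nom|Nom] := pselect (N om); last first.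
    rewrite [\1_N _]indicE memNset// mulr0 add0r.
    by have := sqr_ge0 (a - s); rewrite sqrrB; lra.
  rewrite [\1_N _]indicE mem_set// mulr1.
  have sK : s < K%:R by rewrite /s -card_indic ltr_nat.
  have : (a - K%:R) ^+ 2 <= (a - s) ^+ 2.
    by rewrite ler_sqr ?nnegrE; lra.
  by rewrite [in leRHS]sqrrB; lra.
rewrite (sB (fun A => Pr A)) (sD (fun A => Pr A)) -/a probability_setT/= mulr1.
by lra.
Qed.

End finite_probability.

(** * Pairs of overlapping index sets *)

Section overlaps.
Variables (p m : nat).
Implicit Types (u v : m.-tuple 'I_p).

Definition overlap u v := count (mem v) u.

(** Without repetitions in [u] and [v], the first [m] entries list [u] and the last [m] list [v], up
    to order: this is the overlap pattern of (A2). *)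
Definition merge_pair u v : seq 'I_p :=
  [seq a <- u | a \notin v] ++ [seq a <- u | a \in v] ++ [seq a <- v | a \notin u].

Lemma perm_common u v : uniq u -> uniq v ->
  perm_eq [seq a <- u | a \in v] [seq a <- v | a \in u].
Proof.
move=> uu uv; apply: uniq_perm; rewrite ?filter_uniq// => a.
by rewrite !mem_filter andbC.
Qed.

Lemma size_merge_pair u v : uniq u -> uniq v ->
  size (merge_pair u v) = (2 * m - overlap u v)%N.
Proof.
move=> uu uv; rewrite /merge_pair !size_cat !size_filter.
have hu := count_predC (mem v) u; have hv := count_predC (mem u) v.
have hc := perm_size (perm_common uu uv).
move: hu hv hc; rewrite !size_filter !size_tuple /overlap.
rewrite -[count (fun a => a \notin v) u]/(count (predC (mem v)) u).
rewrite -[count (fun a => a \notin u) v]/(count (predC (mem u)) v).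
rewrite -[count (fun a => a \in v) u]/(count (mem v) u).
rewrite -[count (fun a => a \in u) v]/(count (mem u) v); lia.
Qed.

Lemma overlap_le u v : (overlap u v <= m)%N.
Proof. by rewrite /overlap (leq_trans (count_size _ _))// size_tuple. Qed.

Lemma size_left u v : size [seq a <- u | a \notin v] = (m - overlap u v)%N.
Proof.
rewrite size_filter; have := count_predC (mem v) u; rewrite size_tuple /overlap.
rewrite -[count (fun a => a \notin v) u]/(count (predC (mem v)) u) => hu; lia.
Qed.

Lemma perm_take_merge u v : perm_eq (take m (merge_pair u v)) u.
Proof.
rewrite /merge_pair catA take_size_cat; last first.
  by rewrite size_cat size_left size_filter subnK// overlap_le.
by rewrite perm_catC perm_filterC.
Qed.

Lemma perm_drop_merge u v : uniq u -> uniq v ->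
  perm_eq (drop (m - overlap u v) (merge_pair u v)) v.
Proof.
move=> uu uv; rewrite /merge_pair drop_size_cat; last exact: size_left.
rewrite (perm_trans _ (permEl (perm_filterC (mem u) v)))//.
by rewrite perm_cat2r perm_common.
Qed.

Lemma uniq_merge_pair u v : uniq u -> uniq v -> uniq (merge_pair u v).
Proof.
move=> uu uv; rewrite /merge_pair catA cat_uniq (perm_uniq (permEl (perm_catC _ _))).
rewrite (perm_uniq (permEl (perm_filterC (mem v) u))) uu filter_uniq// andbT/=.
apply/hasPn => a; rewrite mem_filter => /andP[au av].
by rewrite /= mem_cat !mem_filter (negPf au) !andbF.
Qed.

(** The merged list has 2 m - l entries and, [l] being known, determines both index sets. *)
Lemma card_overlap l :
  (#|[pred uv : m.-tuple 'I_p * m.-tuple 'I_p |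
      [&& increasing uv.1, increasing uv.2 & overlap uv.1 uv.2 == l]]|
    <= p ^ (2 * m - l))%N.
Proof.
set D := [pred uv | _].
pose s1 := [seq merge_pair uv.1 uv.2 | uv <- enum D].
pose s2 := [seq val t | t : (2 * m - l).-tuple 'I_p].
have -> : (p ^ (2 * m - l))%N = size s2 by rewrite size_map -cardE card_tuple card_ord.
have -> : #|D| = size s1 by rewrite size_map -cardE.
apply: uniq_leq_size.
  rewrite map_inj_in_uniq ?enum_uniq// => -[u v] [u' v'].
  rewrite !mem_enum !inE/= => /and3P[iu iv /eqP ol] /and3P[iu' iv' /eqP ol'] E.
  have uE : u =i u'.
    by move=> a; rewrite -(perm_mem (perm_take_merge u v)) E (perm_mem (perm_take_merge _ _)).
  have vE : v =i v'.
    move=> a; rewrite -(perm_mem (perm_drop_merge (increasing_uniq iu) (increasing_uniq iv))).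
    by rewrite E ol -ol' (perm_mem (perm_drop_merge (increasing_uniq iu') (increasing_uniq iv'))).
  by rewrite (increasing_inj iu iu' uE) (increasing_inj iv iv' vE).
move=> s0 /mapP[[u v]]; rewrite mem_enum !inE/= => /and3P[iu iv /eqP ol] ->.
have sz : size (merge_pair u v) == (2 * m - l)%N.
  by rewrite size_merge_pair ?increasing_uniq// ol.
by apply/mapP; exists (Tuple sz); rewrite ?mem_enum.
Qed.

Lemma overlap_lt u v : increasing u -> increasing v -> u != v -> (overlap u v < m)%N.
Proof.
move=> iu iv uv; rewrite ltn_neqAle overlap_le andbT; apply: contra_neq uv => ol.
have ss : {subset u <= v}.
  apply/allP; rewrite all_count; apply/eqP; rewrite size_tuple; exact: ol.
apply: increasing_inj => //.
by have [] := uniq_min_size (increasing_uniq iu) ss; rewrite ?size_tuple.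
Qed.

Lemma overlap_gt0 u v : (0 < overlap u v)%N = has (mem v) u.
Proof. by rewrite has_count. Qed.

End overlaps.

Section pair_probability.
Context d (T : measurableType d) (R : realType) (P : probability T R).
Context d' (S : measurableType d').
Variables (m p : nat) (X : nat -> T -> S) (g : m.-tuple S -> R).
Hypothesis Xiid : iid P [set i | (i < p)%N] X.
Hypothesis g_sym : forall (s : 'S_m) (y : m.-tuple S),
  g [tuple tnth y (s k) | k < m] = g y.
Hypothesis mg : measurable_fun setT g.
Hypothesis m_gt0 : (0 < m)%N.
Implicit Types (u v : m.-tuple 'I_p) (B : set R).

Definition kernel_in u B : set T := [set om | B (T_ g (X ^~ om) (map_tuple val u))].

Definition overlap_event (l : nat) (y : R) : set T := [set om |
  y < g [tuple X k om | k < m] /\ y < g [tuple X (m - l + k)%N om | k < m]].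

Let valD u i : i \in map_tuple val u -> [set i | (i < p)%N] i.
Proof. by move=> /mapP[k _ ->] /=. Qed.

Lemma measurable_kernel_in u B : measurable B -> measurable (kernel_in u B).
Proof.
move=> mB; apply: (measurable_sample_preimage Xiid (A := g @^-1` B)) => //.
  exact: valD.
by rewrite -[X in measurable X]setTI; exact: mg.
Qed.

Lemma P_kernel_in u B : uniq u -> measurable B ->
  P (kernel_in u B) = P [set om | B (g [tuple X k om | k < m])].
Proof.
move=> uu mB; have mA : measurable (g @^-1` B).
  by rewrite -[X in measurable X]setTI; exact: mg.
have mp : (m <= p)%N.
  by have := max_card (mem u); rewrite (card_uniqP uu) size_tuple card_ord.
pose v : m.-tuple nat := [tuple val k | k < m].
have E : [set om | B (g [tuple X k om | k < m])] = sample X v @^-1` (g @^-1` B).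
  apply/seteqP; split => om /=; rewrite (_ : sample X v om = [tuple X k om | k < m])//;
    by apply: eq_from_tnth => k; rewrite tnth_map !tnth_mktuple.
rewrite E; apply: (sample_law Xiid) => //.
- by rewrite map_inj_uniq//; exact: val_inj.
- exact: valD.
- by rewrite map_inj_uniq ?enum_uniq//; exact: val_inj.
- by move=> _ /mapP[k _ ->] /=; exact: leq_trans (ltn_ord k) mp.
Qed.

Lemma P_kernel_in2 u v A B : uniq u -> uniq v -> ~~ has (mem u) v ->
  measurable A -> measurable B ->
  P (kernel_in u A `&` kernel_in v B) = (P (kernel_in u A) * P (kernel_in v B))%E.
Proof.
move=> uu uv nuv mA mB.
apply: (sample_indep Xiid (A := g @^-1` A) (B := g @^-1` B)).
- rewrite -map_cat map_inj_uniq; last exact: val_inj.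
  by rewrite cat_uniq uu nuv uv.
- by move=> i; rewrite mem_cat => /orP[] /mapP[k _ ->] /=.
- by rewrite -[X in measurable X]setTI; exact: mg.
- by rewrite -[X in measurable X]setTI; exact: mg.
Qed.

(** The pair is a function of 2 m - l distinct observations, whose joint law is that of the first 2
    m - l; the symmetry of [g] absorbs the reordering. *)
Lemma P_overlap u v (y : R) : increasing u -> increasing v -> u != v ->
  P (kernel_in u `]y, +oo[ `&` kernel_in v `]y, +oo[) =
  P (overlap_event (overlap u v) y).
Proof.
move=> iu iv uv; set l := overlap u v.
have uu := increasing_uniq iu; have uv' := increasing_uniq iv.
have lm : (l < m)%N by exact: overlap_lt.
set r := (2 * m - l)%N.
have h1 (k : 'I_m) : (k < r)%N by have := ltn_ord k; rewrite /r; lia.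
have h2 (k : 'I_m) : (m - l + k < r)%N by have := ltn_ord k; rewrite /r; lia.
pose i1 k := Ordinal (h1 k); pose i2 k := Ordinal (h2 k).
pose B : set (r.-tuple S) := [set x |
  y < g [tuple tnth x (i1 k) | k < m] /\ y < g [tuple tnth x (i2 k) | k < m]].
have mB : measurable B.
  have mi (i : 'I_m -> 'I_r) :
      measurable [set x : r.-tuple S | y < g [tuple tnth x (i k) | k < m]].
    have mgf : measurable_fun setT (g \o (fun x : r.-tuple S => [tuple tnth x (i k) | k < m])).
      apply: (measurableT_comp mg); apply/measurable_fun_tnthP => k.
      rewrite (_ : _ \o _ = fun x => tnth x (i k)); first exact: measurable_tnth.
      by apply/funext => x /=; rewrite tnth_mktuple.
    have := mgf measurableT _ (measurable_itv `]y, +oo[); rewrite setTI.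
    by congr measurable; apply/seteqP; split => x /=; rewrite in_itv/= andbT.
  by apply: measurableI; exact: mi.
have sz : size (map val (merge_pair u v)) == r.
  by rewrite size_map size_merge_pair.
pose z : r.-tuple nat := Tuple sz.
pose z0 : r.-tuple nat := [tuple val k | k < r].
have uz : uniq z by rewrite map_inj_uniq ?uniq_merge_pair//; exact: val_inj.
have zp i : i \in z -> [set i | (i < p)%N] i by move=> /mapP[k _ ->] /=.
have rp : (r <= p)%N.
  have := max_card (mem (merge_pair u v)).
  by rewrite (card_uniqP (uniq_merge_pair uu uv')) card_ord size_merge_pair.
transitivity (P (sample X z @^-1` B)).
  have take_z : val [tuple tnth z (i1 k) | k < m] = map val (take m (merge_pair u v)).
    apply: (@eq_from_nth _ 0%N).
      rewrite size_tuple size_map size_takel// size_merge_pair// -/l; lia.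
    move=> k; rewrite size_tuple => km; rewrite -(tnth_nth _ _ (Ordinal km)) tnth_mktuple.
    by rewrite (tnth_nth 0%N)/= map_take nth_take.
  have drop_z : val [tuple tnth z (i2 k) | k < m] = map val (drop (m - l) (merge_pair u v)).
    apply: (@eq_from_nth _ 0%N).
      rewrite size_tuple size_map size_drop size_merge_pair// -/l; lia.
    move=> k; rewrite size_tuple => km; rewrite -(tnth_nth _ _ (Ordinal km)) tnth_mktuple.
    by rewrite (tnth_nth 0%N)/= map_drop nth_drop.
  have E i om : [tuple tnth (sample X z om) (i k) | k < m] =
      map_tuple (X ^~ om) [tuple tnth z (i k) | k < m].
    by apply: eq_from_tnth => k; rewrite !(tnth_mktuple, tnth_map).
  have Eu om : g [tuple tnth (sample X z om) (i1 k) | k < m] = T_ g (X ^~ om) (map_tuple val u).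
    rewrite E; apply: (perm_T g_sym (X ^~ om)); rewrite take_z; apply: perm_map.
    exact: perm_take_merge.
  have Ev om : g [tuple tnth (sample X z om) (i2 k) | k < m] = T_ g (X ^~ om) (map_tuple val v).
    rewrite E; apply: (perm_T g_sym (X ^~ om)); rewrite drop_z; apply: perm_map.
    exact: perm_drop_merge.
  congr (P _); apply/seteqP; split => om; rewrite /B /kernel_in /= Eu Ev !in_itv/= !andbT.
    by [].
  by [].
rewrite (sample_law Xiid (v := z0)) => //.
- have E i om : [tuple tnth (sample X z0 om) (i k) | k < m] = [tuple X (i k : 'I_r) om | k < m].
    by apply: eq_from_tnth => k; rewrite !(tnth_mktuple, tnth_map).
  by congr (P _); apply/seteqP; split => om; rewrite /B /overlap_event /= !E.
- by rewrite map_inj_uniq ?enum_uniq//; exact: val_inj.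
- by move=> _ /mapP[k _ ->] /=; exact: leq_trans (ltn_ord k) rp.
Qed.

End pair_probability.

(** * Probability that strict, disjoint top index sets exist *)

Section top_event_bound.
Context d (T : measurableType d) (R : realType) (P : probability T R).
Context d' (S : measurableType d').
Variables (m p K : nat) (X : nat -> T -> S) (g : m.-tuple S -> R).
Hypothesis Xiid : iid P [set i | (i < p)%N] X.
Hypothesis g_sym : forall (s : 'S_m) (y : m.-tuple S),
  g [tuple tnth y (s k) | k < m] = g y.
Hypothesis mg : measurable_fun setT g.
Hypothesis m_gt0 : (0 < m)%N.
Implicit Types (u v : m.-tuple 'I_p) (B : set R).

Local Notation Pr A := (fine (P A)).
Local Notation E := (kernel_in X g).

Definition Pr0 B : R := Pr [set om | B (g [tuple X k om | k < m])].

Let C : R := 'C(p, m)%:R.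

Let Pr_E u B : uniq u -> measurable B -> Pr (E u B) = Pr0 B.
Proof. by move=> uu mB; rewrite (P_kernel_in Xiid). Qed.

Lemma sum_increasing (c : R) :
  \sum_(u : m.-tuple 'I_p | increasing u) c = C * c.
Proof.
rewrite sumr_const -mulr_natl /C -card_ltn_sorted_tuples; congr (_%:R * _).
by apply: eq_card => u; rewrite inE.
Qed.

(** A bound on the expected number of ordered pairs of distinct overlapping index sets with both
    kernels above [y]; (A2) makes each term vanish in the limit. *)
Definition overlap_weight (y : R) : R :=
  \sum_(l < m | (0 < l)%N) (p ^ (2 * m - l))%:R * Pr (overlap_event X g l y).

Let OV : pred (m.-tuple 'I_p * m.-tuple 'I_p) :=
  [pred uv | [&& increasing uv.1, increasing uv.2, uv.1 != uv.2 & has (mem uv.2) uv.1]].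

Lemma sum_overlap (y : R) :
  \sum_(uv | OV uv) Pr (E uv.1 `]y, +oo[ `&` E uv.2 `]y, +oo[) <= overlap_weight y.
Proof.
pose ov (uv : m.-tuple 'I_p * m.-tuple 'I_p) : 'I_m :=
  insubd (Ordinal m_gt0) (overlap uv.1 uv.2).
have ovE uv : OV uv -> ov uv = overlap uv.1 uv.2 :> nat.
  by move=> /and4P[iu iv uv0 _]; rewrite /ov val_insubd overlap_lt.
rewrite (partition_big ov (fun l : 'I_m => (0 < l)%N))/=; last first.
  by move=> uv OVuv; rewrite ovE// overlap_gt0; case/and4P: OVuv.
apply: ler_sum => l l0.
apply: (@le_trans _ _ (\sum_(uv | OV uv && (ov uv == l)) Pr (overlap_event X g l y))).
  apply: ler_sum => uv /andP[OVuv /eqP <-].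
  by have /and4P[iu iv uv0 _] := OVuv; rewrite (P_overlap Xiid g_sym mg m_gt0 y iu iv uv0) ovE.
rewrite sumr_const -[leLHS]mulr_natl; apply: ler_wpM2r; first exact: Pr_ge0.
rewrite ler_nat; apply: leq_trans (card_overlap p m l); apply: subset_leq_card.
apply/fintype.subsetP => uv; rewrite !inE => /andP[OVuv /eqP <-].
by rewrite ovE//; have /and4P[-> -> _ _] := OVuv; rewrite eqxx.
Qed.

Let DJ : pred (m.-tuple 'I_p * m.-tuple 'I_p) :=
  [pred uv | [&& increasing uv.1, increasing uv.2 & ~~ has (mem uv.2) uv.1]].

(** Each disjoint pair contributes the square of [Pr0 B] by independence, and the disjoint pairs are
    among all pairs of index sets. *)
Lemma sum_disjoint B : measurable B ->
  \sum_(uv | DJ uv) Pr (E uv.1 B `&` E uv.2 B) <= (C * Pr0 B) ^+ 2.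
Proof.
move=> mB; apply: (@le_trans _ _ (\sum_(uv | DJ uv) Pr0 B * Pr0 B)).
  apply: ler_sum => -[u v] /and3P[/= iu iv uv].
  rewrite (P_kernel_in2 Xiid) ?increasing_uniq// 1?has_sym//.
  by rewrite fineM ?fin_num_measure// ?Pr_E ?increasing_uniq//;
    apply: (measurable_kernel_in Xiid).
rewrite expr2 -!sum_increasing big_distrl/=.
under [leRHS]eq_bigr do rewrite big_distrr/=.
rewrite pair_big_dep/= big_mkcond [leRHS]big_mkcond/=; apply: ler_sum => -[u v] _ /=.
rewrite /DJ/=; have p0 : 0 <= Pr0 B * Pr0 B by rewrite mulr_ge0// Pr_ge0.
case: (increasing u); case: (increasing v); case: (has _ _) => //=.
Qed.

Lemma slab_exists (y : nat -> R) r t : y 0 < t ->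
  exists s : 'I_r.+1, y s < t /\ ((s < r)%N -> t <= y s.+1).
Proof.
move=> y0; elim: r => [|r [s [ys st]]]; first by exists ord0.
have [yr|yr] := ltP (y r.+1) t; first by exists ord_max; rewrite ltnn.
exists (widen_ord (leqnSn _) s); split => //= _.
have [sr|] := ltnP s r; first exact: st.
move=> rs; have -> : s = r :> nat by apply/eqP; rewrite eqn_leq rs -ltnS ltn_ord.
by [].
Qed.

(** Slabs control ties: equal kernels share a slab, and disjoint pairs rarely share one of small
    mass. The last slab is unbounded so that all values above [y 0] are covered. *)
Definition slab (y : nat -> R) r s : set R :=
  if (s < r)%N then `]y s, y s.+1]%classic else `]y s, +oo[%classic.

Let measurable_slab y r s : measurable (slab y r s).
Proof. by rewrite /slab; case: ifP => _; exact: measurable_itv. Qed.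

(* If there are no K strictly largest kernels on disjoint index sets, then two
   overlapping kernels exceed [y 0], or two disjoint ones lie in the same slab,
   or fewer than K exceed [y 0]; the last case is Chebyshev's inequality. *)
Lemma top_event_bound (y : nat -> R) r :
  let a := C * Pr0 `]y 0, +oo[ in
  K%:R < a ->
  1 - Pr (top_event (p := p) (K := K) X g predT) <=
  overlap_weight (y 0) + \sum_(s < r.+1) (C * Pr0 (slab y r s)) ^+ 2 +
  (a + overlap_weight (y 0)) / (a - K%:R) ^+ 2.
Proof.
move=> a Ka.
pose F u : set T := if increasing u then E u `]y 0, +oo[ else set0.
have mE u B : measurable B -> measurable (E u B).
  by move=> mB; exact: (measurable_kernel_in Xiid).
have my0 : measurable (`]y 0, +oo[%classic : set R) by exact: measurable_itv.
have mF u : measurable (F u) by rewrite /F; case: ifP => // _; exact: mE.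
have sumF : \sum_u Pr (F u) = a.
  rewrite /a -sum_increasing [RHS]big_mkcond; apply: eq_bigr => u _.
  rewrite /F; case: ifP => iu; last by rewrite measure0.
  by rewrite Pr_E// increasing_uniq.
(* The second moment, split into equal, disjoint and overlapping pairs; [a ^+ 2] cancels in the
   variance. *)
have sumFF : \sum_u \sum_v Pr (F u `&` F v) <= a + a ^+ 2 + overlap_weight (y 0).
  have h1 := sum_overlap (y 0); have h2 := sum_disjoint my0.
  apply: (@le_trans _ _ (\sum_u Pr (F u) +
    \sum_(uv | DJ uv) Pr (E uv.1 `]y 0, +oo[ `&` E uv.2 `]y 0, +oo[) +
    \sum_(uv | OV uv) Pr (E uv.1 `]y 0, +oo[ `&` E uv.2 `]y 0, +oo[))); last first.
    by rewrite sumF -/a in h2 *; lra.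
  have -> : \sum_u Pr (F u) = \sum_u \sum_v (if u == v then Pr (F u) else 0).
    by apply: eq_bigr => u _; rewrite -big_mkcond/= (big_pred1 u)// => v; rewrite eq_sym.
  rewrite !pair_bigA/= [in X in _ + X + _]big_mkcond [in X in _ + _ + X]big_mkcond -!big_split/=.
  apply: ler_sum => -[u v] _ /=.
  have pE (A : set T) : 0 <= Pr A by exact: Pr_ge0.
  rewrite /F /OV /DJ/=; case: eqVneq => [<-|uv].
    by rewrite setIid -addrA lerDl addr_ge0//; case: ifP.
  case: (increasing u) => /=; last by rewrite set0I measure0 !addr0.
  case: (increasing v) => /=; last by rewrite setI0 measure0 !addr0.
  by case: (has _ _) => /=; rewrite ?add0r ?addr0.
have [mN PN] := Pr_few (K := K) mF (eq_ind_r (fun z => K%:R < z) Ka sumF).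
set N := [set om | _] in mN PN.
have aK : 0 < (a - K%:R) ^+ 2 by rewrite exprn_gt0// subr_gt0.
have {}PN : Pr N <= (a + overlap_weight (y 0)) / (a - K%:R) ^+ 2.
  by rewrite ler_pdivlMr//; move: PN; rewrite sumF; lra.
pose J := (m.-tuple 'I_p * m.-tuple 'I_p)%type.
pose Q (j : J + 'I_r.+1 * J + 'I_1) : bool := match j with
  | inl (inl uv) => OV uv | inl (inr (_, uv)) => DJ uv | inr _ => true end.
pose D (j : J + 'I_r.+1 * J + 'I_1) : set T := match j with
  | inl (inl uv) => E uv.1 `]y 0, +oo[ `&` E uv.2 `]y 0, +oo[
  | inl (inr (s, uv)) => E uv.1 (slab y r s) `&` E uv.2 (slab y r s)
  | inr _ => N end.
have mD j : measurable (D j).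
  case: j => [[uv|[s uv]]|i] //=; apply: measurableI; apply: mE => //; exact: measurable_slab.
have mtop : measurable (top_event (p := p) (K := K) X g predT).
  exact: (measurable_top_event Xiid mg).
have cover om : (~` top_event (p := p) (K := K) X g predT) om -> exists2 j, Q j & D j om.
  move=> ntop; apply: contrapT => nD; apply: ntop.
  have nD' j : Q j -> ~ D j om by move=> Qj Dj; apply: nD; exists j.
  have [||f [fi ft]] := @top_exists R m p K S g g_sym (whole_sample p X om) (y 0); last by exists f.
    move=> u v iu iv uv; rewrite !TT_whole_sample => yu yv.
    have nh : ~~ has (mem v) u.
      apply/negP => huv; apply: (nD' (inl (inl (u, v)))); first by apply/and4P.
      by rewrite /= /kernel_in /= !in_itv/= !andbT.
    split; first by rewrite has_sym.
    apply/eqP => uvE; have [s [ys st]] := slab_exists r yu.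
    apply: (nD' (inl (inr (s, (u, v))))); first by apply/and3P.
    have su : slab y r s (T_ g (X ^~ om) (map_tuple val u)).
      by rewrite /slab; case: ifP => sr; rewrite /= in_itv/= ys//= st.
    by split => //=; rewrite /kernel_in /= -uvE.
  have := nD' (inr ord0) isT; rewrite /= /N /= => /negP; rewrite -leqNgt.
  move=> /leq_trans; apply; apply: subset_leq_card; apply/fintype.subsetP => u.
  move=> /(@asboolP (F u om)); rewrite /F inE; case: ifP => //= iu.
  by rewrite /kernel_in /= in_itv/= andbT TT_whole_sample.
have := Pr_union_bound P (measurableC mtop) mD cover.
rewrite probability_setC// fineB ?fin_num_measure//= big_sumType big_ord1/=.
move=> /le_trans; apply; apply: lerD => //.
rewrite big_sumType/=; apply: lerD; first exact: sum_overlap.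
rewrite (eq_bigl (fun j : 'I_r.+1 * J => true && DJ j.2)); last by case.
rewrite (eq_bigr (fun j : 'I_r.+1 * J => Pr (E j.2.1 (slab y r j.1) `&` E j.2.2 (slab y r j.1)))); last by case.
rewrite -(pair_big xpredT DJ (fun (s : 'I_r.+1) uv => Pr (E uv.1 (slab y r s) `&` E uv.2 (slab y r s))))/=.
by apply: ler_sum => s _; exact: sum_disjoint.
Qed.

End top_event_bound.
(** * Limits of the cell probabilities *)

Section limits.
Context {R : realType}.

Lemma cvg_fin_prod (I : finType) (Q : pred I) (f : I -> nat -> R) (l : I -> R) :
  (forall i, f i n @[n --> \oo] --> l i) ->
  \prod_(i | Q i) f i n @[n --> \oo] --> \prod_(i | Q i) l i.
Proof. by move=> fl; apply: (cvg_big (@mul_continuous R)). Qed.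

Lemma cvg_fin_sum (I : finType) (Q : pred I) (f : I -> nat -> R) (l : I -> R) :
  (forall i, Q i -> f i n @[n --> \oo] --> l i) ->
  \sum_(i | Q i) f i n @[n --> \oo] --> \sum_(i | Q i) l i.
Proof.
move=> fl; apply: (cvg_big (op := +%R : R -> R -> R)) => //.
by move=> x; apply: (@cvgD R R^o); [exact: cvg_fst|exact: cvg_snd].
Qed.

Variable p : nat -> nat.
Hypothesis p_gt0 : forall n, (0 < p n)%N.
Hypothesis p_cvg : p n @[n --> \oo] --> \oo.

Lemma cvg_inv_p : (p n)%:R^-1 @[n --> \oo] --> (0 : R).
Proof.
have H : (p n)%:R @[n --> \oo] --> (+oo : set_system R) by apply/cvgrnyP.
have pos : \forall n \near \oo, 0 < ((p n)%:R : R).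
  by apply: nearW => n; rewrite ltr0n.
exact: (gtr0_cvgV0 pos).2 H.
Qed.

(** The proportion of injective arrays among all arrays of [k] indices. *)
Lemma cvg_ffact k : ((p n) ^_ k)%:R / (p n)%:R ^+ k @[n --> \oo] --> (1 : R).
Proof.
have E n : ((p n) ^_ k)%:R / (p n)%:R ^+ k = \prod_(i < k) ((p n - i)%:R / (p n)%:R) :> R.
  by rewrite ffact_prod natr_prod prodf_div prodr_const card_ord.
have E1 : \prod_(i < k) 1 = 1 :> R by rewrite big1.
rewrite (funext E) -[X in _ --> X]E1.
apply: cvg_fin_prod => i.
have : (1 - i%:R * (p n)%:R^-1) @[n --> \oo] --> (1 - i%:R * 0 : R).
  by apply: cvgB; [exact: cvg_cst|apply: cvgM; [exact: cvg_cst|exact: cvg_inv_p]].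
rewrite mulr0 subr0; apply: cvg_trans; apply: near_eq_cvg.
near=> n; have ip : (i <= p n)%N by near: n; exact: (cvgnyPge _).1.
by rewrite natrB// mulrBl divff// pnatr_eq0 -lt0n.
Unshelve. all: by end_near. Qed.

Lemma cvg_divn j q : (0 < q)%N ->
  ((p n * j) %/ q)%:R / (p n)%:R @[n --> \oo] --> (j%:R / q%:R : R).
Proof.
move=> q0.
apply: (@squeeze_cvgr _ _ _ _ (fun n => j%:R / q%:R - (p n)%:R^-1) (fun=> j%:R / q%:R)).
- apply: nearW => n; have pR : (0 : R) < (p n)%:R by rewrite ltr0n.
  have qR : (0 : R) < q%:R by rewrite ltr0n.
  have h1 : ((p n * j) %/ q * q <= p n * j)%N := leq_divM _ _.
  have h2 : (p n * j < (p n * j) %/ q * q + q)%N by rewrite -mulSnr ltn_ceil.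
  move: h1 h2; rewrite -(ler_nat R) -(ltr_nat R) natrD !natrM => h1 h2.
  rewrite ler_pdivlMr// ler_pdivrMr// mulrBl mulVf ?gt_eqF//.
  have -> : j%:R / q%:R * (p n)%:R = (p n)%:R * j%:R / q%:R :> R by rewrite mulrC mulrA.
  by rewrite lerBlDr ler_pdivrMr// ler_pdivlMr// h1 andbT mulrDl mul1r ltW.
- rewrite -[X in _ --> X]subr0; apply: cvgB; [exact: cvg_cst|exact: cvg_inv_p].
- exact: cvg_cst.
Qed.

End limits.

Lemma card_injective p m K :
  #|[pred f : {ffun 'I_K * 'I_m -> 'I_p} | injectiveb f]| = p ^_ (K * m).
Proof.
have := card_inj_ffuns ('I_K * 'I_m)%type 'I_p.
by rewrite cardsE card_prod !card_ord.
Qed.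

(** * Counting index arrays by the cells of their maxima *)

Section cell_counts.
Context {R : realType}.
Variables (p m K : nat) (a b : 'I_K -> nat).
Hypothesis ab : forall i, (a i <= b i <= p)%N.

Definition in_cells (f : {ffun 'I_K * 'I_m -> 'I_p}) :=
  [forall i, (a i < next_max (map val (block f i)) <= b i)%N].

Let below c : {set {ffun 'I_m -> 'I_p}} := [set h | h \in ffun_on [pred k : 'I_p | (k < c)%N]]%SET.

Let card_below c : (c <= p)%N -> #|below c| = (c ^ m)%N.
Proof.
move=> cp; rewrite cardsE card_ffun_on card_ord; congr (_ ^ _)%N.
have wi : injective (widen_ord cp) by move=> i j /(congr1 val)/= /val_inj.
rewrite -[RHS]card_ord -(fintype.card_image wi).
apply: eq_card => k; rewrite inE; apply/idP/fintype.imageP => [kc|[i _ ->]]; last exact: ltn_ord i.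
by exists (Ordinal kc) => //; apply/val_inj.
Qed.

(** Without injectivity the blocks are chosen freely. A block whose maximum falls in the cell of [i]
    is a map bounded by [b i] but not by [a i], which leaves (b i)^m - (a i)^m maps. *)
Lemma card_in_cells :
  \prod_(i < K) ((b i)%:R ^+ m - (a i)%:R ^+ m) <=
  #|[pred f : {ffun 'I_K * 'I_m -> 'I_p} | in_cells f]|%:R :> R.
Proof.
pose F i := below (b i) :\: below (a i).
have cF i : #|F i|%:R = (b i)%:R ^+ m - (a i)%:R ^+ m :> R.
  have /andP[abi bp] := ab i.
  have sub : below (a i) \subset below (b i).
    apply/fintype.subsetP => h; rewrite !inE => /ffun_onP ha; apply/ffun_onP => k.
    by have := ha k; rewrite !inE => /leq_trans; apply.
  rewrite cardsD (finset.setIidPr sub) natrB ?subset_leq_card// !card_below ?natrX//.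
  exact: leq_trans bp.
under eq_bigr do rewrite -cF.
have -> : \prod_(i < K) #|F i|%:R = #|family F|%:R :> R.
  by rewrite -natr_prod card_family foldrE big_map big_enum.
rewrite ler_nat.
pose unc (h : {ffun 'I_K -> {ffun 'I_m -> 'I_p}}) : {ffun 'I_K * 'I_m -> 'I_p} :=
  [ffun x => h x.1 x.2].
have unc_inj : injective unc.
  move=> h h' /ffunP E; apply/ffunP => i; apply/ffunP => k.
  by have := E (i, k); rewrite !ffunE.
rewrite -(fintype.card_image unc_inj); apply: subset_leq_card.
apply/fintype.subsetP => f /fintype.imageP[h /familyP hF ->].
rewrite inE; apply/forallP => i; have := hF i; rewrite !inE => /andP[na /ffun_onP hb].
apply/andP; split.
  rewrite ltnNge; apply: contra na; rewrite next_max_leq => /allP h1.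
  apply/ffun_onP => k; rewrite inE; apply: h1; apply/mapP.
  exists (h i k) => //; apply/mapP; exists k; rewrite ?mem_enum// ffunE.
  by [].
rewrite next_max_leq; apply/allP => _ /mapP[_ /mapP[k _ ->] ->].
by rewrite ffunE; have := hb k; rewrite inE.
Qed.

(** All arrays with a repetition are discarded; their number is negligible against p^(K m). *)
Lemma card_injective_in_cells :
  \prod_(i < K) ((b i)%:R ^+ m - (a i)%:R ^+ m) - (p%:R ^+ (K * m) - (p ^_ (K * m))%:R) <=
  #|[pred f : {ffun 'I_K * 'I_m -> 'I_p} | injectiveb f && in_cells f]|%:R :> R.
Proof.
apply: (@le_trans _ _ (#|[pred f : {ffun 'I_K * 'I_m -> 'I_p} | in_cells f]|%:R -
  (p%:R ^+ (K * m) - (p ^_ (K * m))%:R))).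
  by rewrite lerD2r card_in_cells.
rewrite lerBlDr; have -> : p%:R ^+ (K * m) - (p ^_ (K * m))%:R =
    #|[pred f : {ffun 'I_K * 'I_m -> 'I_p} | ~~ injectiveb f]|%:R :> R.
  have := cardC [pred f : {ffun 'I_K * 'I_m -> 'I_p} | injectiveb f].
  rewrite card_ffun card_prod !card_ord -natrX => <-.
  rewrite natrD card_injective.
  by rewrite addrAC subrr add0r; congr _%:R; apply: eq_card => f; rewrite !inE.
rewrite -natrD ler_nat -cardUI; apply: leq_trans (leq_addr _ _).
apply: subset_leq_card; apply/fintype.subsetP => f; rewrite !inE => ->.
by rewrite andbT orbN.
Qed.

End cell_counts.
Lemma same_blocks_in_cells p m K (a b : 'I_K -> nat)
    (f e : {ffun 'I_K * 'I_m -> 'I_p}) :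
  same_blocks f e -> in_cells a b f = in_cells a b e.
Proof.
move=> /forallP fe; apply: eq_forallb => i.
by rewrite (perm_next_max (perm_map val (fe i))).
Qed.

Section cell_event.
Context d (T : measurableType d) (R : realType) (P : probability T R).
Context d' (S : measurableType d').
Variables (m p : nat) (X : nat -> T -> S) (g : m.-tuple S -> R).
Variables (K q : nat) (j : 'I_K -> nat).

(** Rounding down loses nothing: for an integer x these bounds say exactly that x / p lies in ]j /
    q, (j + 1) / q]. *)
Definition cell_event : set T := top_event (p := p) (K := K) X g
  (in_cells (fun i => ((p * j i) %/ q)%N) (fun i => ((p * (j i).+1) %/ q)%N)).

Lemma measurable_cell_event : iid P [set i | (i < p)%N] X -> measurable_fun setT g ->
  measurable cell_event.
Proof. by move=> Xiid mg; exact: (measurable_top_event Xiid mg). Qed.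

End cell_event.

Section first_kernel.
Context d (T : measurableType d) (R : realType) (P : probability T R).
Context d' (S : measurableType d').
Variables (m p : nat) (X : nat -> T -> S) (g : m.-tuple S -> R).
Hypothesis Xiid : iid P [set i | (i < p)%N] X.
Hypothesis mg : measurable_fun setT g.
Hypothesis mp : (m <= p)%N.

Lemma measurable_first (B : set R) : measurable B ->
  measurable [set om | B (g [tuple X k om | k < m])].
Proof.
move=> mB; pose v : m.-tuple nat := [tuple val k | k < m].
have -> : [set om | B (g [tuple X k om | k < m])] = sample X v @^-1` (g @^-1` B).
  apply/seteqP; split => om /=; rewrite (_ : sample X v om = [tuple X k om | k < m])//;
    by apply: eq_from_tnth => k; rewrite tnth_map !tnth_mktuple.
apply: (measurable_sample_preimage Xiid).
  by move=> _ /mapP[k _ ->] /=; exact: leq_trans (ltn_ord k) mp.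
by rewrite -[X in measurable X]setTI; exact: mg.
Qed.

Lemma Pr0_itv (a b : R) : a <= b ->
  Pr0 P X g `]a, b] = Pr0 P X g `]a, +oo[ - Pr0 P X g `]b, +oo[.
Proof.
move=> ab; rewrite /Pr0.
have mi (i : interval R) : measurable [set om | [set` i] (g [tuple X k om | k < m])].
  by apply: measurable_first; exact: measurable_itv.
rewrite -fineB ?fin_num_measure//; congr fine.
rewrite (_ : [set om | `]a, b]%classic _] = [set om | `]a, +oo[%classic (g [tuple X k om | k < m])] `\`
   [set om | `]b, +oo[%classic (g [tuple X k om | k < m])]).
  rewrite measureD//; last by rewrite (le_lt_trans (probability_le1 P _)) ?ltry.
  congr (_ - P _)%E; apply/seteqP; split => om /=; rewrite !in_itv/= !andbT.
    by case.
  by move=> h; split => //; exact: le_lt_trans h.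
apply/seteqP; split => om /=; rewrite !in_itv/= !andbT.
  by move=> /andP[-> h]; split => //; apply/negP; rewrite -leNgt.
by move=> [-> /negP]; rewrite -leNgt => ->.
Qed.

End first_kernel.

Unset Implicit Arguments.

(** * Asymptotic probabilities of the cell events *)

Section triangular_array.
Context {R : realType}.
Context (d : nat -> measure_display) (T : forall n, measurableType (d n)).
Context (P : forall n, probability (T n) R).
Context (d' : nat -> measure_display) (S : forall n, measurableType (d' n)).
Variables (m : nat) (p : nat -> nat) (X : forall n, nat -> T n -> S n).
Variable g : forall n, m.-tuple (S n) -> R.
Hypothesis m_gt0 : (0 < m)%N.
Hypothesis p_gt0 : forall n, (0 < p n)%N.
Hypothesis p_cvg : p n @[n --> \oo] --> \oo.
Hypothesis Xiid : forall n, iid (P n) [set i | (i < p n)%N] (X n).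
Hypothesis mg : forall n, measurable_fun setT (g n).
Hypothesis g_sym : forall n (s : 'S_m) (y : m.-tuple (S n)),
  g n [tuple tnth y (s k) | k < m] = g n y.
(** Thresholds indexed by the limiting expected number of kernels above them. *)
Variable lvl : R -> R.
Hypothesis lvl_lt : forall a b, 0 < a -> a < b -> lvl b < lvl a.
Hypothesis A1 : forall a, 0 < a ->
  'C(p n, m)%:R * Pr0 (P n) (X n) (g n) `]lvl a, +oo[ @[n --> \oo] --> a.
Hypothesis A2 : forall a, 0 < a ->
  overlap_weight (P n) (p n) (X n) (g n) (lvl a) @[n --> \oo] --> (0 : R).

Let full K n := fine (P n (top_event (p := p n) (K := K) (X n) (g n) predT)).

Let p_ge k : \forall n \near \oo, (k <= p n)%N.
Proof. by move/cvgnyPge : p_cvg; exact. Qed.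

(** The thresholds are equally spaced on the scale of expected counts, so all [r.+1] slabs, the
    unbounded one included, have the same limiting count. *)
Lemma slab_near gam r (s : 'I_r.+1) : 0 < gam ->
  'C(p n, m)%:R * Pr0 (P n) (X n) (g n)
     (slab (fun s => lvl (gam * (r.+1%:R - s%:R) / r.+1%:R)) r s)
  @[n --> \oo] --> gam / r.+1%:R.
Proof.
move=> gam0; have r0 : 0 < r.+1%:R :> R by rewrite ltr0n.
pose c (t : nat) : R := gam * (r.+1%:R - t%:R) / r.+1%:R.
have c0 (t : nat) : (t <= r)%N -> 0 < c t.
  by move=> tr; rewrite divr_gt0// mulr_gt0// subr_gt0 ltr_nat ltnS.
have sr : (s <= r)%N by rewrite -ltnS.
rewrite /slab -/(c s) -/(c s.+1); case: ifP => [sr'|/negbT sr'].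
  have cs : c s - c s.+1 = gam / r.+1%:R.
    by rewrite /c -mulrBl -mulrBr -natr1; congr (_ / _); ring.
  rewrite -cs.
  have H : 'C(p n, m)%:R * Pr0 (P n) (X n) (g n) `]lvl (c s), +oo[ -
      'C(p n, m)%:R * Pr0 (P n) (X n) (g n) `]lvl (c s.+1), +oo[ @[n --> \oo]
      --> c s - c s.+1.
    by apply: (@cvgB R R^o); apply: A1; exact: c0.
  move: H; apply: cvg_trans; apply: near_eq_cvg; near=> n.
  have mp : (m <= p n)%N by near: n; exact: p_ge.
  rewrite (Pr0_itv (Xiid n) (mg n) mp) /= ?mulrBr//.
  apply/ltW/lvl_lt; first exact: c0.
  rewrite ltr_pM2r ?invr_gt0// ltr_pM2l// ltrD2l ltrN2 ltr_nat.
  exact: ltnSn.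
have -> : gam / r.+1%:R = c s.
  have -> : s = r :> nat by apply/eqP; rewrite eqn_leq sr leqNgt.
  rewrite /c; have -> : r.+1%:R - r%:R = 1 :> R by rewrite -natr1 addrAC subrr add0r.
  by rewrite mulr1.
exact: A1 _ (c0 _ sr).
Unshelve. all: by end_near. Qed.

Lemma top_event_near K (e : R) : 0 < e ->
  \forall n \near \oo, 1 - e <= full K n.
Proof.
move=> e0.
(* The excess of the limiting mean over [K], large enough to bring the Chebyshev term (K + t) / t^2
   below e / 4. *)
pose t : R := 1 + 8 * (K%:R + 1) / e.
have K0 : (0 : R) <= K%:R by exact: ler0n.
have t1 : 1 < t by rewrite /t ltrDl divr_gt0// mulr_gt0// ltr_wpDl.
pose gam := K%:R + t.
have gam0 : 0 < gam by rewrite /gam; lra.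
have gamt : gam / (gam - K%:R) ^+ 2 < e / 4.
  have -> : gam - K%:R = t by rewrite /gam addrAC subrr add0r.
  rewrite ltr_pdivrMr ?exprn_gt0//; last by lra.
  have h : e / 4 * t > 2 * (K%:R + 1).
    have -> : e / 4 * t = e / 4 + 2 * (K%:R + 1).
      by rewrite /t; field; rewrite gt_eqF.
    by rewrite ltrDr divr_gt0.
  rewrite expr2 mulrA (lt_le_trans (y := 2 * (K%:R + 1) * t))//; last first.
    by rewrite ler_pM2r ?ltW//; lra.
  have : K%:R <= K%:R * t by rewrite ler_peMr// ltW.
  rewrite /gam; lra.
(* The slabs contribute (r + 1) (gam / (r + 1))^2 in the limit, which is small when they are
   many. *)
have [r rP] : exists r : nat, gam ^+ 2 / r.+1%:R < e / 4.
  have e40 : 0 < e / 4 / gam ^+ 2 by rewrite !divr_gt0// exprn_gt0.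
  have := @cvg_harmonic R; move/cvgrPdist_lt => /(_ _ e40)[r _ /(_ r (leqnn r))].
  rewrite sub0r normrN ger0_norm/= ?invr_ge0//; move=> h; exists r.
  by rewrite mulrC -ltr_pdivlMr// exprn_gt0.
pose y s := lvl (gam * (r.+1%:R - s%:R) / r.+1%:R).
have y0 : y 0 = lvl gam by rewrite /y subr0 mulfK// pnatr_eq0.
pose a n := 'C(p n, m)%:R * Pr0 (P n) (X n) (g n) `]y 0, +oo[.
pose rho n := overlap_weight (P n) (p n) (X n) (g n) (y 0).
have acvg : a n @[n --> \oo] --> gam by rewrite /a y0; exact: A1.
have rcvg : rho n @[n --> \oo] --> (0 : R) by rewrite /rho y0; exact: A2.
pose bnd n := rho n + \sum_(s < r.+1) ('C(p n, m)%:R * Pr0 (P n) (X n) (g n) (slab y r s)) ^+ 2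
   + (a n + rho n) / (a n - K%:R) ^+ 2.
have bcvg : bnd n @[n --> \oo] -->
    0 + \sum_(s < r.+1) (gam / r.+1%:R) ^+ 2 + (gam + 0) / (gam - K%:R) ^+ 2.
  apply: (@cvgD R R^o); first apply: (@cvgD R R^o) => //.
    by apply: cvg_fin_sum => s _; rewrite expr2; under eq_fun do rewrite expr2;
      apply: cvgM; exact: slab_near.
  apply: cvgM; first exact: (@cvgD R R^o).
  apply: cvgV.
    by rewrite gt_eqF// exprn_gt0// subr_gt0 /gam; lra.
  have H : a n - K%:R @[n --> \oo] --> gam - K%:R by apply: cvgB => //; exact: cvg_cst.
  by rewrite expr2; under eq_fun do rewrite expr2; apply: cvgM.
have lim_lt : 0 + \sum_(s < r.+1) (gam / r.+1%:R) ^+ 2 + (gam + 0) / (gam - K%:R) ^+ 2 < e.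
  rewrite add0r addr0 sumr_const card_ord.
  have -> : (gam / r.+1%:R) ^+ 2 *+ r.+1 = gam ^+ 2 / r.+1%:R.
    rewrite -[LHS]mulr_natr expr_div_n -mulrA; congr (_ * _).
    by rewrite expr2 invfM mulrVK// unitfE pnatr_eq0.
  by apply: (lt_trans (ltrD rP gamt)); lra.
near=> n.
have aK : K%:R < a n.
  by near: n; apply: (cvgr_gt gam) => //; rewrite /gam; lra.
have := @top_event_bound _ _ _ (P n) _ _ m (p n) K (X n) (g n) (Xiid n) (g_sym n) (mg n) m_gt0 y r aK.
rewrite -/(a n) -/(rho n) -/(bnd n) => h.
have bn : bnd n < e by near: n; exact: (cvgr_lt _ bcvg).
by rewrite /full; lra.
Unshelve. all: by end_near. Qed.

Section cells.
Variables (K q : nat) (j : 'I_K -> nat).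
Hypothesis q_gt0 : (0 < q)%N.
Hypothesis jq : forall i, (j i < q)%N.

Lemma cell_event_near (e : R) : 0 < e -> \forall n \near \oo,
  \prod_(i < K) (((j i).+1%:R / q%:R) ^+ m - ((j i)%:R / q%:R) ^+ m) - e <=
  fine (P n (cell_event (p n) (X n) (g n) q j)).
Proof.
move=> e0.
pose a n i := ((p n * j i) %/ q)%N; pose b n i := ((p n * (j i).+1) %/ q)%N.
have ab n i : (a n i <= b n i <= p n)%N.
  rewrite /a /b leq_div2r ?leq_mul2l ?leqnSn ?orbT//=.
  by rewrite -[leqRHS](mulnK (p n) q_gt0) leq_div2r// leq_mul2l jq orbT.
pose L n := full K n * (\prod_(i < K) (((b n i)%:R / (p n)%:R) ^+ m - ((a n i)%:R / (p n)%:R) ^+ m)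
   - (1 - ((p n) ^_ (K * m))%:R / (p n)%:R ^+ (K * m))).
have LP n : L n <= fine (P n (cell_event (p n) (X n) (g n) q j)).
  pose Ni : R := #|[pred f : {ffun 'I_K * 'I_m -> 'I_(p n)} | injectiveb f]|%:R.
  pose Nq : R := #|[pred f : {ffun 'I_K * 'I_m -> 'I_(p n)} | injectiveb f && in_cells (a n) (b n) f]|%:R.
  have E : fine (P n (cell_event (p n) (X n) (g n) q j)) * Ni = full K n * Nq.
    apply: (prob_top_event (Xiid n) (g_sym n) (mg n) m_gt0) => f f'.
    exact: same_blocks_in_cells.
  have pk : (0 : R) < (p n)%:R ^+ (K * m) by rewrite exprn_gt0// ltr0n.
  have full0 : 0 <= full K n by exact: Pr_ge0.
  have cell0 : 0 <= fine (P n (cell_event (p n) (X n) (g n) q j)) by exact: Pr_ge0.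
  have NiE : Ni = ((p n) ^_ (K * m))%:R by rewrite /Ni card_injective.
  have Nile : Ni <= (p n)%:R ^+ (K * m).
    by rewrite NiE -natrX ler_nat -card_injective (leq_trans (max_card _))// card_ffun card_prod !card_ord.
  (* The number of injective arrays is replaced by its upper bound p^(K m), which is the
     normalization that turns counts into powers of scaled cell ends. *)
  apply: (@le_trans _ _ (full K n * (Nq / (p n)%:R ^+ (K * m)))); last first.
    by rewrite mulrA -E ler_pdivrMr// ler_wpM2l.
  rewrite /L; apply: ler_wpM2l => //; rewrite ler_pdivlMr//.
  apply: le_trans (card_injective_in_cells m (ab n)).
  rewrite mulrBl mulrBl mul1r divfK ?gt_eqF// lerD2r.
  rewrite mulnC exprM -[X in _ * X](_ : \prod_(i < K) (p n)%:R ^+ m = _); last first.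
    by rewrite prodr_const card_ord -exprM.
  rewrite -big_split/=; rewrite le_eqVlt; apply/orP; left; apply/eqP.
  apply: eq_bigr => i _; rewrite mulrBl !expr_div_n !divfK//;
    by rewrite expf_neq0// pnatr_eq0 -lt0n.
have full_cvg : full K n @[n --> \oo] --> (1 : R).
  apply/cvgrPdist_le => e1 e10; near=> n.
  have h1 : 1 - e1 <= full K n by near: n; exact: top_event_near.
  have h2 : full K n <= 1 by apply: Pr_le1; exact: (measurable_top_event (Xiid n) (mg n)).
  by rewrite ger0_norm; lra.
set rho := \prod_(i < K) _.
have cvgXm (v : nat -> R) (l : R) : v n @[n --> \oo] --> l -> v n ^+ m @[n --> \oo] --> l ^+ m.
  by move=> vl; apply: (cvg_comp v (fun x => x ^+ m) vl); exact: exprn_continuous.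
have Lcvg : L n @[n --> \oo] --> rho.
  rewrite [X in _ --> X](_ : _ = 1 * (rho - (1 - 1))); last by rewrite subrr subr0 mul1r.
  apply: cvgM => //; apply: (@cvgB R R^o).
    apply: cvg_fin_prod => i; apply: (@cvgB R R^o).
      by apply: cvgXm; exact: cvg_divn.
    by apply: cvgXm; exact: cvg_divn.
  by apply: (@cvgB R R^o); [exact: cvg_cst|exact: cvg_ffact].
near=> n; apply: le_trans (LP n).
apply: ltW; near: n; apply: (cvgr_gt _ Lcvg).
by rewrite ltrBlDr ltrDl.
Unshelve. all: by end_near. Qed.

End cells.
End triangular_array.
Set Implicit Arguments.
(** * Cells as labels *)

Section label_weights.
Context {R : realType}.
Variables (m : nat).
Hypothesis m_gt0 : (0 < m)%N.

(* The probability that the largest component of a uniform point of the simplex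
   lies in ]c / q, (c + 1) / q]. *)
Definition weight q (c : nat) : R := (c.+1%:R / q%:R) ^+ m - (c%:R / q%:R) ^+ m.

Lemma exprB_le (x y : R) : 0 <= y -> y <= x -> x <= 1 -> x ^+ m - y ^+ m <= m%:R * (x - y).
Proof.
move=> y0 yx x1; rewrite subrXX mulrC; apply: ler_wpM2r; first by rewrite subr_ge0.
rewrite -[m in leRHS]card_ord -sum1_card natr_sum; apply: ler_sum => i _.
have x0 := le_trans y0 yx.
by rewrite mulr_ile1 ?exprn_ge0// exprn_ile1// (le_trans yx).
Qed.

Lemma weight_ge0 q c : 0 <= weight q c.
Proof.
rewrite /weight subr_ge0 lerXn2r ?nnegrE ?divr_ge0 ?ler0n//.
by rewrite ler_wpM2r ?invr_ge0 ?ler0n// ler_nat.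
Qed.

Lemma weight_le q c : (c < q)%N -> weight q c <= m%:R / q%:R.
Proof.
move=> cq; have q0 : 0 < q%:R :> R by rewrite ltr0n (leq_ltn_trans _ cq).
apply: (le_trans (exprB_le _ _ _)).
- by rewrite divr_ge0 ?ler0n.
- by rewrite ler_wpM2r ?invr_ge0 ?ler0n// ler_nat.
- by rewrite ler_pdivrMr// mul1r ler_nat.
by rewrite -mulrBl -natrB// subSnn mul1r.
Qed.

Lemma sum_weight q' q : (q' <= q)%N -> (0 < q)%N ->
  \sum_(c < q | (q' <= c)%N) weight q c = 1 - (q'%:R / q%:R) ^+ m.
Proof.
move=> qq q0; rewrite -(big_geq_mkord _ _ xpredT (weight q)).
rewrite (telescope_sumr (fun c => (c%:R / q%:R) ^+ m : R))//.
by rewrite divff ?expr1n// pnatr_eq0 -lt0n.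
Qed.

Lemma sum_weight1 q : (0 < q)%N -> \sum_(c < q) weight q c = 1.
Proof.
move=> q0; have := sum_weight (leq0n q) q0.
by rewrite mul0r expr0n gtn_eqF// subr0.
Qed.

Variables (K k q' : nat).
Let q := (k.+1 * q')%N.
Hypothesis q'_gt0 : (0 < q')%N.

Let q_gt0 : (0 < q)%N. Proof. by rewrite muln_gt0. Qed.

(* Distinct cells fix the order of the points in them; one cell below 1 / (k + 1)
   ensures that the records above this threshold are among the points in cells. *)
Definition good_label (j : {ffun 'I_K -> 'I_q}) : bool :=
  injectiveb j && [exists i, (j i < q')%N].

Let rho (j : {ffun 'I_K -> 'I_q}) : R := \prod_(i < K) weight q (j i).

Let rho_ge0 j : 0 <= rho j.
Proof. by apply: prodr_ge0 => i _; exact: weight_ge0. Qed.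

Let sum_rho (Q : 'I_K -> pred 'I_q) :
  \sum_(j in family Q) rho j = \prod_(i < K) \sum_(c < q | Q i c) weight q c.
Proof. by rewrite bigA_distr_big_dep. Qed.

Let sum_rho_large :
  \sum_(j : {ffun 'I_K -> 'I_q} | [forall i, (q' <= j i)%N]) rho j =
  (1 - (k.+1%:R^-1) ^+ m) ^+ K.
Proof.
rewrite (eq_bigl (fun j => j \in family (fun _ => [pred c : 'I_q | (q' <= c)%N]))); last first.
  by move=> j; apply/forallP/familyP => h i; have := h i; rewrite ?inE.
rewrite sum_rho prodr_const card_ord; congr (_ ^+ _).
rewrite (eq_bigl (fun c : 'I_q => (q' <= c)%N))// sum_weight ?leq_pmull//.
rewrite /q natrM invfM mulrCA mulfV ?mulr1// pnatr_eq0 -lt0n//.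
Qed.

(** Given the cell of [i], the label of [i'] falls in the same cell with weight at most m / q. *)
Let sum_rho_tie (i i' : 'I_K) : i != i' ->
  \sum_(j : {ffun 'I_K -> 'I_q} | j i == j i') rho j <= m%:R / q%:R.
Proof.
move=> ii'; rewrite (partition_big (fun j : {ffun 'I_K -> 'I_q} => j i) xpredT)//=.
apply: (@le_trans _ _ (\sum_(c < q) weight q c * (m%:R / q%:R))); last first.
  by rewrite -mulr_suml sum_weight1// mul1r.
apply: ler_sum => c _.
pose Q (x : 'I_K) := [pred c' : 'I_q | (x \in [:: i; i']) ==> (c' == c)].
rewrite (eq_bigl (fun j => j \in family Q)); last first.
  move=> j; apply/andP/familyP => [[/eqP jj /eqP jc] x|h].
    by rewrite !inE; apply/implyP => /orP[] /eqP ->; rewrite -?jj jc.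
  have := h i; have := h i'; rewrite !inE !eqxx orbT /= => /eqP -> /eqP ->.
  by rewrite eqxx.
rewrite sum_rho (bigD1 i)//= (bigD1 i')//=; last by rewrite eq_sym.
rewrite (big_pred1 c); last by move=> c'; rewrite !inE eqxx.
rewrite (big_pred1 c); last by move=> c'; rewrite !inE eqxx orbT.
rewrite big1 ?mulr1.
  by rewrite ler_wpM2l ?weight_ge0// weight_le.
move=> x /andP[xi xi']; rewrite -[RHS](sum_weight1 q_gt0); apply: eq_bigl => c'.
by rewrite !inE (negPf xi) (negPf xi').
Qed.

(** A label is bad if all its cells start at or above 1 / (k + 1) or if two of them coincide; the
    two subtracted terms bound these cases. *)
Lemma good_label_weight :
  1 - (1 - (k.+1%:R^-1) ^+ m) ^+ K - (K * K)%:R * (m%:R / q%:R) <=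
  \sum_(j | good_label j) rho j <= 1.
Proof.
have tot : \sum_j rho j = 1.
  rewrite (eq_bigl (fun j => j \in family (fun _ => [pred c : 'I_q | true]))); last first.
    by move=> j; apply/esym/familyP.
  by rewrite sum_rho big1// => i _; exact: sum_weight1.
have split_ : 1 = \sum_(j | good_label j) rho j + \sum_(j | ~~ good_label j) rho j.
  by rewrite -tot (bigID good_label).
apply/andP; split; last first.
  by rewrite split_ lerDl sumr_ge0.
suff : \sum_(j | ~~ good_label j) rho j <=
  (1 - (k.+1%:R^-1) ^+ m) ^+ K + (K * K)%:R * (m%:R / q%:R) by lra.
apply: (@le_trans _ _ (\sum_(j : {ffun 'I_K -> 'I_q} | [forall i, (q' <= j i)%N]) rho j +
  \sum_(x : 'I_K * 'I_K | x.1 != x.2) \sum_(j : {ffun 'I_K -> 'I_q} | j x.1 == j x.2) rho j)).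
  under [X in _ <= _ + X]eq_bigr do rewrite big_mkcond.
  rewrite exchange_big/= [leLHS]big_mkcond [X in _ <= X + _]big_mkcond -big_split/=.
  apply: ler_sum => j _; case: ifP => [|_]; last first.
    by rewrite addr_ge0//; [case: ifP|apply: sumr_ge0 => x _; case: ifP].
  rewrite /good_label negb_and => /orP[ninj|nsmall]; last first.
    have -> : [forall i, (q' <= j i)%N].
      by apply/forallP => i; rewrite leqNgt; apply: contra nsmall => h; apply/existsP; exists i.
    by rewrite lerDl; apply: sumr_ge0 => x _; case: ifP.
  have [i [i' [ii' jj]]] : exists i i', i != i' /\ j i = j i'.
    case/injectivePn: ninj => i [i' ii' jj]; by exists i, i'.
  rewrite ler_wpDl//; first by case: ifP.
  rewrite (bigD1 (i, i'))//= jj eqxx lerDl; apply: sumr_ge0 => x _; case: ifP => //.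
rewrite sum_rho_large lerD2l.
apply: (@le_trans _ _ (\sum_(x : 'I_K * 'I_K | x.1 != x.2) (m%:R / q%:R))).
  by apply: ler_sum => x; exact: sum_rho_tie.
rewrite sumr_const -[leLHS]mulr_natl; apply: ler_wpM2r; first by rewrite divr_ge0 ?ler0n.
by rewrite ler_nat -[K in leqRHS]card_ord -card_prod max_card.
Qed.

End label_weights.

Section label_scheme.
Context {R : realType}.
Variables (m : nat).
Hypothesis m_gt0 : (0 < m)%N.

Lemma label_scheme : exists s : nat -> nat * nat, forall k,
  [/\ (k <= (s k).1)%N, (0 < (s k).2)%N &
   1 - 2 / k.+1%:R <= \sum_(j : {ffun 'I_(s k).1 -> 'I_(k.+1 * (s k).2)} | good_label j)
      \prod_(i < (s k).1) (weight m (k.+1 * (s k).2) (j i) : R) <= 1].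
Proof.
suff /choice[s sP] : forall k, exists s : nat * nat,
  [/\ (k <= s.1)%N, (0 < s.2)%N &
   1 - 2 / k.+1%:R <= \sum_(j : {ffun 'I_s.1 -> 'I_(k.+1 * s.2)} | good_label j)
      \prod_(i < s.1) (weight m (k.+1 * s.2) (j i) : R) <= 1] by exists s.
move=> k; have k0 : 0 < k.+1%:R :> R by rewrite ltr0n.
set c : R := 1 - (k.+1%:R^-1) ^+ m.
have c01 : 0 <= c < 1.
  apply/andP; split; first by rewrite subr_ge0 exprn_ile1 ?invr_ge0 ?invf_le1// ?ler1n.
  by rewrite /c ltrBlDr ltrDl exprn_gt0// invr_gt0.
have [K kK cK] : exists2 K, (k <= K)%N & c ^+ K <= k.+1%:R^-1.
  have : (GRing.exp c : R^nat) @ \oo --> 0.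
    by apply: cvg_expr; rewrite ger0_norm; case/andP: c01.
  move=> /cvgrPdist_le/(_ k.+1%:R^-1); rewrite invr_gt0 => /(_ k0)[N _ HN].
  exists (maxn k N); first exact: leq_maxl.
  have := HN _ (leq_maxr k N); rewrite sub0r normrN; exact: le_trans (ler_norm _).
(* [K] depends on [k] and [m] only; the second component is then large enough for the tie term of
   [good_label_weight] to be at most 1 / (k + 1). *)
exists (K, (K * K * m).+1) => /=; split => //.
have /andP[h1 h2] := @good_label_weight R m m_gt0 K k (K * K * m).+1 (ltn0Sn _).
apply/andP; split => //; apply: le_trans h1.
have h3 : (K * K)%:R * (m%:R / (k.+1 * (K * K * m).+1)%:R) <= k.+1%:R^-1 :> R.
  rewrite mulrA -natrM [(k.+1 * _)%:R]natrM invfM mulrCA ler_piMr ?invr_ge0 ?ler0n//.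
  by rewrite ler_pdivrMr ?ltr0n// mul1r ler_nat.
rewrite -/c; have -> : 2 / k.+1%:R = k.+1%:R^-1 + k.+1%:R^-1 :> R by rewrite -mulr2n mulr_natl.
by rewrite -addrA lerD2l -opprD lerN2 lerD.
Qed.

End label_scheme.

(** * Measures compatible with a choice of cells *)

Section cells_of_points.
Context {R : realType}.
Implicit Types (K q c : nat).

Definition in_cell q c (x : R) : bool := c%:R / q%:R < x <= c.+1%:R / q%:R.

Lemma in_cell_lt q c c' (x x' : R) : (0 < q)%N -> in_cell q c x -> in_cell q c' x' ->
  (c < c')%N -> x < x'.
Proof.
move=> q0 /andP[_ xc] /andP[cx' _] cc'; apply: le_lt_trans xc _; apply: le_lt_trans cx'.
by rewrite ler_wpM2r ?invr_ge0 ?ler0n// ler_nat.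
Qed.

Lemma in_cell_inj q c c' (x : R) : (0 < q)%N -> in_cell q c x -> in_cell q c' x -> c = c'.
Proof.
move=> q0 xc xc'; case: (ltngtP c c') => // cc'.
  by have := in_cell_lt q0 xc xc' cc'; rewrite ltxx.
by have := in_cell_lt q0 xc' xc cc'; rewrite ltxx.
Qed.

Lemma in_cell_div p q c x : (0 < p)%N -> (0 < q)%N ->
  ((p * c) %/ q < x <= (p * c.+1) %/ q)%N -> in_cell q c (x%:R / p%:R).
Proof.
move=> p0 q0; rewrite ltn_divLR// leq_divRL// => /andP[h1 h2].
have pR : 0 < p%:R :> R by rewrite ltr0n.
have qR : 0 < q%:R :> R by rewrite ltr0n.
rewrite /in_cell ltr_pdivrMr// mulrAC ltr_pdivlMr// -!natrM ltr_nat mulnC h1/=.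
by rewrite ler_pdivrMr// mulrAC ler_pdivlMr// -!natrM ler_nat [(c.+1 * _)%N]mulnC.
Qed.

(** Points in distinct cells are ordered as their cells are, so records can be read from the
    labels. *)
Lemma in_cell_low_record K q (j : 'I_K -> nat) (w : 'I_K -> R) : (0 < q)%N ->
  injective j -> (forall i, in_cell q (j i) (w i)) -> low_record w =1 low_record j.
Proof.
move=> q0 jinj jw; apply: eq_low_record => i i'.
have [/jinj ->|] := eqVneq (j i) (j i'); first by rewrite !ltxx.
rewrite neq_ltn => /orP[] h.
  by rewrite (in_cell_lt q0 (jw _) (jw _) h) ltEnat.
by rewrite ltNge ltW ?(in_cell_lt q0 (jw _) (jw _) h)// ltEnat/= ltnNge ltnW.
Qed.

(** Above [del], such a measure consists of the strict lower records of some points in the cells.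
    Leaving these points free lets one set contain both the sample process and the limit. *)
Definition cell_measures (del : R) q K (j : 'I_K -> nat) : set (point_measure R) :=
  [set mu | exists2 w : 'I_K -> R, (forall i, in_cell q (j i) (w i)) &
    forall phi, (forall t, 0 < t <= 1 -> t <= del -> sval phi t = 0) ->
      pm_integral mu phi = \sum_(i | low_record w i) sval phi (w i)].

End cells_of_points.

Section sample_in_cells.
Context {R : realType} d d' (T : measurableType d) (S : measurableType d').
Variables (m p K q : nat) (X : nat -> T -> S) (g : m.-tuple S -> R).
Hypothesis g_sym : forall (s : 'S_m) (y : m.-tuple S),
  g [tuple tnth y (s k) | k < m] = g y.
Hypotheses (p_gt0 : (0 < p)%N) (q_gt0 : (0 < q)%N) (m_gt0 : (0 < m)%N).
Variable om : T.

Let x := whole_sample p X om.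

(** Two top arrays of one sample have the same index sets, hence the same maxima, and a point lies
    in one cell only. *)
Lemma cell_event_inj (j j' : 'I_K -> nat) :
  cell_event p X g q j om -> cell_event p X g q j' om -> j =1 j'.
Proof.
move=> [f [fi fj ft]] [f' [f'i f'j ft']].
have ff' : same_blocks f f' by exact/(top_same_blocks g_sym m_gt0 fi f'i ft').
move: fj; rewrite (same_blocks_in_cells _ _ ff') => /forallP fj i.
by move/forallP : f'j => f'j; exact: (in_cell_inj (R := R) q_gt0 (in_cell_div _ _ (fj i)) (in_cell_div _ _ (f'j i))).
Qed.

Lemma cell_event_measures (j : 'I_K -> nat) (del : R) :
  p%:R^-1 <= del -> (exists i, (j i).+1%:R / q%:R <= del) ->
  cell_event p X g q j om ->
  cell_measures del q j (pm_of (scaled_record_time p (running_max g (X^~ om)))).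
Proof.
move=> pdel [i0 i0del] [f [fi /forallP fQ [f_dec f_top]]].
pose F i : m.-tuple nat := map_tuple val (block f i).
have wcell i : in_cell q (j i) ((next_max (F i))%:R / p%:R : R) by exact/in_cell_div/fQ.
have pR : 0 < p%:R :> R by rewrite ltr0n.
exists (fun i => (next_max (F i))%:R / p%:R) => // phi phi0.
rewrite (@top_integral _ _ _ g g_sym (X^~ om) p K F _ _ _ del) //.
- apply: eq_bigl => i; apply: eq_low_record => i1 i2.
  by rewrite ltr_pM2r ?invr_gt0// ltr_nat ltEnat.
- by move=> i; rewrite map_inj_uniq ?uniq_block//; exact: val_inj.
- by move=> i1 i2 /f_dec; rewrite !TT_whole_sample.
- move=> u uu; rewrite next_max_leq => /allP up uF i.
  have uk k : (tnth u k < p)%N by apply: up; exact: mem_tnth.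
  pose u' : m.-tuple 'I_p := [tuple Ordinal (uk k) | k < m].
  have uE : u = map_tuple val u'.
    by apply: eq_from_tnth => k; rewrite tnth_map tnth_mktuple.
  rewrite uE -!TT_whole_sample; apply: f_top.
    by move: uu; rewrite uE map_inj_uniq//; exact: val_inj.
  move=> i'; apply: contra (uF i') => h; rewrite uE; exact: perm_map.
- move=> i; apply/andP; split.
    by rewrite (leq_ltn_trans _ (proj1 (andP (fQ i)))).
  by rewrite next_max_leq; apply/allP => _ /mapP[k _ ->]; exact: ltn_ord.
by exists i0; apply: le_trans i0del; have /andP[] := wcell i0.
Qed.

End sample_in_cells.

(** * Vague convergence along shrinking cells *)

Section shrinking_cells.
Context {R : realType}.
Variables (V : nat -> R) (mu : point_measure R).
Hypothesis V01 : forall i, 0 < V i <= 1.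
Hypothesis V_small : forall del, 0 < del -> exists i, V i <= del.
Hypothesis mu_integral : forall (del : R) (phi : @test_function R) N,
  (exists i : 'I_N, V i <= del) ->
  (forall t, 0 < t <= 1 -> t <= del -> sval phi t = 0) ->
  pm_integral mu phi =
  \sum_(i < N | low_record (fun i : 'I_N => V i) i) sval phi (V i).

Let rec i := [forall i' : 'I_i, V i < V i'].

(** Being a record depends on the preceding points only, hence not on the truncation [N]. *)
Let low_recordE N (i : 'I_N) : low_record (fun i : 'I_N => V i) i = rec i.
Proof.
apply/forallP/forallP => [h i'|h i'].
  by have := h (widen_ord (ltnW (ltn_ord i)) i'); rewrite /= ltn_ord.
by apply/implyP => i'i; exact: (h (Ordinal i'i)).
Qed.

Lemma in_cell_le1 q c (x y : R) : (0 < q)%N -> in_cell q c x -> x <= 1 -> in_cell q c y ->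
  0 < y <= 1.
Proof.
move=> q0 /andP[cx _] x1 /andP[cy yc]; have qR : 0 < q%:R :> R by rewrite ltr0n.
rewrite (le_lt_trans _ cy) ?divr_ge0//= (le_trans yc)// ler_pdivrMr// mul1r ler_nat.
by have := lt_le_trans cx x1; rewrite ltr_pdivrMr// mul1r ltr_nat.
Qed.

Lemma in_cell_dist q c (x y : R) : in_cell q c x -> in_cell q c y -> `|x - y| <= q%:R^-1.
Proof.
rewrite /in_cell -natr1 mulrDl mul1r => /andP[x1 x2] /andP[y1 y2].
rewrite ler_distl; lra.
Qed.

Variables (K q : nat -> nat) (s : nat -> point_measure R).
Hypothesis K_ge : forall k, (k <= K k)%N.
Hypothesis q_gt : forall k, (k < q k)%N.
Hypothesis s_cells : forall k, s k = mu \/ exists j : 'I_(K k) -> nat,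
  [/\ injective j, forall i : 'I_(K k), in_cell (q k) (j i) (V i) &
      cell_measures k.+1%:R^-1 (q k) j (s k)].

Let small_del (del : R) : 0 < del -> exists k0, forall k, (k0 <= k)%N -> k.+1%:R^-1 <= del.
Proof.
move=> del0; have [N _ HN] := @near_infty_natSinv_lt R (PosNum del0).
by exists N => k /HN/ltW.
Qed.

(** Since [V i0 <= del / 2] and cells displace points by at most [del / 2], the point of index [i0]
    stays at or below [del]. Later records are smaller still and invisible to [phi]; the distinct
    labels make the records the same as for [V]. *)
Lemma cell_points (phi : @test_function R) (del : R) i0 k :
  (forall t, 0 < t <= 1 -> t <= del -> sval phi t = 0) ->
  V i0 <= del / 2 -> (i0 < k)%N -> k.+1%:R^-1 <= del / 2 ->
  exists W : nat -> R, (forall i, 0 < W i <= 1 /\ `|V i - W i| <= k.+1%:R^-1) /\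
    pm_integral (s k) phi = \sum_(i < i0.+1 | rec i) sval phi (W i).
Proof.
move=> phi0 Vi0 i0k kdel.
have del2 : del / 2 <= del by have := V01 i0; lra.
have i0K : (i0.+1 <= K k)%N by exact: leq_trans i0k (K_ge k).
have qk : (q k)%:R^-1 <= k.+1%:R^-1 :> R.
  by rewrite lef_pV2 ?posrE ?ltr0n ?(leq_ltn_trans _ (q_gt k))// ler_nat.
have q0 : (0 < q k)%N by exact: leq_ltn_trans (q_gt k).
have [->|[j [jinj jV [w jw sw]]]] := s_cells k.
  exists V; split=> [i|]; first by split=> //; rewrite subrr normr0.
  rewrite (mu_integral (N := i0.+1) _ phi0); last first.
    by exists ord_max; exact: le_trans del2.
  by apply: eq_bigl => i; rewrite low_recordE.
have recE : low_record w =1 (fun i => rec i).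
  move=> i; rewrite (in_cell_low_record q0 jinj jw) -(in_cell_low_record q0 jinj jV).
  exact: low_recordE.
(* Beyond the [K k] points in cells, [W] is completed by [V], which keeps the distance bound valid
   for every index. *)
pose W i := oapp w (V i) (insub i).
have WE (i : 'I_(K k)) : W i = w i by rewrite /W valK.
have w01 i : 0 < w i <= 1.
  by apply: (in_cell_le1 q0 (jV i)) => //; have /andP[] := V01 i.
have Vw (i : 'I_(K k)) : `|V i - w i| <= k.+1%:R^-1.
  exact: le_trans (in_cell_dist (jV i) (jw i)) qk.
exists W; split=> [i|].
  rewrite /W; case: insubP => [i' _ <- /=|_ /=]; first by split.
  by rewrite subrr normr0.
rewrite (big_ord_widen_cond (K k) (fun i => rec i) (fun i => sval phi (W i)))//.
rewrite (sw phi); last first.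
  by move=> t t01 tk; apply: phi0 => //; apply: (le_trans tk); exact: le_trans del2.
rewrite [RHS]big_mkcondr/=; apply: eq_big => [i|i ri]; first exact: recE.
rewrite WE; case: ifPn => //; rewrite -leqNgt => i0i.
have wi : w i < w (widen_ord i0K ord_max).
  by have /forallP/(_ (widen_ord i0K ord_max))/implyP := ri; apply.
apply: phi0 => //; apply: ltW; apply: (lt_le_trans wi).
have := Vw (widen_ord i0K ord_max); rewrite ler_distl lerBlDr => /andP[+ _].
by move=> /le_trans; apply; rewrite [leRHS](splitr del) lerD.
Qed.

(** For large [k] the integrals run over the same finitely many records, whose points converge;
    [phi] is continuous at their limits. *)
Lemma cvg_cell_measures : s k @[k --> \oo] --> mu.
Proof.
apply: vague_cvg => phi; have [del del0 phi0] := test_function_support phi.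
have [i0 Vi0] : exists i, V i <= del / 2 by apply: V_small; rewrite divr_gt0.
have [k0 hk0] := @small_del (del / 2) (divr_gt0 del0 (ltr0Sn _ 1)).
have /choice[W HW] : forall k, exists W : nat -> R,
    (forall i, 0 < W i <= 1 /\ `|V i - W i| <= k.+1%:R^-1) /\
    ((maxn k0 i0.+1 <= k)%N -> pm_integral (s k) phi = \sum_(i < i0.+1 | rec i) sval phi (W i)).
  move=> k; have [hk|hk] := leqP (maxn k0 i0.+1) k; last first.
    exists V; split=> // i; split=> //; rewrite subrr normr0 invr_ge0; exact: ler0n.
  have [|W [W1 W2]] := cell_points phi0 Vi0 _ (hk0 _ (leq_trans (leq_maxl _ _) hk)).
    exact: leq_trans (leq_maxr _ _) hk.
  by exists W.
rewrite (mu_integral (N := i0.+1) _ phi0); last first.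
  by exists ord_max => /=; have := V01 i0; lra.
rewrite (eq_bigl (fun i : 'I_i0.+1 => rec i)); last by move=> i; exact: low_recordE.
have WV i : W k i @[k --> \oo] --> V i.
  apply/cvgrPdist_le => e e0; have [N HN] := small_del e0.
  by exists N => // k /= /HN; apply: le_trans; have [/(_ i)[]] := HW k.
apply: (@cvg_trans _ (\sum_(i < i0.+1 | rec i) sval phi (W k i) @[k --> \oo])).
  apply: near_eq_cvg; exists (maxn k0 i0.+1) => // k /= hk.
  by have [_ ->] := HW k.
have [_ cphi _] := svalP phi.
apply: cvg_fin_sum => i _.
have /subspace_continuousP/(_ (V i)) := cphi.
rewrite /= in_itv/= => /(_ (V01 i)) h.
apply: (cvg_comp (fun k => W k i) (sval phi) _ h) => A [r r0 rA].
move/cvgrPdist_lt : (WV i) => /(_ r r0)[N _ HN]; exists N => // k /= /HN Vr.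
by apply: rA => //=; rewrite in_itv/=; have [/(_ i)[]] := HW k.
Qed.

End shrinking_cells.

(** * The limit process on regular samples *)

Section limit_in_cells.
Context {R : realType}.
Variables (H : evd R) (m : nat) (u : nat -> m.-tuple R) (e : nat -> R).
Variable x : nat -> option R.

(** The almost sure properties under which the discontinuities are the strict lower records of the
    last components. *)
Definition regular_sample :=
  [/\ forall i, 0 < e i, forall i, 0 < last 0 (u i) <= 1 &
      forall k, exists i, last 0 (u i) <= k.+1%:R^-1].

Hypothesis ue : regular_sample.
Hypothesis x_enum : enumerates (discontinuities (limit_path H u e)) x.

Let V_small (del : R) : 0 < del -> exists i, last 0 (u i) <= del.
Proof.
move=> del0; have [_ _ uk] := ue.
have [N _ /(_ N (leqnn N))] := @near_infty_natSinv_lt R (PosNum del0).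
by have [i ui] := uk N; exists i; apply: (le_trans ui); exact: ltW.
Qed.

Lemma limit_cell_measures (del : R) q K (j : 'I_K -> nat) :
  (forall i : 'I_K, in_cell q (j i) (last 0 (u i))) ->
  (exists i, (j i).+1%:R / q%:R <= del) ->
  cell_measures del q j (pm_of x).
Proof.
move=> ju [i ji]; have [e0 u01 _] := ue.
exists (fun i : 'I_K => last 0 (u i)) => // phi phi0.
apply: (limit_integral e0 u01 V_small x_enum) phi0.
by exists i; have /andP[_] := ju i; move=> /le_trans; apply.
Qed.

Lemma cvg_cells_limit (K q : nat -> nat) (s : nat -> point_measure R) :
  (forall k, (k <= K k)%N) -> (forall k, (k < q k)%N) ->
  (forall k, s k = pm_of x \/ exists j : 'I_(K k) -> nat,
    [/\ injective j, forall i : 'I_(K k), in_cell (q k) (j i) (last 0 (u i)) &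
      cell_measures k.+1%:R^-1 (q k) j (s k)]) ->
  s k @[k --> \oo] --> pm_of x.
Proof.
move=> Kk qk sk; have [e0 u01 _] := ue.
apply: (cvg_cell_measures u01 V_small _ Kk qk sk) => del phi N Vdel phi0.
exact: (limit_integral e0 u01 V_small x_enum Vdel phi0).
Qed.

End limit_in_cells.

(** * Cell criterion applied to the record times *)

Unset Implicit Arguments.
Set Strict Implicit.

Theorem theorem2p6 (R : realType) (m : nat) (p : nat -> nat)
  (* probability spaces and samples; X n i is the vector x_(i+1) in R^n *)
  (d : nat -> measure_display) (T : forall n, measurableType (d n))
  (P : forall n, probability (T n) R)
  (X : forall n, nat -> T n -> n.-tuple R)
  (v w : \bar R) (g : forall n, m.-tuple (n.-tuple R) -> R)
  (mu : R -> R) (H : evd R)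
  (* limiting process *)
  (d' : measure_display) (T' : measurableType d') (P' : probability T' R)
  (U : nat -> T' -> m.-tuple R) (E : nat -> T' -> R)
  (tau : T' -> nat -> option R)
  (m_gt0 : (0 < m)%N)
  (p_gt0 : forall n, (0 < p n)%N)
  (p_cvg : p n @[n --> \oo] --> \oo)
  (X_iid : forall n, iid (P n) [set i | (i < p n)%N] (X n))
  (vw : (v < w)%E)
  (g_range : forall n y, (v < (g n y)%:E < w)%E)
  (g_meas : forall n, measurable_fun setT (g n))
  (g_sym : forall n (s : 'S_m) (y : m.-tuple (n.-tuple R)),
      g n [tuple tnth y (s k) | k < m] = g n y)
  (mu_ge0 : forall x : R, (v < x%:E < w)%E -> 0 <= mu x)
  (mu_left : mu (fine y) @[y --> within [set y | (v < y < w)%E] (nbhs v)]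
               --> +oo)
  (mu_right : mu (fine y) @[y --> within [set y | (v < y < w)%E] (nbhs w)]
               --> (0 : R))
  (A1 : forall x : R, (v < x%:E < w)%E ->
      'C(p n, m)%:R *
        fine (P n [set om | x < g n [tuple X n k om | k < m]])
      @[n --> \oo] --> mu x)
  (A2 : forall x : R, (v < x%:E < w)%E -> forall l, (0 < l < m)%N ->
      (fun n => fine (P n [set om |
         x < g n [tuple X n k om | k < m] /\
         x < g n [tuple X n (m - l + k)%N om | k < m]]))
      =o_\oo (fun n => (p n)%:R ^- (2 * m - l) : R))
  (H_left : v = evd_left H) (H_right : w = evd_right H)
  (H_mu : forall x : R, (v < x%:E < w)%E -> expR (- mu x) = evd_cdf H x)
  (U_iid : iid P' setT U) (U_unif : forall i, uniform_law P' (simplex R m) (U i))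
  (E_iid : iid P' setT E) (E_exp : forall i, exponential_law P' 1 (E i))
  (UE_indep : independent_sequences P' U E)
  (tau_enum : forall om,
      enumerates
        (discontinuities (limit_path H (fun i => U i om) (fun i => E i om)))
        (tau om)) :
  cvg_in_distribution P
    (fun n om => pm_of (scaled_record_time (p n)
                          (running_max (g n) (fun i => X n i om))))
    P' (fun om => pm_of (tau om)).
Proof.
pose lvl := evd_level H.
have lvl_range a : 0 < a -> (v < (lvl a)%:E < w)%E.
  by rewrite H_left H_right; exact: evd_level_range.
have mu_lvl a : 0 < a -> mu (lvl a) = a.
  move=> a0; have := H_mu _ (lvl_range _ a0).
  by rewrite evd_cdf_level// => /expR_inj/oppr_inj.
have A1' a : 0 < a ->
    'C(p n, m)%:R * Pr0 (P n) (X n) (g n) `]lvl a, +oo[ @[n --> \oo] --> a.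
  move=> a0; rewrite -[X in _ --> X](mu_lvl _ a0).
  rewrite (_ : (fun n => _) = (fun n => 'C(p n, m)%:R *
    fine (P n [set om | lvl a < g n [tuple X n k om | k < m]]))).
    exact: A1 (lvl_range _ a0).
  apply/funext => n; congr (_ * fine (P n _)).
  by apply/seteqP; split => om; rewrite /= in_itv/= andbT.
have A2' a : 0 < a ->
    overlap_weight (P n) (p n) (X n) (g n) (lvl a) @[n --> \oo] --> (0 : R).
  move=> a0; rewrite [X in _ --> X](_ : 0 = \sum_(l < m | (0 < l)%N) 0); last by rewrite big1.
  apply: cvg_fin_sum => l l0; apply/cvgrPdist_le => e e0.
  have lm : (0 < l < m)%N by rewrite l0 ltn_ord.
  have /eqoP/(_ e e0) := A2 _ (lvl_range _ a0) _ lm.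
  apply: filterS => n; rewrite sub0r normrN normrM natrX normrV ?unitfE ?expf_neq0 ?pnatr_eq0 -?lt0n//.
  rewrite ler_pdivlMr ?normr_gt0 ?expf_neq0 ?pnatr_eq0 -?lt0n// mulrC.
  exact.
have [sch schP] := @label_scheme R m m_gt0.
pose K k := (sch k).1; pose q k := (k.+1 * (sch k).2)%N.
have q_gt k : (k < q k)%N by rewrite /q leq_pmulr//; have [] := schP k.
have q0 k : (0 < q k)%N by exact: leq_ltn_trans (q_gt k).
have K_ge k : (k <= K k)%N by have [] := schP k.
pose V i om : R := last 0 (U i om).
pose I k : finType := {ffun 'I_(K k) -> 'I_(q k)}.
have [N [mN PN Nreg]] : P'.-negligible
    (~` [set om | regular_sample (fun i => U i om) (fun i => E i om)]).
  have := ae_last01 m_gt0 U_iid U_unif; have := ae_last_small m_gt0 U_iid U_unif.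
  have := ae_exponential_gt0 E_iid E_exp; apply: filterS3 => om h1 h2 h3.
  by split.
have reg om : ~ N om -> regular_sample (fun i => U i om) (fun i => E i om).
  by move=> Nom; apply: contrapT => nr; apply: Nom; exact: Nreg.
pose good k (j : I k) := @good_label (K k) k (sch k).2 j.
pose cells k (j : I k) := [set om | forall i : 'I_(K k), in_cell (q k) (j i) (V i om)].
(* [k < p n] puts the scaled time 1 / p at or below the threshold 1 / (k + 1), where the automatic
   first record is not seen. *)
pose A n k (j : I k) : set (T n) :=
  if good k j && (k < p n)%N then cell_event (p n) (X n) (g n) (q k) (fun i => j i : nat) else set0.
(* Removing the measurable null set [N] leaves regular samples only; on [N] itself no cell applies,
   and the selections of the shrinking condition are constant. *)
pose B k (j : I k) : set T' := if good k j then cells k j `\` N else set0.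
pose C k (j : I k) := cell_measures k.+1%:R^-1 (q k) (fun i => j i : nat) : set (point_measure R).
have mcells k j : measurable (cells k j).
  exact: (measurable_cells m_gt0 U_iid).
have good_small k j : good k j -> exists i, (j i).+1%:R / (q k)%:R <= k.+1%:R^-1 :> R.
  case/andP => _ /existsP[i ji]; exists i.
  rewrite /q natrM invfM mulrCA ler_piMr ?invr_ge0 ?ler0n// ler_pdivrMr ?mul1r ?ler_nat//.
  by rewrite ltr0n; have [] := schP k.
have PB k j : good k j -> fine (P' (B k j)) = \prod_(i < K k) weight m (q k) (j i).
  move=> gj; have <- : fine (P' (cells k j)) = \prod_(i < K k) weight m (q k) (j i).
    rewrite /cells /in_cell (P_cells m_gt0 U_iid U_unif)//.
      move=> i; rewrite divr_ge0//= ler_wpM2r ?invr_ge0// ler_nat//.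
    by move=> i; rewrite ler_pdivrMr ?ltr0n// mul1r ler_nat.
  rewrite /B gj measureD//; last by rewrite -ge0_fin_numE// fin_num_measure.
  rewrite [X in (_ - X)%E](_ : _ = 0%E) ?sube0//.
  by apply: (subset_measure0 _ mN) PN => //; exact: measurableI.
apply: (@cvg_in_distribution_cells R _ d T P _ d' T' P' _ I A B C).
- move=> n k j; rewrite /A; case: ifP => // _.
  exact: (measurable_cell_event _ _ (X_iid n) (g_meas n)).
- move=> n k j j' om; rewrite /A; case: ifP => // _; case: ifP => // _ jom j'om.
  apply/ffunP => i; apply/val_inj.
  exact: (cell_event_inj (g_sym n) (p_gt0 n) (q0 k) m_gt0 jom j'om).
- move=> n k j om; rewrite /A; case: ifP => // /andP[gj kp] jom.
  apply: (cell_event_measures (g_sym n) (p_gt0 n) (q0 k) _ (good_small _ _ gj) jom).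
  by rewrite lef_pV2 ?posrE ?ltr0n// ler_nat.
- by move=> k j; rewrite /B; case: ifP => // _; exact: measurableD.
- move=> k j j' om; rewrite /B; case: ifP => // _; case: ifP => // _ [jom _] [j'om _].
  apply/ffunP => i; apply/val_inj; exact: (in_cell_inj (q0 k) (jom i) (j'om i)).
- move=> k j om; rewrite /B; case: ifP => // gj [jom Nom].
  exact: (limit_cell_measures (reg _ Nom) (tau_enum om) jom (good_small _ _ gj)).
- move=> k j e e0; have [gj|gj] := boolP (good k j); last first.
    by apply: nearW => n; rewrite /A /B (negPf gj)/= !measure0 sub0r oppr_le0 ltW.
  rewrite PB//; near=> n.
  have kp : (k < p n)%N by near: n; exact: (cvgnyPgt _).1.
  rewrite /A gj kp; near: n.
  apply: (cell_event_near d T P _ _ m p X g m_gt0 p_gt0 p_cvg X_iid g_meas g_sym lvl _ A1' A2' (K k) (q k)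
     (fun i => j i : nat)) => //.
  exact: evd_level_lt.
- apply: (@squeeze_cvgr _ _ _ _ (fun k => 1 - 2 / k.+1%:R) (fun=> 1)); last exact: cvg_cst.
    apply: nearW => k.
    rewrite (_ : \sum_i _ = \sum_(j | good k j) \prod_(i < K k) weight m (q k) (j i)).
      by have [_ _] := schP k.
    rewrite [RHS]big_mkcond; apply: eq_bigr => j _; case: ifPn => [/PB//|gj].
    by rewrite /B (negPf gj) measure0.
  rewrite -[X in _ --> X]subr0; apply: (@cvgB R R^o); first exact: cvg_cst.
  rewrite -(mulr0 2); apply: (@cvgM R); first exact: cvg_cst.
  exact: cvg_harmonic.
move=> om s sC sN; have [Nom|Nom] := pselect (N om).
  rewrite (_ : s = fun=> pm_of (tau om)); first exact: cvg_cst.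
  apply/funext => k; apply: sN => j; rewrite /B; by case: ifP => // _ [].
apply: (cvg_cells_limit (reg _ Nom) (tau_enum om) K_ge q_gt) => k.
have [[j Bj]|nB] := pselect (exists j, B k j om); last first.
  by left; apply: sN => j Bj; apply: nB; exists j.
right; have sj := sC _ _ Bj; move: Bj; rewrite /B; case: ifP => // gj [jom _].
exists (fun i => j i : nat); split=> //.
by case/andP: gj => /injectiveP jinj _ i i' /val_inj/jinj.
Unshelve. all: by end_near. Qed.
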